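(* Let $d\ge 1$ be an integer. There are constants $\gamma>0$ and $C>0$ depending only on $d$ such that for every $f\in \mathrm{Log}_{d-1}(L)(\mathbb{T}^d)$ that is not almost everywhere zero and every $\varepsilon>0$ there exists a measurable set $E=E_{f,\varepsilon}\subset\mathbb{T}^d$ such that $$|E_{f,\varepsilon}|>(2\pi)^d-\varepsilon$$ and $$\int_{E_{f,\varepsilon}}\exp\left(\gamma\varepsilon\,\frac{|S_nf(\mathbf{x})|+|\tilde S_nf(\mathbf{x})|}{\|f\|_{\mathrm{Log}_{d-1}(L)}}\right)d\mathbf{x}\le C\quad\text{for all } n=1,2,\ldots .$$
   Context: $\mathbb{T}=\mathbb{R}/2\pi\mathbb{Z}$, $\mathbb{T}^d$ is the $d$-dimensional torus, and $|E|$ denotes Lebesgue measure (so $|\mathbb{T}^d|=(2\pi)^d$). For an integer $k\ge 0$ put $\mathrm{Log}_k(u)=|u|\max\{0,\log^k|u|\}$, with $\mathrm{Log}_k(0)=0$; in particular $\mathrm{Log}_0(u)=|u|$. The class is $$\mathrm{Log}_k(L)(\mathbb{T}^d)=\Big\{f\in L^1(\mathbb{T}^d):\int_{\mathbb{T}^d}\mathrm{Log}_k(f)<\infty\Big\},$$ with the Luxemburg norm $$\|f\|_{\mathrm{Log}_k(L)}=\inf\Big\{\lambda>0:\int_{\mathbb{T}^d}\mathrm{Log}_k(f/\lambda)\le 1\Big\}.$$ For $f\in L^1(\mathbb{T}^d)$ the Fourier coefficients are $a_{\mathbf{k}}=\frac{1}{(2\pi)^d}\int_{\mathbb{T}^d}f(\mathbf{x})e^{-i\mathbf{k}\cdot\mathbf{x}}d\mathbf{x}$,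 $\mathbf{k}=(k_1,\ldots,k_d)\in\mathbb{Z}^d$. The square partial sums of the Fourier series and of its conjugate series are $$S_nf(\mathbf{x})=\sum_{-n\le k_j\le n,\ j=1,\ldots,d}a_{\mathbf{k}}e^{i\mathbf{k}\cdot\mathbf{x}},\qquad \tilde S_nf(\mathbf{x})=\sum_{-n\le k_j\le n,\ j=1,\ldots,d}\Big(\prod_{j=1}^d(-i\,\mathrm{sgn}\,k_j)\Big)a_{\mathbf{k}}e^{i\mathbf{k}\cdot\mathbf{x}},$$ where $\mathrm{sgn}\,0=0$. *)

(* Defs.v *)
From HB Require Import structures.
From mathcomp Require Import all_boot all_order all_algebra.
From mathcomp Require Import all_classical all_reals all_analysis.
From mathcomp Require Import complex.
Set Implicit Arguments.
Unset Strict Implicit.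
Unset Printing Implicit Defensive.
Import Order.TTheory GRing.Theory Num.Theory.
Import numFieldNormedType.Exports.

Local Open Scope classical_set_scope.
Local Open Scope ring_scope.

Section tuple_measure.
Local Open Scope ereal_scope.
Context {d : measure_display} {T : measurableType d} {R : realType}.

(* The [n]-fold product of a sigma-finite measure, on [n.-tuple T]. *)

Definition tcons n (p : T * n.-tuple T) : n.+1.-tuple T :=
  [tuple of p.1 :: p.2].

Lemma measurable_tcons n : measurable_fun setT (@tcons n).
Proof. by apply: measurable_cons. Qed.

Lemma measurable_preimage_tcons n (A : set (n.+1.-tuple T)) :
  measurable A -> measurable (@tcons n @^-1` A).
Proof. by move=> mA; rewrite -[X in measurable X]setTI; exact: measurable_tcons. Qed.

Section cons_measure.
Variables (mu : {sigma_finite_measure set T -> \bar R}) (n : nat).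
Variable m : {sigma_finite_measure set (n.-tuple T) -> \bar R}.

Definition cons_measure : set (n.+1.-tuple T) -> \bar R :=
  pushforward (mu \x m) (@tcons n).

Let cons_measure0 : cons_measure set0 = 0.
Proof. by rewrite /cons_measure /pushforward preimage_set0 measure0. Qed.

Let cons_measure_ge0 A : 0 <= cons_measure A.
Proof. by rewrite /cons_measure /pushforward; exact: measure_ge0. Qed.

Let cons_measure_sigma_additive : semi_sigma_additive cons_measure.
Proof.
move=> F mF tF mUF; rewrite /cons_measure /pushforward preimage_bigcup.
apply: measure_semi_sigma_additive.
- by move=> k; exact: measurable_preimage_tcons.
- apply/trivIsetP => /= i j _ _ ij; rewrite -preimage_setI.
  by move/trivIsetP : tF => /(_ _ _ _ _ ij) ->//; rewrite preimage_set0.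
- by rewrite -preimage_bigcup; exact: measurable_preimage_tcons.
Qed.

HB.instance Definition _ := isMeasure.Build _ _ _ cons_measure
  cons_measure0 cons_measure_ge0 cons_measure_sigma_additive.

Let cons_measure_sigma_finite : sigma_finite setT cons_measure.
Proof.
have /sigma_finiteP[F [TF ndF Foo]] := sigma_finiteT mu.
have /sigma_finiteP[G [TG ndG Goo]] := sigma_finiteT m.
pose g (x : n.+1.-tuple T) := (thead x, [tuple of behead x]).
have mg : measurable_fun setT g.
  apply/measurable_fun_pair => /=.
    exact: (measurable_tnth ord0).
  exact: measurable_behead.
have gK : cancel (@tcons n) g.
  by move=> [x t]; congr pair; apply/val_inj.
exists (fun k => g @^-1` (F k `*` G k)).
  apply/esym/seteqP; split => // x _.
  have [i _ Fi] : (\bigcup_i F i) (g x).1 by rewrite -TF.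
  have [j _ Gj] : (\bigcup_i G i) (g x).2 by rewrite -TG.
  exists (maxn i j) => //; split.
  - by move: Fi; exact/subsetPset/ndF/leq_maxl.
  - by move: Gj; exact/subsetPset/ndG/leq_maxr.
move=> k; have [mFk Fk] := Foo k; have [mGk Gk] := Goo k; split.
  by rewrite -[X in measurable X]setTI; apply: mg => //; exact: measurableX.
rewrite /cons_measure /pushforward -comp_preimage.
have -> : g \o @tcons n = id by apply/funext => x /=; rewrite gK.
by rewrite preimage_id product_measure1E// lte_mul_pinfty// ge0_fin_numE.
Qed.

HB.instance Definition _ := Measure_isSigmaFinite.Build _ _ _ cons_measure
  cons_measure_sigma_finite.

End cons_measure.

Variable mu : {sigma_finite_measure set T -> \bar R}.

Fixpoint tuple_measure n : {sigma_finite_measure set (n.-tuple T) -> \bar R} :=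
  if n is k.+1 then cons_measure mu (tuple_measure k)
  else @dirac _ _ [tuple] R.

Lemma tuple_measure_box n (A : 'I_n -> set T) :
  (forall i, measurable (A i)) ->
  tuple_measure n [set x | forall i, A i (tnth x i)] = \prod_(i < n) mu (A i).
Proof.
elim: n A => [|n ih] A mA.
  by rewrite big_ord0 /= diracE mem_set// => -[].
have mB : measurable [set x : n.-tuple T | forall i, A (lift ord0 i) (tnth x i)].
  rewrite [X in measurable X](_ : _ = \bigcap_(i in [set: 'I_n])
    ((fun x : n.-tuple T => tnth x i) @^-1` A (lift ord0 i))).
    apply: fin_bigcap_measurable; first exact: finite_finset.
    by move=> i _; rewrite -[X in measurable X]setTI; exact: measurable_tnth.
  by apply/seteqP; split => [x Ax i _|x Ax i]; exact: Ax.
rewrite big_ord_recl -ih// /= /cons_measure /pushforward -product_measure1E//.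
congr (_ _); apply/seteqP; split => [[x t] /= At|[x t] /= [Ax At] i].
  split; first by have := At ord0; rewrite tnth0.
  by move=> i; have := At (lift ord0 i); rewrite tnthS.
by case: (unliftP ord0 i) => [j ->|->]; rewrite ?tnthS ?tnth0.
Qed.

End tuple_measure.

Import complex.ComplexField.Normc.

(* The measurable sets of [rvec R d] are the Borel sets of R^d. *)
Notation rvec R d := (d.-tuple (measurableTypeR R)).

Definition lebesgue_rvec {R : realType} (d : nat) :
    {sigma_finite_measure set (rvec R d) -> \bar R} :=
  tuple_measure lebesgue_measure d.

(* Functions on the torus are functions on R^d that are 2 pi-periodic in each
   variable; integrals over the torus are taken over the cube [0, 2 pi[^d. *)
Definition torus_cube {R : realType} (d : nat) : set (rvec R d) :=
  [set x | forall j, 0 <= tnth x j < 2 * pi].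
Arguments torus_cube {R} d _.

Definition freq_cube (d n : nat) : set (d.-tuple int) :=
  [set k | forall j, - n%:Z <= tnth k j <= n%:Z].
Arguments freq_cube d n _ : clear implicits.

Section fourier_torus.
Context {R : realType}.
Local Notation C := R[i].

Definition shift2pi (d : nat) (j : 'I_d) (x : rvec R d) : rvec R d :=
  [tuple if i == j then tnth x i + 2 * pi else tnth x i | i < d].

Definition torus_periodic (d : nat) (f : rvec R d -> C) :=
  forall j x, f (shift2pi j x) = f x.

Definition torus_L1 (d : nat) (f : rvec R d -> C) :=
  [/\ torus_periodic f,
      (lebesgue_rvec d).-integrable (torus_cube d)
        (fun x => (complex.Re (f x))%:E) &
      (lebesgue_rvec d).-integrable (torus_cube d)
        (fun x => (complex.Im (f x))%:E)].

(* For even k the factor ln^k is positive also for |u| < 1. The junk value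
   of ln at 0 is harmless since |u| = 0. *)
Definition Logk (k : nat) (u : C) : R :=
  normc u * Num.max 0 (ln (normc u) ^+ k).

Definition Logk_int (d k : nat) (f : rvec R d -> C) : \bar R :=
  (\int[lebesgue_rvec d]_(x in torus_cube d) (Logk k (f x))%:E)%E.

Definition Logk_class (d k : nat) (f : rvec R d -> C) :=
  torus_L1 f /\ (Logk_int k f < +oo)%E.

Definition Logk_norm (d k : nat) (f : rvec R d -> C) : R :=
  inf [set l : R | 0 < l /\ (Logk_int k (fun x => f x / l%:C%C)%R <= 1)%E].

Definition expi (t : R) : C := (cos t +i* sin t)%C.

Definition dotk (d : nat) (k : d.-tuple int) (x : rvec R d) : R :=
  \sum_(j < d) (tnth k j)%:~R * tnth x j.

Definition torus_integral (d : nat) (g : rvec R d -> C) : C :=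
  (Rintegral (lebesgue_rvec d) (torus_cube d) (fun x => complex.Re (g x)) +i*
   Rintegral (lebesgue_rvec d) (torus_cube d) (fun x => complex.Im (g x)))%C.

Definition fourier_coef (d : nat) (f : rvec R d -> C) (k : d.-tuple int) : C :=
  (((2 * pi) ^+ d)^-1)%:C%C * torus_integral (fun x => f x * expi (- dotk k x)).

Definition square_sum (d : nat) (f : rvec R d -> C) (n : nat) (x : rvec R d) :
    C :=
  \sum_(k \in freq_cube d n) fourier_coef f k * expi (dotk k x).

Definition conj_square_sum (d : nat) (f : rvec R d -> C) (n : nat) (x : rvec R d) :
    C :=
  \sum_(k \in freq_cube d n)
    (\prod_(j < d) (- 'i%C * (sgz (tnth k j))%:~R)) *
    fourier_coef f k * expi (dotk k x).

End fourier_torus.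

(* Main.v *)
(**
The square partial sums split into half-space projections by
[1{k_i <= n} 1{k_j <= n} = 1{k_i <= n} 1{k_j <= k_i} + 1{k_j <= n} 1{k_i < k_j}]:
each is a combination of products of half-space projections in which only one
half-space moves with [n] and at most [d - 1] are fixed.

The fixed projections obey M. Riesz's bound [O(m)] on [L^(2m)]; applied to the
level sets [e^N <= |f| < e^(N+1)] with [m] of order [N], it turns [Log_(d-1)]
integrability of [f] into [L^1] bounds.

Up to a modulation the moving projection is a conjugate function along a
direction [v]. If [G] dominates [|p|], a 1-Lipschitz height [s], built from the
averages of [G] over segments parallel to [v], makes the Poisson extension of
[|p|] at height [s] at most [O(lam)]. Cauchy's theorem for the [2m]-th power of
the analytic extension on the curve of height [s] gives Riesz's bound
[(C m lam)^(2m)] on the set [s = 0], whose complement has measure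
[O(|G|_1 / lam)] by the maximal ergodic lemma. Summing the moments over [m]
gives the exponential bound. The height depends on [G] only, so the exceptional
set does not depend on [n].
*)
Require Import Defs.
From HB Require Import structures.
From mathcomp Require Import all_boot all_order all_algebra.
From mathcomp Require Import all_classical all_reals all_analysis.
From mathcomp Require Import measurable_realfun complex.
From mathcomp Require Import ring lra zify.
Set Implicit Arguments.
Unset Strict Implicit.
Unset Printing Implicit Defensive.
Import Order.TTheory GRing.Theory Num.Theory.
Import numFieldNormedType.Exports.
Import complex.ComplexField.Normc.

Local Open Scope classical_set_scope.
Local Open Scope ring_scope.

(** Estimates are made for trigonometric polynomials, where analytic extension is a finite sum; [f]
    is reached through polynomials [q N] close to its truncations. The exceptional set must then be
    independent of [N] as well as of [n]. So the dominating function is the sum of the moduli of the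
    projected increments of [q]: it grows with [N], while its integral stays bounded. This is why
    [L^1] bounds are proved for the sum over all increments and not for each [q N]. Only afterwards
    is [N] chosen, depending on [n]. The fixed projections act first and are absorbed into the
    dominating function. The modulation that carries the moving half-space to the origin changes no
    modulus, so one dominating function serves every [n]. The fixed projections are unbounded on
    [L^1]. By duality they are moved onto a bounded test polynomial, where Riesz's bound costs one
    factor [m] each, and each factor is paid for by one logarithm of [|f|]. For merely integrable
    data Riesz's argument has no finite moment on the right-hand side. Lifting the curve off the
    torus replaces the unbounded boundary values by a Poisson integral of size [O(lam)]. *)

Section bounded_measurable.
Context {disp : measure_display} {T : measurableType disp} {R : realType}.
Implicit Types f g : T -> R.

(** All integrals are over sets of finite measure, so with boundedness and global measurability
    integrability is automatic, and the real-valued integral is linear and monotone with no further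
    side conditions. *)
Definition bmeas f :=
  measurable_fun setT f /\ exists M : R, forall x, `|f x| <= M.

Lemma bmeas_cst (c : R) : bmeas (fun=> c).
Proof. by split; [exact: measurable_cst|exists `|c|]. Qed.

Lemma bmeasN f : bmeas f -> bmeas (fun x => - f x).
Proof.
move=> [mf [M fM]]; split; first exact: measurable_funN.
by exists M => x; rewrite normrN.
Qed.

Lemma bmeasD f g : bmeas f -> bmeas g -> bmeas (fun x => f x + g x).
Proof.
move=> [mf [M fM]] [mg [N gN]]; split; first exact: measurable_funD.
by exists (M + N) => x; rewrite (le_trans (ler_normD _ _))// lerD.
Qed.

Lemma bmeasB f g : bmeas f -> bmeas g -> bmeas (fun x => f x - g x).
Proof. by move=> bf /bmeasN; exact: bmeasD. Qed.

Lemma bmeasM f g : bmeas f -> bmeas g -> bmeas (fun x => f x * g x).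
Proof.
move=> [mf [M fM]] [mg [N gN]]; split; first exact: measurable_funM.
by exists (M * N) => x; rewrite normrM ler_pM.
Qed.

Lemma bmeasZ (c : R) f : bmeas f -> bmeas (fun x => c * f x).
Proof. by move=> bf; apply: bmeasM => //; exact: bmeas_cst. Qed.

Lemma bmeas_norm f : bmeas f -> bmeas (fun x => `|f x|).
Proof.
move=> [mf [M fM]]; split; first exact: measurableT_comp.
by exists M => x; rewrite normr_id.
Qed.

Lemma bmeasX f n : bmeas f -> bmeas (fun x => f x ^+ n).
Proof.
move=> [mf [M fM]]; split; first exact: measurable_funX.
by exists (M ^+ n) => x; rewrite normrX lerXn2r// nnegrE (le_trans _ (fM x)).
Qed.

Lemma bmeas_exp f : bmeas f -> bmeas (fun x => expR (f x)).
Proof.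
move=> [mf [M fM]]; split; first exact: measurableT_comp.
exists (expR M) => x; rewrite ger0_norm ?expR_ge0// ler_expR.
by rewrite (le_trans _ (fM x))// ler_norm.
Qed.

Lemma bmeas_sum (I : Type) (r : seq I) (P : pred I) (F : I -> T -> R) :
  (forall i, bmeas (F i)) -> bmeas (fun x => \sum_(i <- r | P i) F i x).
Proof.
move=> bF; elim: r => [|i r ih].
  by under [X in bmeas X]funext do rewrite big_nil; exact: bmeas_cst.
under [X in bmeas X]funext do rewrite big_cons.
by case: (P i) => //; exact: bmeasD.
Qed.

Lemma bmeas_le f g : measurable_fun setT f -> bmeas g ->
  (forall x, `|f x| <= g x) -> bmeas f.
Proof.
move=> mf [_ [M gM]] fg; split => //; exists M => x.
by rewrite (le_trans (fg x))// (le_trans _ (gM x))// ler_norm.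
Qed.

Lemma bmeas_indic (A : set T) : measurable A -> bmeas (\1_A : T -> R).
Proof.
move=> mA; split; first exact: measurable_indic.
by exists 1 => x; rewrite indicE; case: (x \in A); rewrite ?normr1 ?normr0.
Qed.

Section integral.
Variables (mu : {measure set T -> \bar R}) (D : set T).
Hypothesis mD : measurable D.
Hypothesis muD : (mu D < +oo)%E.

Lemma bmeas_integrable f : bmeas f -> mu.-integrable D (EFin \o f).
Proof.
move=> [mf [M fM]]; apply: measurable_bounded_integrable => //.
  exact: measurable_funTS.
exists M; split; first exact: num_real.
by move=> N MN x _ /=; rewrite (le_trans (fM x))// ltW.
Qed.

Local Notation J f := (Rintegral mu D f).

Lemma bint_EFin f : bmeas f -> (J f)%:E = (\int[mu]_(x in D) (f x)%:E)%E.
Proof.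
by move=> bf; rewrite /Rintegral fineK// integrable_fin_num//; exact: bmeas_integrable.
Qed.

Lemma bintD f g : bmeas f -> bmeas g -> J (fun x => f x + g x) = J f + J g.
Proof. by move=> bf bg; rewrite RintegralD//; exact: bmeas_integrable. Qed.

Lemma bintB f g : bmeas f -> bmeas g -> J (fun x => f x - g x) = J f - J g.
Proof. by move=> bf bg; rewrite RintegralB//; exact: bmeas_integrable. Qed.

Lemma bintZ c f : bmeas f -> J (fun x => c * f x) = c * J f.
Proof. by move=> bf; rewrite RintegralZl//; exact: bmeas_integrable. Qed.

Lemma bintN f : bmeas f -> J (fun x => - f x) = - J f.
Proof. by move=> bf; under eq_Rintegral do rewrite -mulN1r; rewrite bintZ// mulN1r. Qed.

Lemma bint_cst c : J (fun=> c) = c * fine (mu D).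
Proof. by rewrite Rintegral_cst. Qed.

Lemma bint_le f g : bmeas f -> bmeas g -> (forall x, D x -> f x <= g x) ->
  J f <= J g.
Proof. by move=> bf bg fg; apply: le_Rintegral => //; exact: bmeas_integrable. Qed.

Lemma bint_norm f : bmeas f -> `|J f| <= J (fun x => `|f x|).
Proof. by move=> bf; apply: le_normr_Rintegral => //; exact: bmeas_integrable. Qed.

Lemma bint_sum (I : Type) (r : seq I) (P : pred I) (F : I -> T -> R) :
  (forall i, bmeas (F i)) ->
  J (fun x => \sum_(i <- r | P i) F i x) = \sum_(i <- r | P i) J (F i).
Proof.
move=> bF; elim: r => [|i r ih].
  rewrite big_nil; under eq_Rintegral do rewrite big_nil.
  by rewrite bint_cst mul0r.
rewrite big_cons; under eq_Rintegral do rewrite big_cons.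
by case: (P i); rewrite // bintD ?ih//; exact: bmeas_sum.
Qed.

Lemma bint_indic (A : set T) : measurable A ->
  J (\1_A : T -> R) = fine (mu (A `&` D)).
Proof. by move=> mA; rewrite /Rintegral integral_indic. Qed.

End integral.
End bounded_measurable.

(** * Translation invariance of integrals over the torus *)

Section translation.
Context {R : realType}.
Local Notation leb := (@lebesgue_measure R).

Lemma lebesgue_measure_translation (a : R) (A : set R) : measurable A ->
  pushforward leb ((fun t => t + a) : measurableTypeR R -> measurableTypeR R) A
  = leb A.
Proof.
have ma : measurable_fun setT
    ((fun t => t + a) : measurableTypeR R -> measurableTypeR R).
  exact: measurable_funD.
move=> mA; apply/esym.
apply: lebesgue_measure_unique => //= _ [[x y]] _ <-.
rewrite /pushforward/=.
rewrite (_ : _ @^-1` _ = `](x - a), (y - a)]%classic); last first.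
  by apply/seteqP; split => t /=; rewrite !in_itv/= ltrBlDr lerBrDr.
by rewrite !lebesgue_measure_itv/= !lte_fin ltrD2r; case: ifPn => // _;
  rewrite -!EFinB opprB addrA subrK.
Qed.

Lemma ge0_integral_translation (a : R) (D : set R) (f : R -> \bar R) :
  measurable D -> measurable_fun D f -> (forall t, (0 <= f t)%E) ->
  (\int[leb]_(t in D) f t =
   \int[leb]_(t in (fun t => t + a)%R @^-1` D) f (t + a)%R)%E.
Proof.
move=> mD mf f0.
rewrite -(@ge0_integral_pushforward _ _ (measurableTypeR R) (measurableTypeR R)
  R ((fun t => t + a)%R) _ leb D f)//; last exact: measurable_funD.
apply: eq_measure_integral; first exact: measurable_funD.
by move=> ? A mA _; exact: (esym (lebesgue_measure_translation a mA)).
Qed.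

Let period : set R := [set t | 0 <= t < 2 * pi].

Let periodE : period = `[0, (2 * pi)[%classic.
Proof. by apply/seteqP; split => t /=; rewrite in_itv. Qed.

Lemma measurable_period : measurable period.
Proof. by rewrite periodE. Qed.

Lemma lebesgue_period : leb period = (2 * pi)%:E.
Proof.
rewrite periodE lebesgue_measure_itv/= lte_fin mulr_gt0// ?pi_gt0//.
by rewrite oppr0 adde0.
Qed.

(** Whole periods are removed from [a], leaving [b] in [[0, 2 pi[]. The translated period [[b, b + 2
    pi[] is cut at [2 pi] and the overhang is moved back by one period. Nonnegative extended-real
    functions are used so that Tonelli's theorem applies in the induction on the dimension. *)
Lemma ge0_integral_period (f : R -> \bar R) (a : R) :
  measurable_fun setT f -> (forall t, (0 <= f t)%E) ->
  (forall t, f (t + 2 * pi)%R = f t) ->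
  (\int[leb]_(t in period) f (t + a)%R = \int[leb]_(t in period) f t)%E.
Proof.
move=> mf f0 fper.
have p0 : 0 < 2 * pi :> R by rewrite mulr_gt0// pi_gt0.
have fN t (n : nat) : f (t + n%:R * (2 * pi)) = f t.
  elim: n => [|n ih]; first by rewrite mul0r addr0.
  by rewrite -natr1 mulrDl mul1r addrA fper ih.
have fZ t (n : int) : f (t + n%:~R * (2 * pi)) = f t.
  case: n => n; first exact: fN.
  rewrite NegzE -[LHS](fN _ n.+1); congr f.
  by rewrite mulrNz pmulrn mulNr subrK.
pose m := Num.floor (a / (2 * pi)).
pose b := a - m%:~R * (2 * pi).
have b0 : 0 <= b by rewrite subr_ge0 -ler_pdivlMr// Num.Theory.floor_le.
have b1 : b < 2 * pi.
  by rewrite ltrBlDr -[X in X + _]mul1r -mulrDl -ltr_pdivrMr// addrC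
    -[1]/(1%:~R) -intrD floorD1_gt.
have -> : (\int[leb]_(t in period) f (t + a)%R = \int[leb]_(t in period) f (t + b)%R)%E.
  apply: eq_integral => t _; rewrite -(fZ (t + b) m); congr f.
  by rewrite /b addrA subrK.
have mfa (c : R) (D : set R) : measurable_fun D (fun t : R => f (t + c)).
  apply: (@measurableT_comp _ _ _ _ _ _ f) => //.
  exact: measurable_funD.
have -> : (\int[leb]_(t in period) f (t + b)%R =
   \int[leb]_(t in `[b, (2 * pi + b)%R[) f t)%E.
  rewrite [RHS](ge0_integral_translation b)//; last exact: measurable_funTS.
  rewrite (_ : _ @^-1` _ = period)//; apply/seteqP; split => t /=;
   by rewrite in_itv/= lerDr ltrD2r.
have -> : `[b, (2 * pi + b)[%classic =
   `[b, (2 * pi)[%classic `|` `[(2 * pi), (2 * pi + b)[%classic :> set R.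
  apply/seteqP; split => t /=; rewrite !in_itv/=.
    by move=> /andP[-> ->]; rewrite andbT; case: (ltP t (2 * pi)); [left|right].
  by move=> [] /andP[h1 h2]; apply/andP; split; lra.
rewrite ge0_integral_setU//; last 2 first.
- exact: measurable_funTS.
- apply/disj_setPS => t [/=]; rewrite !in_itv/= => /andP[_ h] /andP[].
  by rewrite leNgt h.
rewrite [X in (_ + X)%E](ge0_integral_translation (2 * pi))//; last first.
  exact: measurable_funTS.
rewrite (_ : (fun t => t + 2 * pi) @^-1` _ = `[0, b[%classic); last first.
  apply/seteqP; split => t /=; rewrite !in_itv/= => /andP[h1 h2];
    by apply/andP; split; lra.
under [X in (_ + X)%E]eq_integral do rewrite fper.
rewrite addeC -ge0_integral_setU//; last 2 first.
- exact: measurable_funTS.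
- apply/disj_setPS => t [/=]; rewrite !in_itv/= => /andP[_ h] /andP[].
  by rewrite leNgt h.
congr (integral _ _ _); rewrite periodE.
apply/seteqP; split => t /=; rewrite !in_itv/=.
  by move=> [] /andP[h1 h2]; apply/andP; split; lra.
by move=> /andP[-> ->]; rewrite andbT; case: (ltP t b); [left|right].
Qed.

Definition xadd (d : nat) (y : 'I_d -> R) (x : rvec R d) : rvec R d :=
  [tuple tnth x j + y j | j < d].

Lemma measurable_xadd d (y : 'I_d -> R) : measurable_fun setT (xadd y).
Proof.
apply/measurable_fun_tnthP => i.
rewrite (_ : _ \o _ = fun x => tnth x i + y i); last first.
  by apply/funext => x /=; rewrite tnth_mktuple.
by apply: measurable_funD => //; exact: measurable_tnth.
Qed.

Lemma torus_cube_measurable d : measurable (torus_cube d : set (rvec R d)).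
Proof.
rewrite [X in measurable X](_ : _ = \bigcap_(i in [set: 'I_d])
    ((fun x : rvec R d => tnth x i) @^-1` period)).
  apply: fin_bigcap_measurable; first exact: finite_finset.
  move=> i _; rewrite -[X in measurable X]setTI.
  by apply: measurable_tnth => //; exact: measurable_period.
by apply/seteqP; split => [x Ax i _|x Ax i]; exact: Ax.
Qed.

Lemma lebesgue_cube d :
  lebesgue_rvec d (torus_cube d : set (rvec R d)) = ((2 * pi) ^+ d)%:E.
Proof.
rewrite /lebesgue_rvec.
rewrite [LHS](@tuple_measure_box _ _ _ lebesgue_measure d (fun=> period)); last first.
  by move=> i; exact: measurable_period.
rewrite (eq_bigr (fun=> (2 * pi)%:E)); last by move=> i _; exact: lebesgue_period.
by rewrite prodEFin prodr_const card_ord.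
Qed.

Lemma integral_torus_cons d (f : rvec R d.+1 -> \bar R) :
  measurable_fun setT f -> (forall x, (0 <= f x)%E) ->
  (\int[lebesgue_rvec d.+1]_(x in torus_cube d.+1) f x =
   \int[leb]_(t in period) \int[lebesgue_rvec d]_(x in torus_cube d)
     f (tcons (t, x)))%E.
Proof.
move=> mf f0.
have mc : measurable_fun setT (fun p : measurableTypeR R * rvec R d => tcons p).
  exact: measurable_tcons.
rewrite /lebesgue_rvec /= /cons_measure.
rewrite (@ge0_integral_pushforward _ _ _ _ _ _ mc)//; last 2 first.
- exact: torus_cube_measurable.
- exact: measurable_funTS.
rewrite (_ : _ @^-1` _ = period `*` torus_cube d); last first.
  apply/seteqP; split => [[t x] /= h|[t x] /= [h1 h2] i].
    split; first by have := h ord0; rewrite tnth0.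
    by move=> i; have := h (lift ord0 i); rewrite tnthS.
  by case: (unliftP ord0 i) => [j ->|->]; rewrite ?tnthS ?tnth0.
rewrite integral_mkcond fubini_tonelli1; last 2 first.
- apply/(measurable_restrictT _ _).1.
    by apply: measurableX; [exact: measurable_period|exact: torus_cube_measurable].
  by apply: measurable_funTS; exact: measurableT_comp.
- by move=> z; rewrite patchE; case: ifPn => // _; exact: f0.
rewrite [RHS]integral_mkcond; apply: eq_integral => t _.
rewrite /fubini_F [RHS]patchE; case: ifPn => tp.
  rewrite [RHS]integral_mkcond; apply: eq_integral => x _.
  rewrite !patchE in_setX tp /=.
  by case: ifPn.
by rewrite integral0_eq// => x _; rewrite patchE in_setX (negbTE tp).
Qed.

Lemma tcons_shift2pi0 d (t : R) (x : rvec R d) :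
  tcons (t + 2 * pi, x) = shift2pi ord0 (tcons (t, x)) :> rvec R d.+1.
Proof.
apply: eq_from_tnth => i; rewrite tnth_mktuple.
by case: (unliftP ord0 i) => [j ->|->]; rewrite ?tnthS ?tnth0//= eqxx.
Qed.

Lemma tcons_shift2piS d (t : R) (x : rvec R d) j :
  tcons (t, shift2pi j x) = shift2pi (lift ord0 j) (tcons (t, x)) :> rvec R d.+1.
Proof.
apply: eq_from_tnth => i; rewrite tnth_mktuple.
case: (unliftP ord0 i) => [k ->|->]; rewrite ?tnthS ?tnth0//=.
by rewrite tnth_mktuple (inj_eq lift_inj).
Qed.

Lemma measurable_tcons2 d (t : R) :
  measurable_fun setT ((fun x => tcons (t, x)) : rvec R d -> rvec R d.+1).
Proof. exact: (measurable_cons (measurable_cst t) (@measurable_id _ _ _)). Qed.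

(** Induction on [d]: the first coordinate is handled by the one-dimensional period, the others
    inside the iterated integral. *)
Lemma ge0_integral_torus_translation d (y : 'I_d -> R) (f : rvec R d -> \bar R) :
  measurable_fun setT f -> (forall x, (0 <= f x)%E) ->
  (forall j x, f (shift2pi j x) = f x) ->
  (\int[lebesgue_rvec d]_(x in torus_cube d) f (xadd y x) =
   \int[lebesgue_rvec d]_(x in torus_cube d) f x)%E.
Proof.
elim: d => [|d ih] in y f *.
  move=> _ _ _; apply: eq_integral => x _; congr f.
  by apply: eq_from_tnth => -[].
move=> mf f0 fper.
rewrite (integral_torus_cons mf f0).
rewrite (@integral_torus_cons d (fun x => f (xadd y x))); last 2 first.
- by apply: measurableT_comp => //; exact: measurable_xadd.
- by move=> x; exact: f0.
pose F (t : R) : \bar R := (\int[lebesgue_rvec d]_(x in torus_cube d) f (tcons (t, x)))%E.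
transitivity (\int[leb]_(t in period) F (t + y ord0)%R)%E; last first.
  apply: ge0_integral_period.
  - pose g (z : measurableTypeR R * rvec R d) := ((f \o (@tcons _ _ d)) \_ (setT `*` torus_cube d)) z.
    have mg : measurable_fun setT g.
      apply/(measurable_restrictT _ _).1.
        by apply: measurableX => //; exact: torus_cube_measurable.
      by apply: measurable_funTS; apply: measurableT_comp => //; exact: measurable_tcons.
    have g0 z : (0 <= g z)%E.
      by rewrite /g patchE; case: ifPn => // _; exact: f0.
    have := @measurable_fun_fubini_tonelli_F _ _ _ _ _ (lebesgue_rvec d) g mg g0.
    congr (measurable_fun _ _); apply/funext => t.
    rewrite /fubini_F /F [RHS]integral_mkcond; apply: eq_integral => x _.
    by rewrite /g !patchE in_setX in_setT.
  - by move=> t; exact: integral_ge0.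
  - by move=> t; apply: eq_integral => x _; rewrite tcons_shift2pi0 fper.
apply: eq_integral => t _.
rewrite /F -[RHS](ih (fun j => y (lift ord0 j)) (fun x => f (tcons (t + y ord0, x)))) //.
- apply: eq_integral => x _; congr f.
  apply: eq_from_tnth => i; rewrite tnth_mktuple.
  by case: (unliftP ord0 i) => [j ->|->]; rewrite ?tnthS ?tnth0//= tnth_mktuple.
- by apply: measurableT_comp => //; exact: measurable_tcons2.
- by move=> j x; rewrite tcons_shift2piS fper.
Qed.

Lemma bint_torus_translation d (y : 'I_d -> R) (f : rvec R d -> R) :
  bmeas f -> (forall j x, f (shift2pi j x) = f x) ->
  Rintegral (lebesgue_rvec d) (torus_cube d) (fun x => f (xadd y x)) =
  Rintegral (lebesgue_rvec d) (torus_cube d) f.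
Proof.
move=> bf fper; have [mf [M fM]] := bf.
have mD : measurable (torus_cube d : set (rvec R d)).
  exact: torus_cube_measurable.
have muD : (lebesgue_rvec d (torus_cube d : set (rvec R d)) < +oo)%E.
  by rewrite lebesgue_cube ltry.
have bfy : bmeas (fun x => f (xadd y x)).
  split; last by exists M => x; exact: fM.
  by apply: measurableT_comp => //; exact: measurable_xadd.
(* Adding the bound [M] makes the function nonnegative; the constant is cancelled afterwards. *)
have bM : bmeas (fun _ : rvec R d => M) by exact: bmeas_cst.
apply/(addIr (Rintegral (lebesgue_rvec d) (torus_cube d) (fun=> M))).
rewrite -!(bintD mD muD)// /Rintegral; congr fine.
apply: (ge0_integral_torus_translation y (f := fun x => (f x + M)%:E)).
- by apply/measurable_EFinP; apply: measurable_funD.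
- by move=> x; rewrite lee_fin -lerBlDr sub0r; have := fM x; rewrite ler_norml => /andP[].
- by move=> j x; rewrite fper.
Qed.

End translation.

(** * Complex moduli, real and imaginary parts, unit exponentials *)

Section complex_extras.
Local Open Scope complex_scope.
Context {R : realType}.
Local Notation C := R[i].
Implicit Types z w : C.
Local Notation Re := (@complex.Re R).
Local Notation Im := (@complex.Im R).

Lemma normc_ge0 z : 0 <= normc z.
Proof. by case: z => a b /=; exact: sqrtr_ge0. Qed.

Lemma sqr_normcE z : normc z ^+ 2 = Re z ^+ 2 + Im z ^+ 2.
Proof. by case: z => a b /=; rewrite sqr_sqrtr// addr_ge0 ?sqr_ge0. Qed.

Lemma ler_normRe z : `|Re z| <= normc z.
Proof.
rewrite -(@ler_pXn2r _ 2)// ?nnegrE ?normc_ge0// real_normK ?num_real//.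
by rewrite sqr_normcE lerDl sqr_ge0.
Qed.

Lemma ler_normIm z : `|Im z| <= normc z.
Proof.
rewrite -(@ler_pXn2r _ 2)// ?nnegrE ?normc_ge0// real_normK ?num_real//.
by rewrite sqr_normcE lerDr sqr_ge0.
Qed.

Lemma normc_le_ReIm z : normc z <= `|Re z| + `|Im z|.
Proof.
rewrite -(@ler_pXn2r _ 2)// ?nnegrE ?normc_ge0 ?addr_ge0//.
rewrite sqr_normcE sqrrD !real_normK ?num_real//.
by rewrite -addrA lerD2l lerDr mulrn_wge0// mulr_ge0.
Qed.

Lemma ReD z w : Re (z + w) = Re z + Re w. Proof. by case: z w => a b [c e]. Qed.
Lemma ImD z w : Im (z + w) = Im z + Im w. Proof. by case: z w => a b [c e]. Qed.
Lemma ReB z w : Re (z - w) = Re z - Re w. Proof. by case: z w => a b [c e]. Qed.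
Lemma ReM z w : Re (z * w) = Re z * Re w - Im z * Im w.
Proof. by case: z w => a b [c e]. Qed.
Lemma ImM z w : Im (z * w) = Re z * Im w + Im z * Re w.
Proof. by case: z w => a b [c e]. Qed.
Lemma ReZ a w : Re (a%:C * w) = a * Re w.
Proof. by rewrite ReM/= mul0r subr0. Qed.
Lemma ImZ a w : Im (a%:C * w) = a * Im w.
Proof. by rewrite ImM/= mul0r addr0. Qed.
Lemma normc_i : normc ('i%C : C) = 1.
Proof. by rewrite /= expr0n add0r expr1n sqrtr1. Qed.
Lemma normcN_i : normc (- 'i%C : C) = 1.
Proof. by rewrite normcN normc_i. Qed.
Lemma normc_conj z : normc (conjc z) = normc z.
Proof. by case: z => a b /=; rewrite sqrrN. Qed.
Lemma conjcZ (a : R) z : conjc (a%:C * z) = a%:C * conjc z.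
Proof. by case: z => b c /=; congr Complex; ring. Qed.
Lemma conjcD z w : conjc (z + w) = conjc z + conjc w.
Proof. by case: z w => a b [c e] /=; congr Complex; ring. Qed.
Lemma conjcM z w : conjc (z * w) = conjc z * conjc w.
Proof. by case: z w => a b [c e] /=; congr Complex; ring. Qed.
Lemma normcZ (a : R) : normc a%:C = `|a|.
Proof. by rewrite /= expr0n/= addr0 sqrtr_sqr. Qed.
Lemma normcX z n : normc (z ^+ n) = normc z ^+ n.
Proof.
elim: n => [|n ih]; first by rewrite !expr0 normc1.
by rewrite !exprS normcM ih.
Qed.

Lemma Re_sum (I : Type) (r : seq I) (F : I -> C) :
  Re (\sum_(i <- r) F i) = \sum_(i <- r) Re (F i).
Proof. by elim/big_rec2: _ => // i x y _ <-; rewrite ReD. Qed.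

Lemma Im_sum (I : Type) (r : seq I) (F : I -> C) :
  Im (\sum_(i <- r) F i) = \sum_(i <- r) Im (F i).
Proof. by elim/big_rec2: _ => // i x y _ <-; rewrite ImD. Qed.

Lemma conjc_sum (I : Type) (r : seq I) (F : I -> C) :
  conjc (\sum_(i <- r) F i) = \sum_(i <- r) conjc (F i).
Proof.
elim/big_rec2: _ => [|i x y _ <-]; last by rewrite conjcD.
by congr Complex; rewrite oppr0.
Qed.

Lemma normc_sum (I : Type) (r : seq I) (F : I -> C) :
  normc (\sum_(i <- r) F i) <= \sum_(i <- r) normc (F i).
Proof.
elim/big_rec2: _ => [|i x y _ h]; first by rewrite normc0.
by rewrite (le_trans (le_normcD _ _))// lerD2l.
Qed.

Lemma expiD (a b : R) : expi (a + b) = expi a * expi b.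
Proof.
by apply/eqP; rewrite eq_complex /= cosD sinD !eqxx /= addrC; apply/eqP; ring.
Qed.

Lemma expi0 : expi 0 = 1 :> C.
Proof. by rewrite /expi cos0 sin0. Qed.

Lemma normc_expi (a : R) : normc (expi a) = 1.
Proof. by rewrite /= cos2Dsin2 sqrtr1. Qed.

Lemma conj_expi (a : R) : conjc (expi a) = expi (- a).
Proof. by rewrite /expi cosN sinN. Qed.

Lemma expi_2pi_int (n : int) : expi (n%:~R * (2 * pi)) = 1 :> C.
Proof.
have h (k : nat) : expi (k%:R * (2 * pi)) = 1 :> C.
  elim: k => [|k ih]; first by rewrite mul0r expi0.
  rewrite -natr1 mulrDl expiD ih mul1r mul1r /expi.
  by rewrite mulr_natl cos2pi sin2pi.
case: n => n; first exact: h.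
by rewrite NegzE mulrNz mulNr -conj_expi (h n.+1) conjc1.
Qed.

End complex_extras.

(** * Taylor bounds for sine, cosine and the exponential *)

Section real_estimates.
Local Open Scope complex_scope.
Context {R : realType}.
Implicit Types a b x y : R.

Lemma ler_norm_sin x : `|sin x| <= `|x|.
Proof.
wlog x0 : x / 0 <= x.
  move=> h; have [/h//|x0] := leP 0 x.
  by rewrite -[in leLHS](opprK x) sinN normrN -[leRHS]normrN h// oppr_ge0 ltW.
move: x0; rewrite le_eqVlt => /predU1P[<-|x0]; first by rewrite sin0.
have [|c _] := @MVT R (@sin R) (@cos R) 0 x x0.
- by apply: continuous_subspaceT => y; exact: continuous_sin.
- rewrite sin0 !subr0 => ->; rewrite normrM ler_piMl//; exact: cos_max.
Qed.

Lemma one_minus_cos_le x : 0 <= 1 - cos x <= x ^+ 2 / 2.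
Proof.
rewrite subr_ge0 cos_le1/=.
have -> : cos x = 1 - 2 * sin (x / 2) ^+ 2.
  have {1}-> : x = (x / 2) *+ 2 by rewrite mulr2n -splitr.
  by rewrite cos_mulr2n sin2cos2; ring.
have := ler_norm_sin (x / 2); rewrite -(@ler_pXn2r _ 2)// ?nnegrE//.
rewrite !real_normK ?num_real//; lra.
Qed.

Lemma sin_sub_le x : `|x| <= 1 -> `|sin x - x| <= x ^+ 2.
Proof.
wlog x0 : x / 0 <= x.
  move=> h; have [/h//|x0] := leP 0 x.
  rewrite -{1}[x]opprK normrN => x1.
  have := h (- x); rewrite oppr_ge0 (ltW x0) sinN sqrrN => /(_ isT x1).
  by rewrite -opprD normrN.
move: x0; rewrite le_eqVlt => /predU1P[<-|x0].
  by rewrite sin0 subrr normr0 expr0n.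
rewrite gtr0_norm// => x1.
have [|c cx] := @MVT R (@sin R) (@cos R) 0 x x0.
- by apply: continuous_subspaceT => y; exact: continuous_sin.
- rewrite sin0 !subr0 => ->.
  rewrite -[X in _ - X]mul1r -mulrBl normrM (gtr0_norm x0) expr2 ler_pM2r//.
  rewrite distrC; have /andP[c0 c1] := one_minus_cos_le c.
  rewrite ger0_norm// (le_trans c1)//.
  move: cx; rewrite in_itv/= => /andP[? ?]; nra.
Qed.

(** Both sides follow from [1 + a <= expR a], the upper one through [expR a * expR (- a) = 1]. *)
Lemma expR_sub1_le a : `|a| <= 1/2 -> `|expR a - 1 - a| <= 2 * a ^+ 2.
Proof.
rewrite ler_norml => /andP[a1 a2].
have h1 := expR_ge1Dx a.
have h2 := expR_ge1Dx (- a); have h3 : expR a * expR (- a) = 1.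
  by rewrite -expRD subrr expR0.
have h4 := expR_gt0 a; rewrite ler_norml; apply/andP; split; nra.
Qed.

(** The second-order Taylor remainder of the complex exponential at [a + i b]. [curve_pointwise]
    divides it by [q h], which leaves an error of order [h]; the condition on [a] reflects a slope
    of at most 1. *)
Lemma expi_expansion (a b : R) : `|a| <= b -> b <= 1/2 ->
  normc ((expR a)%:C * expi b - 1 - (a +i* b)) <= 10 * b ^+ 2.
Proof.
move=> ab b2; have b0 : 0 <= b by rewrite (le_trans _ ab).
have ab2 : a ^+ 2 <= b ^+ 2.
  by rewrite -(real_normK (num_real a)) lerXn2r// nnegrE.
have a2 : `|a| <= 1/2 by rewrite (le_trans ab).
have h1 := expR_sub1_le a2.
have b1 : `|b| <= 1 by rewrite ger0_norm//; lra.
have h2 := sin_sub_le b1.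
have h3 := one_minus_cos_le b.
have e2 : `|expR a - 1| <= 2 * b.
  move: h1 a2 ab; rewrite !ler_norml => /andP[? ?] /andP[? ?] /andP[? ?].
  apply/andP; split; nra.
apply: (le_trans (normc_le_ReIm _)) => /=.
rewrite !mul0r !subr0 !addr0.
have -> : expR a * cos b - 1 - a =
   (expR a - 1 - a) - (1 + (expR a - 1)) * (1 - cos b) by ring.
have -> : expR a * sin b - b = (sin b - b) + (expR a - 1) * sin b by ring.
have h4 : `|(expR a - 1) * sin b| <= 2 * b * b.
  rewrite normrM ler_pM// (le_trans (ler_norm_sin b))// ger0_norm//.
have h5 : `|(1 + (expR a - 1)) * (1 - cos b)| <= 2 * (b ^+ 2 / 2).
  rewrite normrM ler_pM//; last by rewrite ger0_norm; case/andP: h3.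
  rewrite (le_trans (ler_normD _ _))// normr1; lra.
rewrite (le_trans (lerD (ler_normB _ _) (ler_normD _ _)))//.
move: h1 h2 h4 h5; lra.
Qed.

End real_estimates.

(** Finite functions carry the additive group of frequencies; [ffreq] and [tfreq] pass to and from
    the tuples of the statement. *)
Notation freq d := {ffun 'I_d -> int}.

(** * Bounded measurable complex functions *)

Section bounded_measurable_complex.
Local Open Scope complex_scope.
Context {disp : measure_display} {T : measurableType disp} {R : realType}.
Local Notation C := R[i].
Implicit Types f g : T -> C.

Definition bcmeas f :=
  bmeas (fun x => complex.Re (f x)) /\ bmeas (fun x => complex.Im (f x)).

Lemma bcmeas_cst (c : C) : bcmeas (fun=> c).
Proof. by split; exact: bmeas_cst. Qed.

Lemma bcmeasD f g : bcmeas f -> bcmeas g -> bcmeas (fun x => f x + g x).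
Proof.
move=> [f1 f2] [g1 g2]; split.
  by under [X in bmeas X]funext do rewrite ReD; exact: bmeasD.
by under [X in bmeas X]funext do rewrite ImD; exact: bmeasD.
Qed.

Lemma bcmeasM f g : bcmeas f -> bcmeas g -> bcmeas (fun x => f x * g x).
Proof.
move=> [f1 f2] [g1 g2]; split.
  under [X in bmeas X]funext do rewrite ReM.
  by apply: bmeasB; exact: bmeasM.
under [X in bmeas X]funext do rewrite ImM.
by apply: bmeasD; exact: bmeasM.
Qed.

Lemma bcmeasB f g : bcmeas f -> bcmeas g -> bcmeas (fun x => f x - g x).
Proof.
move=> bf bg; under [X in bcmeas X]funext do rewrite -mulN1r.
by apply: bcmeasD => //; apply: bcmeasM => //; exact: bcmeas_cst.
Qed.

Lemma bcmeas_conj f : bcmeas f -> bcmeas (fun x => conjc (f x)).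
Proof.
move=> [f1 f2]; split.
  rewrite (_ : (fun x => _) = (fun x => complex.Re (f x)))//.
  by apply/funext => x; case: (f x).
rewrite (_ : (fun x => _) = (fun x => - complex.Im (f x))); first exact: bmeasN.
by apply/funext => x; case: (f x).
Qed.

Lemma bcmeas_sum (I : Type) (r : seq I) (F : I -> T -> C) :
  (forall i, bcmeas (F i)) -> bcmeas (fun x => \sum_(i <- r) F i x).
Proof.
move=> bF; elim: r => [|i r ih].
  by under [X in bcmeas X]funext do rewrite big_nil; exact: bcmeas_cst.
by under [X in bcmeas X]funext do rewrite big_cons; exact: bcmeasD.
Qed.

Lemma bcmeas_real (f : T -> R) : bmeas f -> bcmeas (fun x => (f x)%:C).
Proof. by move=> bf; split => //; exact: bmeas_cst. Qed.

Lemma bcmeas_normc f : bcmeas f -> bmeas (fun x => normc (f x)).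
Proof.
move=> [f1 f2]; have b : bmeas (fun x => `|complex.Re (f x)| + `|complex.Im (f x)|).
  by apply: bmeasD; exact: bmeas_norm.
apply: (bmeas_le _ b) => [|x].
  rewrite (_ : (fun x => _) = Num.sqrt \o
      (fun x => complex.Re (f x) ^+ 2 + complex.Im (f x) ^+ 2)); last first.
    by apply/funext => x /=; case: (f x).
  apply: measurableT_comp.
    by apply: continuous_measurable_fun => ?; exact: sqrt_continuous.
  by have [] := bmeasD (bmeasX 2 f1) (bmeasX 2 f2).
by rewrite ger0_norm ?normc_ge0// normc_le_ReIm.
Qed.

End bounded_measurable_complex.

(** * Trigonometric polynomials, linear flows and multipliers *)

Section trigonometric_polynomials.
Local Open Scope complex_scope.
Context {R : realType} {d : nat}.
Local Notation C := R[i].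
Local Notation mu := (@lebesgue_rvec R d).
Local Notation T := (torus_cube d : set (rvec R d)).
Local Notation J f := (Rintegral mu T f).
Implicit Types (k l v : freq d) (x : rvec R d).

Definition fdot k v : int := \sum_j k j * v j.

Lemma fdotDl k l v : fdot (k + l) v = fdot k v + fdot l v.
Proof.
by rewrite /fdot -big_split; apply: eq_bigr => j _; rewrite ffunE mulrDl.
Qed.

Lemma fdotNl k v : fdot (- k) v = - fdot k v.
Proof. by rewrite /fdot -sumrN; apply: eq_bigr => j _; rewrite ffunE mulNr. Qed.

Lemma fdotNr k v : fdot k (- v) = - fdot k v.
Proof. by rewrite /fdot -sumrN; apply: eq_bigr => j _; rewrite ffunE mulrN. Qed.

Lemma fdotDr k v l : fdot k (v + l) = fdot k v + fdot k l.
Proof.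
by rewrite /fdot -big_split; apply: eq_bigr => j _; rewrite ffunE mulrDr.
Qed.

Definition phase k x : R := \sum_j (k j)%:~R * tnth x j.
Definition tchar k x : C := expi (phase k x).

Lemma phaseD k l x : phase (k + l) x = phase k x + phase l x.
Proof.
by rewrite /phase -big_split; apply: eq_bigr => j _; rewrite ffunE intrD mulrDl.
Qed.

Lemma phaseN k x : phase (- k) x = - phase k x.
Proof.
by rewrite /phase -sumrN; apply: eq_bigr => j _; rewrite ffunE intrN mulNr.
Qed.

Lemma tcharD k l x : tchar (k + l) x = tchar k x * tchar l x.
Proof. by rewrite /tchar phaseD expiD. Qed.

Lemma tcharN k x : tchar (- k) x = conjc (tchar k x).
Proof. by rewrite /tchar phaseN conj_expi. Qed.

Lemma tchar0 x : tchar 0 x = 1.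
Proof.
by rewrite /tchar /phase big1 ?expi0// => j _; rewrite ffunE mul0r.
Qed.

Lemma normc_tchar k x : normc (tchar k x) = 1.
Proof. exact: normc_expi. Qed.

Lemma phase_xadd k (y : 'I_d -> R) x :
  phase k (xadd y x) = phase k x + \sum_j (k j)%:~R * y j.
Proof.
by rewrite /phase -big_split; apply: eq_bigr => j _; rewrite tnth_mktuple mulrDr.
Qed.

Definition flow v (t : R) x : rvec R d := xadd (fun j => t * (v j)%:~R) x.

(** Along an orbit a trigonometric polynomial becomes one of a single variable with the integer
    frequencies [fdot k v], and a half-space [k.v <= c] becomes a half-line. *)
Lemma tchar_flow k v t x :
  tchar k (flow v t x) = expi (t * (fdot k v)%:~R) * tchar k x.
Proof.
rewrite /tchar phase_xadd addrC expiD; congr (expi _ * _).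
rewrite /fdot rmorph_sum mulr_sumr; apply: eq_bigr => j _.
by rewrite rmorphM/=; ring.
Qed.

Lemma flowD v s t x : flow v s (flow v t x) = flow v (s + t) x.
Proof.
by apply: eq_from_tnth => j; rewrite !tnth_mktuple mulrDl addrA addrAC.
Qed.

Lemma flow0 v x : flow v 0 x = x.
Proof. by apply: eq_from_tnth => j; rewrite !tnth_mktuple mul0r addr0. Qed.

Lemma flow_shift2pi v t j x : flow v t (shift2pi j x) = shift2pi j (flow v t x).
Proof.
apply: eq_from_tnth => i; rewrite !tnth_mktuple.
by case: ifP => // _; rewrite addrAC.
Qed.

Lemma tchar_shift2pi k j x : tchar k (shift2pi j x) = tchar k x.
Proof.
have -> : shift2pi j x = xadd (fun i => if i == j then 2 * pi else 0) x.
  apply: eq_from_tnth => i; rewrite !tnth_mktuple.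
  by case: ifP; rewrite ?addr0.
rewrite /tchar phase_xadd addrC expiD (bigD1 j)//= eqxx big1 ?addr0.
  by rewrite expi_2pi_int mul1r.
by move=> i /negbTE ->; rewrite mulr0.
Qed.

Lemma bcmeas_tchar k : bcmeas (tchar k).
Proof.
have m : measurable_fun setT (phase k).
  apply: measurable_sum => j; apply: measurable_funM => //.
  exact: measurable_tnth.
split; split.
- apply: measurableT_comp => //; apply: continuous_measurable_fun.
  exact: continuous_cos.
- by exists 1 => x; exact: cos_max.
- apply: measurableT_comp => //; apply: continuous_measurable_fun.
  exact: continuous_sin.
- by exists 1 => x; exact: sin_max.
Qed.

(** A frequency may occur several times: sums, products and multipliers are then plain list
    operations with no normal form to maintain, and only [teval] matters. *)
Definition tpoly := seq (freq d * C).
Implicit Types p q : tpoly.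

Definition teval p x : C := \sum_(t <- p) t.2 * tchar t.1 x.
Definition tmul p q : tpoly := [seq (a.1 + b.1, a.2 * b.2) | a <- p, b <- q].
Definition tconj p : tpoly := [seq (- t.1, conjc t.2) | t <- p].
Definition tmult (m : freq d -> C) p : tpoly := [seq (t.1, m t.1 * t.2) | t <- p].
Definition tshift k p : tpoly := [seq (t.1 + k, t.2) | t <- p].
Definition tone : tpoly := [:: (0, 1)].
Fixpoint tpow p n : tpoly := if n is n'.+1 then tmul p (tpow p n') else tone.

Lemma teval_nil x : teval [::] x = 0.
Proof. by rewrite /teval big_nil. Qed.

Lemma teval_cons a p x : teval (a :: p) x = a.2 * tchar a.1 x + teval p x.
Proof. by rewrite /teval big_cons. Qed.

Lemma teval_cat p q x : teval (p ++ q) x = teval p x + teval q x.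
Proof. by rewrite /teval big_cat. Qed.

Lemma teval_one x : teval tone x = 1.
Proof. by rewrite /teval big_seq1 tchar0 mulr1. Qed.

Lemma teval_mul p q x : teval (tmul p q) x = teval p x * teval q x.
Proof.
rewrite /teval /tmul big_allpairs_dep mulr_suml; apply: eq_bigr => a _ /=.
by rewrite mulr_sumr; apply: eq_bigr => b _; rewrite tcharD; ring.
Qed.

Lemma teval_pow p n x : teval (tpow p n) x = teval p x ^+ n.
Proof.
by elim: n => [|n ih]; rewrite ?teval_one ?expr0//= teval_mul ih exprS.
Qed.

Lemma teval_conj p x : teval (tconj p) x = conjc (teval p x).
Proof.
rewrite /teval big_map conjc_sum; apply: eq_bigr => a _ /=.
by rewrite tcharN conjcM.
Qed.

Lemma teval_shift k p x : teval (tshift k p) x = tchar k x * teval p x.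
Proof.
rewrite /teval big_map mulr_sumr; apply: eq_bigr => a _ /=.
by rewrite tcharD; ring.
Qed.

Lemma teval_tmult m p x :
  teval (tmult m p) x = \sum_(t <- p) m t.1 * t.2 * tchar t.1 x.
Proof. by rewrite /teval big_map. Qed.

Lemma teval_scale (c : C) p x : teval (tmult (fun=> c) p) x = c * teval p x.
Proof.
by rewrite teval_tmult mulr_sumr; apply: eq_bigr => a _; rewrite mulrA.
Qed.

Lemma tmult_cat m p q : tmult m (p ++ q) = tmult m p ++ tmult m q.
Proof. exact: map_cat. Qed.

Lemma tmult_comp m m' p : tmult m (tmult m' p) = tmult (fun k => m k * m' k) p.
Proof. by rewrite /tmult -map_comp; apply: eq_map => a /=; rewrite mulrA. Qed.

Lemma teval_shift2pi p j x : teval p (shift2pi j x) = teval p x.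
Proof. by apply: eq_bigr => a _; rewrite tchar_shift2pi. Qed.

Lemma bcmeas_teval p : bcmeas (teval p).
Proof.
apply: bcmeas_sum => a; apply: bcmeasM; first exact: bcmeas_cst.
exact: bcmeas_tchar.
Qed.

Lemma cube_measurable : measurable T.
Proof. exact: torus_cube_measurable. Qed.

Lemma cube_fin : (mu T < +oo)%E.
Proof. by rewrite lebesgue_cube ltry. Qed.

Lemma bint_flow v t (f : rvec R d -> R) : bmeas f ->
  (forall j x, f (shift2pi j x) = f x) -> J (fun x => f (flow v t x)) = J f.
Proof. exact: bint_torus_translation. Qed.

(** Translating by [pi / k_j] in a coordinate with [k_j != 0] changes the sign of the character, so
    the integral equals its own opposite. *)
Lemma bint_tchar k (c : C) : k != 0 -> J (fun x => complex.Re (c * tchar k x)) = 0.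
Proof.
move=> k0; have [j kj] : exists j, k j != 0.
  apply/existsP; rewrite -negb_forall; apply: contra k0 => /forallP h.
  by apply/eqP/ffunP => j; rewrite ffunE; exact/eqP.
have kj' : (k j)%:~R != 0 :> R by rewrite intr_eq0.
pose y i : R := if i == j then pi / (k j)%:~R else 0.
have bf : bmeas (fun x => complex.Re (c * tchar k x)).
  by have [] := bcmeasM (bcmeas_cst c) (bcmeas_tchar k).
have := @bint_torus_translation _ _ y _ bf _.
have -> : (fun x => complex.Re (c * tchar k (xadd y x))) =
          (fun x => - complex.Re (c * tchar k x)).
  apply/funext => x; rewrite /tchar phase_xadd expiD.
  rewrite (bigD1 j)//= /y eqxx big1 ?addr0; last first.
    by move=> i /negbTE ->; rewrite mulr0.
  have -> : (k j)%:~R * (pi / (k j)%:~R) = pi :> R by field.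
  have -> : expi pi = -1 :> C.
    by apply/eqP; rewrite /expi cospi sinpi eq_complex /= oppr0 !eqxx.
  by rewrite !(ReM, ImM)/=; ring.
rewrite (bintN cube_measurable cube_fin bf) => h.
have {h} : - J (fun x => complex.Re (c * tchar k x)) =
    J (fun x => complex.Re (c * tchar k x)).
  by apply: h => i x; rewrite tchar_shift2pi.
lra.
Qed.

(** The difference of the two sides is a double sum weighted by [m a - m b]: equal frequencies
    cancel and distinct ones integrate to zero. *)
Lemma bint_tmult_adj (m : freq d -> R) p q :
  J (fun x => complex.Re (teval (tmult (fun k => (m k)%:C) p) x * conjc (teval q x))) =
  J (fun x => complex.Re (teval p x * conjc (teval (tmult (fun k => (m k)%:C) q) x))).
Proof.
pose h a b x := complex.Re (((m a.1 - m b.1)%:C * a.2 * conjc b.2) * tchar (a.1 - b.1) x).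
have bh a b : bmeas (h a b).
  have [] := bcmeasM (bcmeas_cst ((m a.1 - m b.1)%:C * a.2 * conjc b.2))
    (bcmeas_tchar (a.1 - b.1)) => //.
have b1 p' q' : bmeas (fun x => complex.Re (teval p' x * conjc (teval q' x))).
  by have [] := bcmeasM (bcmeas_teval p') (bcmeas_conj (bcmeas_teval q')).
apply/eqP; rewrite -subr_eq0 -(bintB cube_measurable cube_fin)//.
have -> : (fun x => complex.Re (teval (tmult (fun k => (m k)%:C) p) x * conjc (teval q x))
   - complex.Re (teval p x * conjc (teval (tmult (fun k => (m k)%:C) q) x))) =
   (fun x => \sum_(a <- p) \sum_(b <- q) h a b x).
  apply/funext => x; rewrite -ReB !teval_tmult /teval.
  rewrite !mulr_suml -sumrB Re_sum; apply: eq_bigr => a _.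
  rewrite !conjc_sum !mulr_sumr -sumrB Re_sum; apply: eq_bigr => b _.
  rewrite /h tcharD tcharN -[(m b.1)%:C * _ * _]mulrA conjcZ.
  by congr complex.Re; rewrite !conjcM rmorphB /=; ring.
rewrite (bint_sum cube_measurable cube_fin)//; last by move=> a; exact: bmeas_sum.
apply/eqP; rewrite big1// => a _.
rewrite (bint_sum cube_measurable cube_fin)// big1// => b _.
have [ab|ab] := eqVneq a.1 b.1; last by apply: bint_tchar; rewrite subr_eq0.
rewrite /h ab subrr.
under eq_Rintegral do rewrite mul0r mul0r mul0r /=.
by rewrite (bint_cst _ cube_measurable) mul0r.
Qed.

End trigonometric_polynomials.

(** * Pointwise inequalities behind Riesz's theorem *)

Section riesz_pointwise.
Local Open Scope complex_scope.
Context {R : realType}.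
Local Notation C := R[i].

(** The binomial expansion of [Y ^+ n] about [a] without its leading term, estimated in modulus. *)
Lemma normc_expB_le (Y : C) (a : R) n : normc (Y ^+ n - (a ^+ n)%:C) <=
  (`|a| + normc (Y - a%:C)) ^+ n - `|a| ^+ n.
Proof.
elim: n => [|n ih]; first by rewrite !expr0 subrr normc0 subrr.
have -> : Y ^+ n.+1 - (a ^+ n.+1)%:C =
    Y * (Y ^+ n - (a ^+ n)%:C) + (Y - a%:C) * (a ^+ n)%:C.
  by rewrite !exprS rmorphM /=; ring.
have hY : normc Y <= `|a| + normc (Y - a%:C).
  have {1}-> : Y = a%:C + (Y - a%:C) by ring.
  by rewrite (le_trans (le_normcD _ _))// normcZ.
rewrite (le_trans (le_normcD _ _))// !normcM.
apply: (le_trans (lerD (ler_pM (normc_ge0 _) (normc_ge0 _) hY ih) (lexx _))).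
by rewrite normcZ normrX !exprS; lra.
Qed.

(** Division-free form of [(1 + t)^n <= 1 / (1 - n t)] with [t = B / A]. *)
Lemma bernoulli_upper (A B : R) n : 0 <= A -> 0 <= B ->
  (A + B) ^+ n * (A - n%:R * B) <= A ^+ n.+1.
Proof.
move=> A0 B0; elim: n => [|n ih]; first by rewrite expr0 mul1r mul0r subr0 expr1.
have h : (A + B) * (A - n.+1%:R * B) <= A * (A - n%:R * B).
  rewrite -natr1; have : 0 <= n%:R :> R by []; nra.
rewrite exprS -mulrA mulrCA (le_trans (ler_wpM2l _ h))//.
  by rewrite exprn_ge0// addr_ge0.
by rewrite mulrCA [leRHS]exprS ler_wpM2l.
Qed.

(* If [|Re Y| >= 16 m |Im Y|] then [Y^(2m)] is close to [(Re Y)^(2m)];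
   otherwise the term with [Im Y] dominates. *)
Lemma riesz_pointwise (Y : C) (t : R) (m : nat) : (0 < m)%N -> `|t| <= 1/4 ->
  1/2 * complex.Re Y ^+ (2 * m) - 2 * (17 * m%:R) ^+ (2 * m) * complex.Im Y ^+ (2 * m)
  <= complex.Re (Y ^+ (2 * m) * (1 +i* t)).
Proof.
move=> m0 t4; set a := complex.Re Y; set b := complex.Im Y.
have m1 : 1 <= m%:R :> R by rewrite ler1n.
have evn (r : R) : r ^+ (2 * m) = `|r| ^+ (2 * m).
  by rewrite exprM -real_normK ?num_real// -exprM.
have eRe : complex.Re (Y ^+ (2 * m) * (1 +i* t)) =
    complex.Re (Y ^+ (2 * m)) - t * complex.Im (Y ^+ (2 * m)).
  by rewrite ReM /=; ring.
have Yb : normc (Y - a%:C) = `|b|.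
  rewrite /a /b; case: Y {a b eRe} => y1 y2 /=.
  by rewrite subrr expr0n add0r subr0 sqrtr_sqr.
have tI : t * complex.Im (Y ^+ (2 * m)) <= 1/4 * normc (Y ^+ (2 * m)).
  rewrite (le_trans (ler_norm _))// normrM ler_pM//; exact: ler_normIm.
have [ab|ab] := leP (16 * m%:R * `|b|) `|a|.
  have := normc_expB_le Y a (2 * m); rewrite Yb => h.
  (* Here [2 m |b| <= |a| / 8], whence the factor [1 / (1 - 1/8) = 8/7]. The case closes with
     [6/7 - 1/4 * 8/7 = 4/7], which exceeds 1/2. *)
  have h1 : (`|a| + `|b|) ^+ (2 * m) <= 8/7 * `|a| ^+ (2 * m).
    have [a0|a0] := eqVneq `|a| 0.
      have -> : `|b| = 0.
        apply/eqP; rewrite eq_le normr_ge0 andbT; have := normr_ge0 b; nra.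
      by rewrite addr0; have := exprn_ge0 (2 * m) (normr_ge0 a); lra.
    have {}a0 : 0 < `|a| by rewrite lt_neqAle eq_sym a0/=.
    have := bernoulli_upper (2 * m) (normr_ge0 a) (normr_ge0 b).
    set S := (_ + _) ^+ _; have S0 : 0 <= S by rewrite exprn_ge0// addr_ge0.
    rewrite exprSr natrM => h1.
    have h2 : S * (7/8 * `|a|) <= `|a| ^+ (2 * m) * `|a|.
      rewrite (le_trans _ h1)// ler_wpM2l//; lra.
    move: h2; rewrite mulrA ler_pM2r//; lra.
  have h2 : normc (Y ^+ (2 * m) - (a ^+ (2 * m))%:C) <= 1/7 * a ^+ (2 * m).
    by rewrite [X in _ <= _ * X](evn a); lra.
  have h3 : a ^+ (2 * m) - complex.Re (Y ^+ (2 * m)) <= 1/7 * a ^+ (2 * m).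
    apply: le_trans h2; apply: le_trans (ler_normRe _).
    by rewrite ReB /= -normrN opprB ler_norm.
  have h4 : normc (Y ^+ (2 * m)) <= 8/7 * a ^+ (2 * m).
    have -> : Y ^+ (2 * m) = (a ^+ (2 * m))%:C + (Y ^+ (2 * m) - (a ^+ (2 * m))%:C).
      by ring.
    rewrite (le_trans (le_normcD _ _))// normcZ ger0_norm; last first.
      by rewrite evn exprn_ge0.
    lra.
  have h5 : 0 <= 2 * (17 * m%:R) ^+ (2 * m) * b ^+ (2 * m).
    apply: mulr_ge0; last by rewrite (evn b) exprn_ge0.
    by rewrite mulr_ge0// exprn_ge0// mulr_ge0.
  rewrite eRe; have : 0 <= a ^+ (2 * m) by rewrite evn exprn_ge0.
  lra.
(* Origin of 17: [|Y|^2 <= (16^2 m^2 + 1) b^2 <= (17 m)^2 b^2]. *)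
have hn : normc (Y ^+ (2 * m)) <= (17 * m%:R) ^+ (2 * m) * b ^+ (2 * m).
  rewrite normcX -exprMn !exprM.
  apply: lerXn2r; rewrite ?nnegrE ?sqr_ge0//.
  rewrite sqr_normcE -/a -/b exprMn -(real_normK (num_real a)) -(real_normK (num_real b)).
  have : `|a| ^+ 2 <= (16 * m%:R * `|b|) ^+ 2.
    by rewrite lerXn2r// ?nnegrE// ?mulr_ge0// ltW.
  have : 1 * `|b| ^+ 2 <= m%:R ^+ 2 * `|b| ^+ 2.
    by rewrite ler_wpM2r ?sqr_ge0// exprn_ege1.
  by rewrite !exprMn; have := sqr_ge0 `|b|; lra.
have ha : a ^+ (2 * m) <= (17 * m%:R) ^+ (2 * m) * b ^+ (2 * m).
  rewrite evn (le_trans _ hn)// normcX lerXn2r// ?nnegrE ?normc_ge0//.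
  exact: ler_normRe.
have hR : - normc (Y ^+ (2 * m)) <= complex.Re (Y ^+ (2 * m)).
  by rewrite lerNl (le_trans (ler_norm _))// normrN ler_normRe.
rewrite eRe; have := normc_ge0 (Y ^+ (2 * m)); lra.
Qed.

(** The factor [0 -i* (q * h)^-1] is [1 / (i q h)]. The increment of the primitive
    [exp(i q zeta) / (i q)] over a chord from height [s0] to height [s1], divided by [h], is
    compared with the integrand at the start times the direction [1 + i (s1 - s0) / h]. A
    nonnegative [s0] keeps [exp(- q s0)] at most 1. *)
Lemma curve_pointwise (z c : C) (q h s0 s1 : R) : normc z = 1 -> 1 <= q ->
  0 < h -> q * h <= 1/2 -> `|s1 - s0| <= h -> 0 <= s0 ->
  `|complex.Re ((0 -i* (q * h)^-1) * (c * (expi (h * q) * z) * (expR (- (q * s1)))%:C)) -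
    complex.Re ((0 -i* (q * h)^-1) * (c * z * (expR (- (q * s0)))%:C)) -
    complex.Re (c * z * (expR (- (q * s0)))%:C * (1 +i* ((s1 - s0) / h)))|
  <= 10 * normc c * q * h.
Proof.
move=> z1 q1 h0 hq sh s0_ge0; have q0 : 0 < q by rewrite (lt_le_trans _ q1).
have qh0 : 0 < q * h by rewrite mulr_gt0.
have -> : - (q * s1) = - (q * s0) + - (q * (s1 - s0)) by ring.
rewrite expRD rmorphM [h * q]mulrC -!ReB.
have e2 : normc ((expR (- (q * (s1 - s0))))%:C * expi (q * h) - 1 -
    ((- (q * (s1 - s0))) +i* (q * h))) <= 10 * (q * h) ^+ 2.
  apply: expi_expansion; last exact: hq.
  by rewrite normrN normrM (gtr0_norm q0) ler_pM2l.
have e1 : expR (- (q * s0)) <= 1.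
  by rewrite -expR0 ler_expR oppr_le0 mulr_ge0// ltW.
have e0 := expR_ge0 (- (q * s0)).
have c'w : (0 -i* (q * h)^-1) * ((- (q * (s1 - s0))) +i* (q * h)) =
    1 +i* ((s1 - s0) / h).
  by apply/eqP; rewrite eq_complex /=; apply/andP; split; apply/eqP; field;
    rewrite ?gt_eqF.
rewrite -c'w.
have nc' : normc (0 -i* (q * h)^-1) = (q * h)^-1.
  by rewrite /= expr0n add0r sqrrN sqrtr_sqr ger0_norm// invr_ge0 ltW.
move: e2 nc' e0 e1; set w := (_ +i* (q * h)); set E1 := expR (- (q * (_ - _))).
set E0 := expR _; set c' := (0 -i* _); set ee := expi _ => e2 nc' e0 e1.
have -> : c' * (c * (ee * z) * (E0%:C * E1%:C)) - c' * (c * z * E0%:C) -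
    c * z * E0%:C * (c' * w) = c' * (c * z * E0%:C * (E1%:C * ee - 1 - w)) by ring.
rewrite (le_trans (ler_normRe _))// !normcM normcZ z1 mulr1 nc' (ger0_norm e0).
have -> : 10 * normc c * q * h = (q * h)^-1 * (normc c * 1 * (10 * (q * h) ^+ 2)).
  by field; rewrite ?gt_eqF.
rewrite ler_wpM2l ?invr_ge0 ?(ltW qh0)//.
apply: ler_pM e2; rewrite ?normc_ge0// ?mulr_ge0 ?normc_ge0//.
by rewrite ler_wpM2l ?normc_ge0.
Qed.

End riesz_pointwise.

(** * Cauchy's theorem on a curve above the torus *)

Section curve.
Local Open Scope complex_scope.
Context {R : realType} {d : nat}.
Local Notation C := R[i].
Local Notation mu := (@lebesgue_rvec R d).
Local Notation T := (torus_cube d : set (rvec R d)).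
Local Notation J f := (Rintegral mu T f).
Implicit Types (k v : freq d) (x : rvec R d) (p q : @tpoly R d).

Let mT : measurable T := @cube_measurable R d.
Let fT : (mu T < +oo)%E := @cube_fin R d.

Lemma bmeas_flow v t (f : rvec R d -> R) : bmeas f -> bmeas (fun x => f (flow v t x)).
Proof.
move=> [mf [M fM]]; split; last by exists M => x; exact: fM.
by apply: measurableT_comp => //; exact: measurable_xadd.
Qed.

(** The continuation of [p] along the flow of [v] to complex time, evaluated at time [i s(x)]. *)
Definition tevals v (s : rvec R d -> R) p x : C :=
  \sum_(t <- p) t.2 * tchar t.1 x * (expR (- ((fdot t.1 v)%:~R * s x)))%:C.

Definition analytic v p := all (fun t => 0 <= fdot t.1 v) p.

(** The part invariant under the flow; for analytic [p] it is the limit of the continuation at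
    infinite height. *)
Definition tzero v p := tmult (fun k => (fdot k v == 0)%:R) p.

Lemma tevals_one v s x : tevals v s tone x = 1.
Proof.
rewrite /tevals big_seq1 /= tchar0 /fdot big1 ?mul0r ?oppr0 ?expR0 ?mulr1//.
by move=> j _; rewrite ffunE mul0r.
Qed.

Lemma tevals_mul v s p q x : tevals v s (tmul p q) x = tevals v s p x * tevals v s q x.
Proof.
rewrite /tevals /tmul big_allpairs_dep mulr_suml; apply: eq_bigr => a _ /=.
rewrite mulr_sumr; apply: eq_bigr => b _; rewrite tcharD fdotDl.
rewrite intrD mulrDl opprD expRD rmorphM /=; ring.
Qed.

Lemma tevals_pow v s p n x : tevals v s (tpow p n) x = tevals v s p x ^+ n.
Proof.
by elim: n => [|n ih]; rewrite ?tevals_one ?expr0//= tevals_mul ih exprS.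
Qed.

Lemma analytic_mul v p q : analytic v p -> analytic v q -> analytic v (tmul p q).
Proof.
move=> /allP ap /allP aq; apply/allP => t /allpairsP[[a b]] /= [pa qb ->] /=.
by rewrite fdotDl; apply: addr_ge0; [exact: ap|exact: aq].
Qed.

Lemma analytic_pow v p n : analytic v p -> analytic v (tpow p n).
Proof.
move=> ap; elim: n => [|n ih] /=; last exact: analytic_mul.
by rewrite /analytic /= andbT /fdot sumr_ge0// => j _; rewrite ffunE mul0r.
Qed.

(** For analytic factors the numbers [k.v] add without cancellation, so a product term is invariant
    only if both of its factors are. *)
Lemma teval_tzero_mul v p q x : analytic v p -> analytic v q ->
  teval (tzero v (tmul p q)) x = teval (tzero v p) x * teval (tzero v q) x.
Proof.
move=> /allP ap /allP aq; rewrite !teval_tmult /tmul big_allpairs_dep mulr_suml.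
rewrite big_seq [RHS]big_seq; apply: eq_bigr => a /ap pa.
rewrite mulr_sumr big_seq [RHS]big_seq; apply: eq_bigr => b /aq qb /=.
by rewrite fdotDl paddr_eq0// tcharD; do 2 case: eqP => _ /=; ring.
Qed.

Lemma teval_tzero_pow v p n x : analytic v p ->
  teval (tzero v (tpow p n)) x = teval (tzero v p) x ^+ n.
Proof.
move=> ap; elim: n => [|n ih] /=.
  rewrite teval_cons teval_nil addr0 /= tchar0 /fdot big1 ?mulr1//.
  by move=> j _; rewrite ffunE mul0r.
by rewrite teval_tzero_mul// ?ih ?exprS//; exact: analytic_pow.
Qed.

Section curve_integral.
Variables (v : freq d) (s chi : rvec R d -> R).
Hypotheses (bs : bmeas s) (s_ge0 : forall x, 0 <= s x)
  (s_per : forall j x, s (shift2pi j x) = s x).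
Hypotheses (bchi : bmeas chi) (chi_ge0 : forall x, 0 <= chi x)
  (chi_per : forall j x, chi (shift2pi j x) = chi x)
  (chi_flow : forall t x, chi (flow v t x) = chi x).

Lemma bcmeas_tevals p : bcmeas (tevals v s p).
Proof.
apply: bcmeas_sum => a; apply: bcmeasM.
  by apply: bcmeasM; [exact: bcmeas_cst|exact: bcmeas_tchar].
by apply/bcmeas_real/bmeas_exp/bmeasN/bmeasZ.
Qed.

(** A difference quotient stands in for the slope of the curve, as [s] need not be differentiable;
    identities then hold up to [O(h)], and [h] tends to zero at the end. *)
Let tau h x := (s (flow v h x) - s x) / h.

Let btau h : bmeas (tau h).
Proof.
rewrite /tau; under [X in bmeas X]funext do rewrite mulrC.
by apply/bmeasZ/bmeasB => //; exact: bmeas_flow.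
Qed.

Let b1tau h : bcmeas (fun x => 1 +i* tau h x).
Proof. by split => //=; exact: bmeas_cst. Qed.

Let bterm (F : rvec R d -> C) : bcmeas F -> bmeas (fun x => chi x * complex.Re (F x)).
Proof. by move=> [b _]; exact: bmeasM. Qed.

(** An invariant character gains neither phase nor decay, so the slope term is exactly an increment
    along the flow of an invariant factor times [s], and increments have integral zero. *)
Lemma curve_term_eq0 k (c : C) h : h != 0 -> fdot k v = 0 ->
  J (fun x => chi x * complex.Re (c * tchar k x * (1 +i* tau h x))) =
  J (fun x => chi x * complex.Re (c * tchar k x)).
Proof.
move=> h0 kv.
have bck : bcmeas (fun x => c * tchar k x).
  by apply: bcmeasM; [exact: bcmeas_cst|exact: bcmeas_tchar].
pose g x := chi x * complex.Im (c * tchar k x) * s x.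
have bg : bmeas g by apply: bmeasM => //; apply: bmeasM => //; case: bck.
have hg : J (fun x => g (flow v h x)) = J g.
  by apply: bint_flow => // j x; rewrite /g chi_per tchar_shift2pi s_per.
apply/eqP; rewrite -subr_eq0 -(bintB mT fT); last 2 first.
- by apply: bterm; exact: bcmeasM.
- exact: bterm.
have -> : (fun x => chi x * complex.Re (c * tchar k x * (1 +i* tau h x)) -
    chi x * complex.Re (c * tchar k x)) =
   (fun x => (- h^-1) * (g (flow v h x) - g x)).
  apply/funext => x; rewrite /g chi_flow tchar_flow kv mulr0 expi0 mul1r.
  rewrite [in LHS]ReM /= /tau; ring.
rewrite (bintZ mT fT); last by apply: bmeasB => //; exact: bmeas_flow.
by rewrite (bintB mT fT)//; [rewrite hg subrr mulr0|exact: bmeas_flow].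
Qed.

(* Cauchy's theorem on the curve [t + i s(x + t v)]: up to [O(h)] the integrand
   is the increment along the flow of [E / (i q h)], [E] being the character
   continued to height [s], and increments have integral zero. *)
Lemma curve_term_gt0 k (c : C) : 0 < fdot k v ->
  exists K h0 : R, [/\ 0 <= K, 0 < h0 & forall h, 0 < h <= h0 ->
    (forall x, `|s (flow v h x) - s x| <= h) ->
  `|J (fun x => chi x * complex.Re (c * tchar k x *
      (expR (- ((fdot k v)%:~R * s x)))%:C * (1 +i* tau h x)))| <= K * h].
Proof.
set q : R := (fdot k v)%:~R => kv.
have q1 : 1 <= q by rewrite /q -[1]/(1%:~R) ler_int.
have q0 : 0 < q by rewrite (lt_le_trans _ q1).
have bJ : 0 <= J chi by apply: Rintegral_ge0 => x _.
exists (10 * normc c * q * J chi), (1 / (2 * q)); split.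
- by rewrite !mulr_ge0// ?normc_ge0// ltW.
- by rewrite divr_gt0// mulr_gt0.
move=> h /andP[h0 hh] sh.
have hq : q * h <= 1/2.
  by move: hh; rewrite ler_pdivlMr ?mulr_gt0//; lra.
have [E EE] : exists E : rvec R d -> C,
    forall x, E x = c * tchar k x * (expR (- (q * s x)))%:C by eexists.
have -> : (fun x => chi x * complex.Re (c * tchar k x *
    (expR (- (q * s x)))%:C * (1 +i* tau h x))) =
    (fun x => chi x * complex.Re (E x * (1 +i* tau h x))).
  by apply/funext => x; rewrite EE.
have bE : bcmeas E.
  rewrite (_ : E = fun x => c * tchar k x * (expR (- (q * s x)))%:C); last first.
    by apply/funext => x; rewrite EE.
  apply: bcmeasM; last exact/bcmeas_real/bmeas_exp/bmeasN/bmeasZ.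
  by apply: bcmeasM; [exact: bcmeas_cst|exact: bcmeas_tchar].
have [g gE] : exists g : rvec R d -> R,
    forall x, g x = chi x * complex.Re ((0 -i* (q * h)^-1) * E x) by eexists.
have bg : bmeas g.
  rewrite (_ : g = fun x => chi x * complex.Re ((0 -i* (q * h)^-1) * E x)); last first.
    by apply/funext => x; rewrite gE.
  by apply: bterm; apply: bcmeasM; [exact: bcmeas_cst|exact: bE].
have hg : J (fun x => g (flow v h x)) = J g.
  apply: bint_flow; first exact: bg.
  by move=> j x; rewrite !gE chi_per !EE tchar_shift2pi s_per.
have hK x : `|g (flow v h x) - g x - chi x * complex.Re (E x * (1 +i* tau h x))|
     <= (10 * normc c * q * h) * chi x.
  rewrite !gE chi_flow !EE tchar_flow -/q -!mulrBr normrM (ger0_norm (chi_ge0 x)).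
  rewrite [leRHS]mulrC; apply: ler_wpM2l; first exact: chi_ge0.
  apply: curve_pointwise; [exact: normc_tchar|exact: q1|exact: h0|exact: hq|exact: sh|exact: s_ge0].
have bEt : bmeas (fun x => chi x * complex.Re (E x * (1 +i* tau h x))).
  by apply: bterm; apply: bcmeasM; [exact: bE|exact: b1tau].
have bgg : bmeas (fun x => g (flow v h x) - g x).
  exact: (bmeasB (bmeas_flow v h bg) bg).
have Jr : J (fun x => chi x * complex.Re (E x * (1 +i* tau h x))) =
   - J (fun x => g (flow v h x) - g x - chi x * complex.Re (E x * (1 +i* tau h x))).
  rewrite (bintB mT fT bgg bEt) (bintB mT fT (bmeas_flow v h bg) bg) hg.
  by rewrite subrr sub0r opprK.
rewrite Jr normrN.
have br := bmeasB bgg bEt.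
apply: (le_trans (bint_norm mT fT br)).
have -> : 10 * normc c * q * J chi * h = J (fun x => (10 * normc c * q * h) * chi x).
  by rewrite (bintZ mT fT _ bchi); ring.
apply: (bint_le mT fT (bmeas_norm br) (bmeasZ _ bchi)) => x _.
exact: hK.
Qed.

(** Termwise addition of the two preceding cases. [K] and [h0] may depend on [p], since [h] tends to
    zero with [p] fixed. *)
Lemma curve_list p : analytic v p ->
  exists K h0 : R, [/\ 0 <= K, 0 < h0 & forall h, 0 < h <= h0 ->
    (forall x, `|s (flow v h x) - s x| <= h) ->
  `|J (fun x => chi x * complex.Re (tevals v s p x * (1 +i* tau h x))) -
    J (fun x => chi x * complex.Re (teval (tzero v p) x))| <= K * h].
Proof.
elim: p => [_|a p ih /= /andP[va vp]].
  exists 0, 1; split => // h _ _; rewrite (_ : (fun x => _) = fun=> 0); last first.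
    by apply/funext => x; rewrite /tevals big_nil mul0r mulr0.
  rewrite (_ : (fun x => chi x * _) = fun=> 0); last first.
    by apply/funext => x; rewrite teval_nil mulr0.
  by rewrite subrr normr0 mul0r.
have [K [h0 [K0 h00 H]]] := ih vp.
have [K' [h0' [K'0 h0'0 H']]] : exists K h0 : R, [/\ 0 <= K, 0 < h0 &
   forall h, 0 < h <= h0 -> (forall x, `|s (flow v h x) - s x| <= h) ->
  `|J (fun x => chi x * complex.Re (a.2 * tchar a.1 x *
      (expR (- ((fdot a.1 v)%:~R * s x)))%:C * (1 +i* tau h x))) -
    J (fun x => chi x * complex.Re ((fdot a.1 v == 0)%:R * a.2 * tchar a.1 x))| <= K * h].
  have [a0|a0] := eqVneq (fdot a.1 v) 0.
    exists 0, 1; split => // h /andP[h0_ _] _.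
    rewrite mul0r normr_le0 subr_eq0; apply/eqP.
    under eq_Rintegral do rewrite a0 mul0r oppr0 expR0 mulr1.
    rewrite curve_term_eq0// ?gt_eqF//.
    by under [RHS]eq_Rintegral do rewrite mul1r.
  have {}a0 : 0 < fdot a.1 v by rewrite lt_neqAle eq_sym a0.
  have [K1 [h1 [K10 h10 H1]]] := curve_term_gt0 a.2 a0.
  exists K1, h1; split => // h hh hs.
  rewrite [X in _ - X](_ : _ = 0) ?subr0; first exact: H1.
  under eq_Rintegral do rewrite !mul0r mulr0.
  by rewrite (bint_cst _ mT) mul0r.
exists (K' + K), (Num.min h0' h0); split; first by rewrite addr_ge0.
  by rewrite lt_min h0'0.
move=> h /andP[hp]; rewrite le_min => /andP[hh' hh] hs.
have {}H := H h _ hs; have {}H' := H' h _ hs.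
have -> : (fun x => chi x * complex.Re (tevals v s (a :: p) x * (1 +i* tau h x))) =
   (fun x => chi x * complex.Re (a.2 * tchar a.1 x *
      (expR (- ((fdot a.1 v)%:~R * s x)))%:C * (1 +i* tau h x)) +
      chi x * complex.Re (tevals v s p x * (1 +i* tau h x))).
  by apply/funext => x; rewrite /tevals big_cons [in LHS]mulrDl ReD mulrDr.
have -> : (fun x => chi x * complex.Re (teval (tzero v (a :: p)) x)) =
   (fun x => chi x * complex.Re ((fdot a.1 v == 0)%:R * a.2 * tchar a.1 x) +
      chi x * complex.Re (teval (tzero v p) x)).
  by apply/funext => x; rewrite /tzero teval_cons /= ReD mulrDr.
have bt k (c : C) : bcmeas (fun x => c * tchar k x).
  by apply: bcmeasM; [exact: bcmeas_cst|exact: bcmeas_tchar].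
rewrite !(bintD mT fT); last 4 first.
- exact: bterm.
- by apply: bterm; exact: bcmeas_teval.
- apply: bterm; apply: bcmeasM => //; apply: bcmeasM => //.
  by apply/bcmeas_real/bmeas_exp/bmeasN/bmeasZ.
- by apply: bterm; apply: bcmeasM => //; exact: bcmeas_tevals.
rewrite opprD addrACA mulrDl (le_trans (ler_normD _ _))// lerD//.
  by apply: H'; rewrite hp.
by apply: H; rewrite hp.
Qed.

(* M. Riesz's argument on a curve above the torus: the analytic function [p^(2m)]
   integrated against [1 + i s'] gives the mean of [p_0^(2m)], and the slope of
   [s] is at most 1/4. *)
Theorem curve_riesz p m : analytic v p -> (0 < m)%N ->
  (forall e : R, 0 < e -> exists2 h, 0 < h <= e &
     forall x, `|s (flow v h x) - s x| <= h / 4) ->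
  J (fun x => chi x * complex.Re (tevals v s p x) ^+ (2 * m)) <=
  4 * (17 * m%:R) ^+ (2 * m) *
    J (fun x => chi x * complex.Im (tevals v s p x) ^+ (2 * m)) +
  2 * J (fun x => chi x * normc (teval (tzero v p) x) ^+ (2 * m)).
Proof.
move=> ap m0 hs.
have [K [h0 [K0 h00 H]]] := curve_list (analytic_pow (2 * m) ap).
have [bre bim] := bcmeas_tevals p.
have b1 : bmeas (fun x => chi x * complex.Re (tevals v s p x) ^+ (2 * m)).
  by apply: bmeasM => //; exact: bmeasX.
have b2 : bmeas (fun x => chi x * complex.Im (tevals v s p x) ^+ (2 * m)).
  by apply: bmeasM => //; exact: bmeasX.
have b3 : bmeas (fun x => chi x * normc (teval (tzero v p) x) ^+ (2 * m)).
  by apply: bmeasM => //; apply: bmeasX; apply: bcmeas_normc; exact: bcmeas_teval.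
set A := J _; set B := J _; set D := J _.
suff key e : 0 < e -> 1/2 * A - 2 * (17 * m%:R) ^+ (2 * m) * B <= D + K * e.
  have : 1/2 * A - 2 * (17 * m%:R) ^+ (2 * m) * B <= D.
    apply/ler_addgt0Pr => e e0.
    have K1 : 0 < K + 1 by lra.
    rewrite (le_trans (key (e / (K + 1)) _)) ?divr_gt0// lerD2l.
    by rewrite mulrCA ger_pMr// ler_pdivrMr//; lra.
  lra.
move=> e0; have [|h /andP[hp]] := hs (Num.min e h0); first by rewrite lt_min e0.
rewrite le_min => /andP[he hh] hs4.
have {}hs4' x : `|s (flow v h x) - s x| <= h.
  by rewrite (le_trans (hs4 x))//; lra.
have := H h _ hs4'; rewrite hp hh => /(_ isT) {}H.
have bP : bcmeas (fun x => tevals v s (tpow p (2 * m)) x * (1 +i* tau h x)).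
  by apply: bcmeasM => //; exact: bcmeas_tevals.
have low : 1/2 * A - 2 * (17 * m%:R) ^+ (2 * m) * B <=
   J (fun x => chi x * complex.Re (tevals v s (tpow p (2 * m)) x * (1 +i* tau h x))).
  rewrite -(bintZ mT fT)// -(bintZ mT fT)// -(bintB mT fT); last 2 first.
  - exact: bmeasZ.
  - exact: bmeasZ.
  apply: (bint_le mT fT).
  - by apply: bmeasB; exact: bmeasZ.
  - exact: bterm.
  move=> x _; rewrite tevals_pow.
  have : `|tau h x| <= 1/4.
    rewrite /tau normrM normfV (gtr0_norm hp) ler_pdivrMr//.
    by rewrite (le_trans (hs4 x))//; lra.
  move=> /(riesz_pointwise (tevals v s p x) m0) h1.
  rewrite mulrCA (mulrCA _ (chi x)) -mulrBr ler_wpM2l//.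
have up : J (fun x => chi x * complex.Re (teval (tzero v (tpow p (2 * m))) x)) <= D.
  apply: (bint_le mT fT) => //; first by apply: bterm; exact: bcmeas_teval.
  move=> x _; rewrite teval_tzero_pow// ler_wpM2l// (le_trans (ler_norm _))//.
  by rewrite (le_trans (ler_normRe _))// normcX.
have := ler_norm (J (fun x => chi x * complex.Re (tevals v s (tpow p (2 * m)) x * (1 +i* tau h x))) -
  J (fun x => chi x * complex.Re (teval (tzero v (tpow p (2 * m))) x))).
have : K * h <= K * e by rewrite ler_wpM2l.
lra.
Qed.

End curve_integral.
End curve.

(** * Riesz's bound for projections onto half-spaces of frequencies *)

Section half_space_projections.
Local Open Scope complex_scope.
Context {R : realType} {d : nat}.
Local Notation C := R[i].
Local Notation mu := (@lebesgue_rvec R d).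
Local Notation T := (torus_cube d : set (rvec R d)).
Local Notation J f := (Rintegral mu T f).
Implicit Types (k v w : freq d) (x : rvec R d) (p q : @tpoly R d).

Let mT : measurable T := @cube_measurable R d.
Let fT : (mu T < +oo)%E := @cube_fin R d.

(* Convexity: the power function lies above its tangents. *)
Lemma tangent_pow (x y : R) n : 0 <= x -> 0 <= y ->
  y ^+ n.+1 + n.+1%:R * y ^+ n * (x - y) <= x ^+ n.+1.
Proof.
move=> x0 y0; elim: n => [|n ih]; first by rewrite !expr1 expr0; lra.
rewrite [leRHS]exprS; apply: le_trans (ler_wpM2l x0 ih).
rewrite -subr_ge0.
have -> : x * (y ^+ n.+1 + n.+1%:R * y ^+ n * (x - y)) -
   (y ^+ n.+2 + n.+2%:R * y ^+ n.+1 * (x - y)) =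
   n.+1%:R * y ^+ n * (x - y) ^+ 2.
  by rewrite -(natr1 n.+1) !exprS; ring.
by rewrite mulr_ge0 ?sqr_ge0// mulr_ge0// exprn_ge0.
Qed.

(* Averaging along the flow is a contraction; the polynomial [z^m (conj z)^(m-1)]
   is the duality map that shows it. *)
Lemma bint_tzero_le v p m : (0 < m)%N ->
  J (fun x => normc (teval (tzero v p) x) ^+ (2 * m)) <=
  J (fun x => normc (teval p x) ^+ (2 * m)).
Proof.
move=> m0; pose z := tzero v p.
pose q := tmul (tpow z m) (tpow (tconj z) m.-1).
have qE x : teval q x = teval z x ^+ m * conjc (teval z x) ^+ m.-1.
  by rewrite teval_mul !teval_pow teval_conj.
(* Same values as [z], but only invariant frequencies are listed; the duality polynomial built from
   [z'] is then itself fixed by [tzero], which can be moved across the pairing. *)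
pose z' : @tpoly R d := [seq t <- p | fdot t.1 v == 0].
have suppz : all (fun t : freq d * C => fdot t.1 v == 0) z'.
  exact: filter_all.
have tzzz q' x : all (fun t : freq d * C => fdot t.1 v == 0) q' -> teval (tzero v q') x = teval q' x.
  move=> /allP h; rewrite teval_tmult /teval big_seq [RHS]big_seq.
  by apply: eq_bigr => t /h /eqP ->; rewrite eqxx mul1r.
have zz' x : teval z x = teval z' x.
  rewrite teval_tmult /teval big_filter [RHS]big_mkcond; apply: eq_bigr => t _.
  by case: ifP => _; rewrite ?mul1r ?mul0r.
pose good (p' : @tpoly R d) := all (fun t : freq d * C => fdot t.1 v == 0) p'.
have gmul p1 p2 : good p1 -> good p2 -> good (tmul p1 p2).
  move=> /allP g1 /allP g2; apply/allP => t /allpairsP[[a b]] /= [pa pb ->] /=.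
  by move: (g1 _ pa) (g2 _ pb) => /eqP h1 /eqP h2; rewrite fdotDl h1 h2.
have gpow p1 n : good p1 -> good (tpow p1 n).
  move=> g1; elim: n => [|n ih] /=; last exact: gmul.
  by rewrite /good /= andbT /fdot big1// => j _; rewrite ffunE mul0r.
have gconj p1 : good p1 -> good (tconj p1).
  move=> /allP g1; apply/allP => t /mapP[a /g1 /eqP h ->] /=.
  by rewrite fdotNl h oppr0.
pose q' := tmul (tpow z' m) (tpow (tconj z') m.-1).
have q'E x : teval q' x = teval q x.
  by rewrite qE teval_mul !teval_pow teval_conj zz'.
have gq' : good q'.
  apply: gmul; first exact/gpow/suppz.
  exact/gpow/gconj/suppz.
have adj : J (fun x => complex.Re (teval z x * conjc (teval q' x))) =
           J (fun x => complex.Re (teval p x * conjc (teval q' x))).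
  have := bint_tmult_adj (fun k => (fdot k v == 0)%:R) p q'.
  have e1 x : teval (tmult (fun k => ((fdot k v == 0)%:R : R)%:C) p) x = teval z x.
    by rewrite /z /tzero !teval_tmult; apply: eq_bigr => t _; case: eqP.
  have e2 x : teval (tmult (fun k => ((fdot k v == 0)%:R : R)%:C) q') x = teval q' x.
    rewrite -[RHS](tzzz q')// /tzero !teval_tmult; apply: eq_bigr => t _.
    by case: eqP.
  under eq_Rintegral do rewrite e1.
  by under [RHS]eq_Rintegral do rewrite e2.
set n := (2 * m)%N; have n0 : (0 < n)%N by rewrite muln_gt0.
have nm : n = (m + m.-1).+1 by rewrite /n; lia.
have zq x : complex.Re (teval z x * conjc (teval q' x)) = normc (teval z x) ^+ n.
  rewrite q'E qE; set Z := teval z x.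
  have -> : Z * conjc (Z ^+ m * conjc Z ^+ m.-1) = (Z * conjc Z) ^+ m.
    have cX (W : C) j : conjc (W ^+ j) = conjc W ^+ j.
      by elim: j => [|j ih]; rewrite ?expr0 ?exprS ?conjcM ?ih//= oppr0.
    have zm : Z ^+ m = Z * Z ^+ m.-1 by rewrite -exprS prednK.
    by rewrite conjcM !cX conjcK exprMn zm; ring.
  have -> : Z * conjc Z = (normc Z ^+ 2)%:C.
    apply/eqP; rewrite eq_complex sqr_normcE; case: Z => a b /=.
    by apply/andP; split; apply/eqP; ring.
  by rewrite -rmorphXn /= -exprM.
have nq x : normc (teval q' x) = normc (teval z x) ^+ n.-1.
  by rewrite q'E qE normcM !normcX normc_conj -exprD nm.
have bz : bmeas (fun x => normc (teval z x)) by exact/bcmeas_normc/bcmeas_teval.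
have bp : bmeas (fun x => normc (teval p x)) by exact/bcmeas_normc/bcmeas_teval.
set A := J _; set B := J _.
have nR : 0 < n%:R :> R by rewrite ltr0n.
(* The tangent inequality [n |p| |z|^(n-1) <= |p|^n + (n - 1) |z|^n], integrated. *)
have key : n%:R * A <= B + (n%:R - 1) * A.
  have bzn : bmeas (fun x => normc (teval z x) ^+ n) by exact: bmeasX.
  have bpn : bmeas (fun x => normc (teval p x) ^+ n) by exact: bmeasX.
  have bpq : bmeas (fun x => complex.Re (teval p x * conjc (teval q' x))).
    by have [] := bcmeasM (bcmeas_teval p) (bcmeas_conj (bcmeas_teval q')).
  have -> : n%:R * A = J (fun x => n%:R * complex.Re (teval p x * conjc (teval q' x))).
    rewrite (bintZ mT fT _ bpq) -adj; congr (_ * _).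
    by apply: eq_Rintegral => x _; rewrite zq.
  have -> : B + (n%:R - 1) * A =
      J (fun x => normc (teval p x) ^+ n + (n%:R - 1) * normc (teval z x) ^+ n).
    by rewrite (bintD mT fT bpn (bmeasZ _ bzn)) (bintZ mT fT _ bzn).
  apply: (bint_le mT fT (bmeasZ _ bpq) (bmeasD bpn (bmeasZ _ bzn))).
  move=> x _.
  have h1 : complex.Re (teval p x * conjc (teval q' x)) <=
      normc (teval p x) * normc (teval z x) ^+ n.-1.
    rewrite (le_trans (ler_norm _))// (le_trans (ler_normRe _))//.
    by rewrite normcM normc_conj nq.
  have h2 := @tangent_pow (normc (teval p x)) (normc (teval z x)) n.-1
    (normc_ge0 _) (normc_ge0 _).
  rewrite (prednK n0) in h2.
  have h3 : normc (teval z x) ^+ n = normc (teval z x) * normc (teval z x) ^+ n.-1.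
    by rewrite -exprS (prednK n0).
  rewrite (le_trans (ler_wpM2l (ltW nR) h1))//.
  move: h2; rewrite h3; set X := normc (teval p x); set Y := normc _ => h2.
  by nra.
move: key; rewrite mulrBl mul1r; lra.
Qed.

(* Reflecting the frequencies with [k.w < 0] makes a polynomial analytic in the
   direction [w] without changing its real part. *)
Definition tana w p : @tpoly R d :=
  [seq if 0 <= fdot t.1 w then t else (- t.1, conjc t.2) | t <- p].

Definition tge w p := tmult (fun k => ((0 <= fdot k w)%R)%:R) p.

Lemma analytic_tana w p : analytic w (tana w p).
Proof.
apply/allP => t /mapP[a _ ->]; case: ifPn => // h.
by rewrite fdotNl oppr_ge0 ltW// ltNge.
Qed.

(** The harmonic counterpart of [tevals]: frequencies of both signs decay, so it is a Poisson
    integral along the orbit. *)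
Definition tpois w (s : rvec R d -> R) p x : C :=
  \sum_(t <- p) t.2 * tchar t.1 x * (expR (- (`|fdot t.1 w|%:~R * s x)))%:C.

Lemma Re_tana w s p x :
  complex.Re (tevals w s (tana w p) x) = complex.Re (tpois w s p x).
Proof.
rewrite /tevals /tpois big_map !Re_sum; apply: eq_bigr => t _.
case: ifPn => h; first by rewrite ger0_norm.
rewrite /= fdotNl ltr0_norm ?ltNge//.
rewrite tcharN -conjcM mulrC (mulrC (_ * _)) !ReZ; congr (_ * _).
by case: (_ * _).
Qed.

Lemma tevals_cst0 w p x : tevals w (fun=> 0) p x = teval p x.
Proof.
by apply: eq_bigr => t _; rewrite mulr0 oppr0 expR0 mulr1.
Qed.

Lemma tpois_cst0 w p x : tpois w (fun=> 0) p x = teval p x.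
Proof.
by apply: eq_bigr => t _; rewrite mulr0 oppr0 expR0 mulr1.
Qed.

Lemma teval_tzero_tana w p x :
  teval (tzero w (tana w p)) x = teval (tzero w p) x.
Proof.
rewrite !teval_tmult big_map; apply: eq_bigr => t _.
case: ifPn => //= h; have h' : fdot t.1 w != 0.
  by rewrite lt_eqF// ltNge.
by rewrite fdotNl oppr_eq0 (negbTE h') !mul0r.
Qed.

(** Reflected terms are conjugates, so their imaginary part changes sign, exactly as under [2 P - 1]
    with [P] the half-space projection. *)
Lemma Im_tana_scale w p x : complex.Im (teval (tana w p) x) =
  complex.Im (2 * teval (tge w p) x - teval p x).
Proof.
rewrite teval_tmult /teval mulr_sumr -sumrB big_map !Im_sum; apply: eq_bigr => t _.
case: ifPn => h /=; first by congr complex.Im; ring.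
rewrite tcharN -conjcM mul0r mul0r mulr0 sub0r.
by case: (_ * _).
Qed.

(** Used for [p] and for [i p], the preceding identity recovers both parts of [2 P p - p]. *)
Lemma normc_tge_le w p x : normc (teval (tge w p) x) <=
  (normc (teval p x) + `|complex.Im (teval (tana w p) x)| +
   `|complex.Im (teval (tana w (tmult (fun=> 'i%C) p)) x)|) / 2.
Proof.
rewrite !Im_tana_scale teval_scale.
have -> : teval (tge w (tmult (fun=> 'i%C) p)) x = 'i%C * teval (tge w p) x.
  by rewrite /tge tmult_comp !teval_tmult mulr_sumr; apply: eq_bigr => t _; ring.
set g := teval (tge w p) x; set P := teval p x.
have -> : 2 * ('i%C * g) - 'i%C * P = 'i%C * (2 * g - P) :> C by ring.
have h : 2 * normc g <= normc P + normc (2 * g - P).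
  have -> : 2 * normc g = normc (2 * g).
    by rewrite normcM; congr (_ * _); rewrite -[2]/(2%:R) -(rmorph_nat (real_complex R)) normcZ ger0_norm.
  have {1}-> : 2 * g = P + (2 * g - P) by ring.
  exact: le_normcD.
have := normc_le_ReIm (2 * g - P).
have -> : complex.Im ('i%C * (2 * g - P)) = complex.Re (2 * g - P).
  by rewrite ImM /= mul0r mul1r add0r.
lra.
Qed.

Definition hspace v (c : int) k : R := ((fdot k v <= c)%R)%:R.
Definition thalf v c p := tmult (fun k => (hspace v c k)%:C) p.

(* Multiplying by [tchar (- c a)] moves the half-space [k.v <= c] to the origin. *)
Lemma normc_thalf v a c p x : fdot a v = 1 ->
  normc (teval (thalf v c p) x) =
  normc (teval (tge (- v) (tshift (- (a *~ c)) p)) x).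
Proof.
move=> av; rewrite [in RHS]/teval /tge big_map big_map /=.
have e (t : freq d * C) : (0 <= fdot (t.1 - a *~ c) (- v)) = (fdot t.1 v <= c).
  have -> : fdot (t.1 - a *~ c) (- v) = c - fdot t.1 v.
    rewrite fdotNr fdotDl fdotNl.
    have -> : fdot (a *~ c) v = c.
      rewrite /fdot (eq_bigr (fun j => c * (a j * v j))); last first.
        move=> j _; have -> : (a *~ c) j = c * a j.
          case: c => n; rewrite ?NegzE ?mulNr; first by rewrite -pmulrn ffunMnE -mulr_natl natz.
          by rewrite mulrNz ffunE -pmulrn ffunMnE -mulr_natl natz.
        by rewrite mulrA.
      by rewrite -mulr_sumr -/(fdot a v) av mulr1.
    by ring.
  by rewrite subr_ge0.
have -> : \sum_(t <- p) ((0 <= fdot (t.1 - a *~ c) (- v))%R)%:R * t.2 * tchar (t.1 - a *~ c) x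
   = tchar (- (a *~ c)) x * teval (thalf v c p) x.
  rewrite teval_tmult mulr_sumr; apply: eq_bigr => t _.
  rewrite e tcharD /hspace; case: (_ <= c) => /=; ring.
by rewrite normcM normc_tchar mul1r.
Qed.

Lemma expr_sum3_le (x y z : R) n : 0 <= x -> 0 <= y -> 0 <= z ->
  ((x + y + z) / 2) ^+ n <= (3/2) ^+ n * (x ^+ n + y ^+ n + z ^+ n).
Proof.
move=> x0 y0 z0; pose M := Num.max x (Num.max y z).
have M0 : 0 <= M by rewrite le_max x0.
have xM : x <= M by rewrite le_max lexx.
have yM : y <= M by rewrite !le_max lexx orbT.
have zM : z <= M by rewrite !le_max lexx !orbT.
have : ((x + y + z) / 2) ^+ n <= (3/2 * M) ^+ n.
  by rewrite lerXn2r// ?nnegrE; lra.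
move=> /le_trans; apply; rewrite exprMn ler_wpM2l ?exprn_ge0//.
have xn := exprn_ge0 n x0; have yn := exprn_ge0 n y0; have zn := exprn_ge0 n z0.
rewrite /M; case: (leP x) => _; last by lra.
by case: (leP y) => _; lra.
Qed.

(** [curve_riesz] on the flat curve [s = 0], for [- i] times the analytic polynomial: this makes the
    conjugate part the real part, bounded by the known one. The constant is [6 = 4 + 2]. *)
Lemma riesz_tana w p m : (0 < m)%N ->
  J (fun x => complex.Im (teval (tana w p) x) ^+ (2 * m)) <=
  6 * (17 * m%:R) ^+ (2 * m) * J (fun x => normc (teval p x) ^+ (2 * m)).
Proof.
move=> m0; pose F := tmult (fun=> - 'i%C) (tana w p).
have aF : analytic w F by rewrite /analytic all_map; exact: analytic_tana.
have b0 : bmeas (fun _ : rvec R d => 0 : R) by exact: bmeas_cst.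
have b1 : bmeas (fun _ : rvec R d => 1 : R) by exact: bmeas_cst.
have := @curve_riesz R d w (fun=> 0) (fun=> 1) b0 (fun=> lexx _) (fun _ _ => erefl)
  b1 (fun=> ler01) (fun _ _ => erefl) (fun _ _ => erefl) F m aF m0.
have hs : forall e : R, 0 < e -> exists2 h, 0 < h <= e & forall x : rvec R d, `|0 - 0 : R| <= h / 4.
  move=> e e0; exists e; first by rewrite e0 lexx.
  by move=> x; rewrite subrr normr0 divr_ge0// ltW.
move=> /(_ hs).
have e0 x : 1 * complex.Re (tevals w (fun=> 0) F x) ^+ (2 * m) =
    complex.Im (teval (tana w p) x) ^+ (2 * m).
  by rewrite mul1r tevals_cst0 teval_scale ReM /=; congr (_ ^+ _); ring.
have e1 x : 1 * complex.Im (tevals w (fun=> 0) F x) ^+ (2 * m) =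
    complex.Re (teval p x) ^+ (2 * m).
  rewrite mul1r tevals_cst0 teval_scale ImM.
  rewrite -(tevals_cst0 w) Re_tana tpois_cst0 /= oppr0 mul0r add0r mulN1r.
  by rewrite !exprM sqrrN.
have e2 x : 1 * normc (teval (tzero w F) x) ^+ (2 * m) =
    normc (teval (tzero w p) x) ^+ (2 * m).
  rewrite mul1r -[in RHS]teval_tzero_tana /F.
  have -> : teval (tzero w (tmult (fun=> - 'i%C) (tana w p))) x =
      - 'i%C * teval (tzero w (tana w p)) x.
    by rewrite /tzero tmult_comp !teval_tmult mulr_sumr; apply: eq_bigr => t _; ring.
  by rewrite normcM normcN_i mul1r.
under eq_Rintegral do rewrite e0.
under [X in _ <= _ * X + _]eq_Rintegral do rewrite e1.
under [X in _ <= _ + _ * X]eq_Rintegral do rewrite e2.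
have h2 := bint_tzero_le w p m0.
have bp : bmeas (fun x => normc (teval p x) ^+ (2 * m)).
  by apply: bmeasX; exact/bcmeas_normc/bcmeas_teval.
have h1 : J (fun x => complex.Re (teval p x) ^+ (2 * m)) <= J (fun x => normc (teval p x) ^+ (2 * m)).
  apply: (bint_le mT fT) => //.
    by apply: bmeasX; case: (bcmeas_teval p).
  move=> x _; rewrite exprM -real_normK ?num_real// -exprM.
  by rewrite lerXn2r// ?nnegrE ?normc_ge0//; exact: ler_normRe.
have k1 : 1 <= (17 * m%:R) ^+ (2 * m) :> R.
  have : 1 <= m%:R :> R by rewrite ler1n.
  by move=> ?; rewrite exprn_ege1//; lra.
have B0 : 0 <= J (fun x => normc (teval p x) ^+ (2 * m)).
  by apply: Rintegral_ge0 => x _; rewrite exprn_ge0// normc_ge0.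
move=> /le_trans; apply.
set K := (17 * _) ^+ _ in k1 *.
move: h1 h2 B0; set B := J (fun x => normc (teval p x) ^+ _).
set A := J _; set D := J _ => h1 h2 B0.
have : 4 * K * A <= 4 * K * B by rewrite ler_wpM2l//; lra.
have : B <= K * B by rewrite -{1}[B]mul1r ler_wpM2r.
lra.
Qed.

Theorem riesz_thalf v a c p m : fdot a v = 1 -> (0 < m)%N ->
  J (fun x => normc (teval (thalf v c p) x) ^+ (2 * m)) <=
  (104 * m%:R) ^+ (2 * m) * J (fun x => normc (teval p x) ^+ (2 * m)).
Proof.
move=> av m0; pose f := tshift (- (a *~ c)) p.
have nf x : normc (teval f x) = normc (teval p x).
  by rewrite teval_shift normcM normc_tchar mul1r.
have h1 := riesz_tana (- v) f m0.
have h2 := riesz_tana (- v) (tmult (fun=> 'i%C) f) m0.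
have e2 x : normc (teval (tmult (fun=> 'i%C) f) x) = normc (teval p x).
  by rewrite teval_scale normcM nf normc_i mul1r.
have nf' : (fun x => normc (teval f x) ^+ (2 * m)) = (fun x => normc (teval p x) ^+ (2 * m)).
  by apply/funext => x; rewrite nf.
have e2' : (fun x => normc (teval (tmult (fun=> 'i%C) f) x) ^+ (2 * m)) =
    (fun x => normc (teval p x) ^+ (2 * m)).
  by apply/funext => x; rewrite e2.
rewrite nf' in h1; rewrite e2' in h2.
have bp : bmeas (fun x => normc (teval p x) ^+ (2 * m)).
  by apply: bmeasX; exact/bcmeas_normc/bcmeas_teval.
have bA q : bmeas (fun x => complex.Im (teval (tana (- v) q) x) ^+ (2 * m)).
  by apply: bmeasX; case: (bcmeas_teval (tana (- v) q)).
set A1 := J _ in h1; set A2 := J _ in h2; set B := J _ in h1 h2 *.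
have evn (r : R) : `|r| ^+ (2 * m) = r ^+ (2 * m).
  by rewrite exprM real_normK ?num_real// -exprM.
have : J (fun x => normc (teval (thalf v c p) x) ^+ (2 * m)) <=
   (3/2) ^+ (2 * m) * (B + A1 + A2).
  rewrite -(bintD mT fT)// -(bintD mT fT)//; last exact: bmeasD.
  rewrite -(bintZ mT fT); last by apply: bmeasD => //; exact: bmeasD.
  apply: (bint_le mT fT).
  - by apply: bmeasX; exact/bcmeas_normc/bcmeas_teval.
  - by apply: bmeasZ; apply: bmeasD => //; exact: bmeasD.
  move=> x _; rewrite (normc_thalf _ _ _ av) -nf.
  rewrite -[complex.Im _ ^+ _]evn -[X in _ * (_ + _ + X)]evn.
  apply: le_trans (expr_sum3_le _ (normc_ge0 _) (normr_ge0 _) (normr_ge0 _)).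
  rewrite lerXn2r// ?nnegrE ?normc_ge0//; last exact: normc_tge_le.
  by rewrite divr_ge0// !addr_ge0// normc_ge0.
move=> /le_trans; apply.
have B0 : 0 <= B.
  by apply: Rintegral_ge0 => x _; rewrite exprn_ge0// normc_ge0.
have k1 : 1 <= (17 * m%:R) ^+ (2 * m) :> R.
  have : 1 <= m%:R :> R by rewrite ler1n.
  by move=> ?; rewrite exprn_ege1//; lra.
(* With [K = (17 m)^(2m)], the three moments total at most [13 K B], absorbed by [4^(2m) >= 16].
   This extra base 4 gives [4 * 51/2 = 102], rounded up to 104. *)
have -> : 104 * m%:R = 4 * (3/2 * (17 * m%:R)) + (2 * m%:R) :> R by field.
have k4 : 16 <= 4 ^+ (2 * m) :> R.
  by rewrite exprM (le_trans (_ : _ <= (4 ^+ 2) ^+ 1))// ?ler_weXn2l//; lra.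
have hs : (4 * (3/2 * (17 * m%:R))) ^+ (2 * m) <=
    (4 * (3/2 * (17 * m%:R)) + 2 * m%:R) ^+ (2 * m) :> R.
  rewrite lerXn2r// ?nnegrE ?lerDl ?addr_ge0// ?mulr_ge0//.
apply: le_trans (ler_wpM2r B0 hs).
rewrite [X in _ <= X * _]exprMn [X in _ <= _ * X * _]exprMn -!mulrA.
set K := (17 * _) ^+ _ in k1 h1 h2 *; set S := (3 / 2) ^+ _.
have S0 : 0 <= S by rewrite exprn_ge0//.
rewrite [leRHS]mulrCA ler_wpM2l//.
have : 16 * (K * B) <= 4 ^+ (2 * m) * (K * B).
  by rewrite ler_wpM2r// mulr_ge0// (le_trans ler01).
have : B <= K * B by rewrite -{1}[B]mul1r ler_wpM2r.
lra.
Qed.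

(** Coprime entries, by Bezout; the lattice vector [a] is what allows a half-space orthogonal to [v]
    to be moved to the origin. *)
Definition primitive v := exists a, fdot a v = 1.

Definition halfs (L : seq (freq d * int)) k : R :=
  \prod_(h <- L) hspace h.1 h.2 k.

Definition thalfs L p := tmult (fun k => (halfs L k)%:C) p.

Lemma teval_thalfs_cons h L p x :
  teval (thalfs (h :: L) p) x = teval (thalf h.1 h.2 (thalfs L p)) x.
Proof.
rewrite /thalfs /thalf tmult_comp !teval_tmult; apply: eq_bigr => t _.
by rewrite /halfs big_cons rmorphM.
Qed.

(** One factor [104 m] per half-space: at most [D] of them cost [m^D], the source of the logarithmic
    power in the class. *)
Lemma riesz_thalfs L p m : (forall h, h \in L -> primitive h.1) -> (0 < m)%N ->
  J (fun x => normc (teval (thalfs L p) x) ^+ (2 * m)) <=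
  (104 * m%:R) ^+ (2 * m * size L) * J (fun x => normc (teval p x) ^+ (2 * m)).
Proof.
move=> + m0; elim: L => [_|h L ih hL].
  rewrite muln0 expr0 mul1r le_eqVlt; apply/orP; left; apply/eqP.
  apply: eq_Rintegral => x _; congr (normc _ ^+ _); rewrite teval_tmult.
  by apply: eq_bigr => t _; rewrite /halfs big_nil mul1r.
have [a av] : primitive h.1 by apply: hL; rewrite mem_head.
under eq_Rintegral do rewrite teval_thalfs_cons.
rewrite (le_trans (riesz_thalf _ _ av m0))// mulnS exprD -mulrA.
apply: ler_wpM2l; first by rewrite exprn_ge0// mulr_ge0.
by apply: ih => g gL; apply: hL; rewrite inE gL orbT.
Qed.

End half_space_projections.

(** * Integrals over one period and the Poisson kernel *)

Section fiber_integrals.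
Local Open Scope complex_scope.
Context {R : realType}.
Local Notation leb := (@lebesgue_measure R).

Definition sym_itv (r : R) : set (measurableTypeR R) := [set t | - r <= t <= r].

Lemma sym_itvE (r : R) : sym_itv r = `[- r, r]%classic.
Proof. by apply/seteqP; split => t /=; rewrite in_itv. Qed.

Lemma measurable_sym_itv (r : R) : measurable (sym_itv r).
Proof. by rewrite sym_itvE; exact: measurable_itv. Qed.

Lemma lebesgue_sym_itv (r : R) : 0 <= r -> leb (sym_itv r) = (2 * r)%:E.
Proof.
move=> r0; rewrite sym_itvE lebesgue_measure_itv /= lte_fin.
case: ltP => h; first by rewrite -EFinD; congr (_%:E); ring.
have -> : r = 0 by lra.
by rewrite mulr0.
Qed.

Lemma sym_itv_fin (r : R) : (leb (sym_itv r) < +oo)%E.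
Proof.
rewrite sym_itvE lebesgue_measure_itv /=; case: ifPn => // _.
by rewrite -EFinD ltry.
Qed.

Lemma bmeas_shift1 (f : measurableTypeR R -> R) (a : R) :
  bmeas f -> bmeas (fun t : measurableTypeR R => f (t + a)).
Proof.
move=> [mf [M fM]]; split; last by exists M => x; exact: fM.
apply: measurableT_comp => //.
exact: measurable_funD.
Qed.

Lemma bint_sym_period (f : measurableTypeR R -> R) (a : R) :
  bmeas f -> (forall t, f (t + 2 * pi) = f t) ->
  Rintegral leb (sym_itv pi) (fun t => f (t + a)) = Rintegral leb (sym_itv pi) f.
Proof.
move=> bf fper.
have key (g : measurableTypeR R -> R) : bmeas g -> (forall t, 0 <= g t) ->
    (forall t, g (t + 2 * pi) = g t) ->
  (\int[leb]_(t in sym_itv pi) (g t)%:E =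
   \int[leb]_(t in [set t | (0 <= t < 2 * pi)%R]) (g t)%:E)%E.
  move=> [mg _] g0 gper.
  have mE : measurable_fun setT (fun t : measurableTypeR R => (g t)%:E).
    exact/measurable_EFinP.
  have E0 t : (0 <= (g t)%:E)%E by rewrite lee_fin.
  rewrite -(ge0_integral_period (- pi) mE E0); last by move=> t; rewrite gper.
  rewrite sym_itvE -integral_itv_bndo_bndc; last exact: measurable_funTS.
  rewrite (ge0_integral_translation (- pi))//; last exact: measurable_funTS.
  congr (integral _ _ _); apply/seteqP; split => t /=; rewrite in_itv/=;
   move=> /andP[? ?]; apply/andP; split; lra.
have [mf [M fM]] := bf.
pose g t := f t + M.
have bg : bmeas g by apply: bmeasD => //; exact: bmeas_cst.
have g0 t : 0 <= g t.
  by rewrite /g -lerBlDr sub0r; have := fM t; rewrite ler_norml => /andP[].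
have gper t : g (t + 2 * pi) = g t by rewrite /g fper.
have gs : Rintegral leb (sym_itv pi) (fun t => g (t + a)) = Rintegral leb (sym_itv pi) g.
  rewrite /Rintegral; congr fine.
  rewrite (key (fun t => g (t + a))); last 3 first.
  - exact: bmeas_shift1.
  - by move=> t; exact: g0.
  - by move=> t; rewrite addrAC gper.
  rewrite (key g)//; apply: ge0_integral_period.
  - by apply/measurable_EFinP; case: bg.
  - by move=> t; rewrite lee_fin.
  - by move=> t; rewrite gper.
move: gs; rewrite /g (bintD (measurable_sym_itv _) (sym_itv_fin _) (bmeas_shift1 a bf) (bmeas_cst _)).
rewrite (bintD (measurable_sym_itv _) (sym_itv_fin _) bf (bmeas_cst _)).
by move/addIr.
Qed.

Lemma bmeas_trig1 (c : R[i]) (q : R) :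
  bmeas (fun t : measurableTypeR R => complex.Re (c * expi (t * q))).
Proof.
have m1 : measurable_fun setT (fun t : measurableTypeR R => t * q).
  exact: mulrr_measurable.
under [X in bmeas X]funext do rewrite ReM.
apply: bmeasB; apply: bmeasM; try exact: bmeas_cst; split.
- apply: (@measurableT_comp _ _ _ _ _ _ (@cos R)) => //.
  by apply: continuous_measurable_fun; exact: continuous_cos.
- by exists 1 => t; exact: cos_max.
- apply: (@measurableT_comp _ _ _ _ _ _ (@sin R)) => //.
  by apply: continuous_measurable_fun; exact: continuous_sin.
- by exists 1 => t; exact: sin_max.
Qed.

Lemma bint_trig1 (c : R[i]) (q : int) :
  Rintegral leb (sym_itv pi) (fun t => complex.Re (c * expi (t * q%:~R))) =
  if q == 0 then 2 * pi * complex.Re c else 0.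
Proof.
case: eqP => [->|/eqP q0].
  under eq_Rintegral do rewrite mulr0 expi0 mulr1.
  rewrite (bint_cst _ (measurable_sym_itv _)).
  by rewrite [X in fine X](lebesgue_sym_itv (@pi_ge0 R)) /= mulrC.
have q0' : q%:~R != 0 :> R by rewrite intr_eq0.
have bf := bmeas_trig1 c q%:~R.
have per t : complex.Re (c * expi ((t + 2 * pi) * q%:~R)) = complex.Re (c * expi (t * q%:~R)).
  by rewrite mulrDl [2 * pi * _]mulrC expiD expi_2pi_int mulr1.
have := bint_sym_period (pi / q%:~R) bf per.
have -> : (fun t : R => complex.Re (c * expi ((t + pi / q%:~R) * q%:~R))) =
    (fun t => - complex.Re (c * expi (t * q%:~R))).
  apply/funext => t; rewrite mulrDl divfK// expiD.
  have -> : expi pi = -1 :> R[i].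
    by apply/eqP; rewrite /expi cospi sinpi eq_complex /= oppr0 !eqxx.
  by rewrite mulrN1 mulrN; case: (c * _).
rewrite (bintN (measurable_sym_itv _) (sym_itv_fin _) bf).
lra.
Qed.

Definition poisson (r t : R) : R := (1 - r ^+ 2) / (1 - 2 * r * cos t + r ^+ 2).

Lemma poisson_denom_gt0 (r t : R) : 0 <= r < 1 -> 0 < 1 - 2 * r * cos t + r ^+ 2.
Proof.
move=> /andP[r0 r1]; have := cos_le1 t; have : 0 < (1 - r) ^+ 2.
  by rewrite exprn_gt0// subr_gt0.
nra.
Qed.

Lemma poisson_ge0 (r t : R) : 0 <= r < 1 -> 0 <= poisson r t.
Proof.
move=> r01; rewrite /poisson divr_ge0//; last exact/ltW/poisson_denom_gt0.
by case/andP: r01 => ? ?; rewrite subr_ge0; nra.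
Qed.

Lemma bmeas_poisson (r : R) : 0 <= r < 1 -> bmeas (poisson r : measurableTypeR R -> R).
Proof.
move=> r01; split.
  apply: continuous_measurable_fun => t; rewrite /poisson.
  apply: cvgM; first exact: cvg_cst.
  apply: cvgV; first by rewrite gt_eqF// poisson_denom_gt0.
  apply: cvgD; last exact: cvg_cst.
  apply: cvgB; first exact: cvg_cst.
  apply: cvgM; first exact: cvg_cst.
  exact: continuous_cos.
have /andP[r0 r1] := r01.
exists ((1 - r ^+ 2) / (1 - r) ^+ 2) => t.
have d0 : 0 < (1 - r) ^+ 2 by rewrite exprn_gt0// subr_gt0.
rewrite ger0_norm ?poisson_ge0// /poisson ler_wpM2l//.
  by rewrite subr_ge0; nra.
rewrite lef_pV2 ?posrE ?poisson_denom_gt0//.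
by have := cos_le1 t; nra.
Qed.

(** Multiplying by the denominator of the kernel gives a three-term recurrence for the integrals
    [I n], with characteristic roots [r] and [1 / r]. Boundedness excludes [1 / r], and the equation
    at [n = 0] fixes the amplitude. *)
Lemma poisson_trig (r : R) (c : R[i]) (q : int) : 0 <= r < 1 ->
  Rintegral leb (sym_itv pi) (fun t => poisson r t * complex.Re (c * expi (t * q%:~R)))
  = 2 * pi * r ^+ `|q|%N * complex.Re c.
Proof.
move=> r01; have /andP[r0 r1] := r01.
have mI := measurable_sym_itv (@pi R); have fI := sym_itv_fin (@pi R).
pose I (n : int) := Rintegral leb (sym_itv pi)
  (fun t => poisson r t * complex.Re (c * expi (t * n%:~R))).
have bI n : bmeas (fun t : measurableTypeR R => poisson r t * complex.Re (c * expi (t * n%:~R))).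
  by apply: bmeasM; [exact: bmeas_poisson|exact: bmeas_trig1].
have rec n : (1 + r ^+ 2) * I n - r * (I (n + 1) + I (n - 1)) =
    if n == 0 then (1 - r ^+ 2) * (2 * pi * complex.Re c) else 0.
  have -> : (if n == 0 then (1 - r ^+ 2) * (2 * pi * complex.Re c) else 0) =
     (1 - r ^+ 2) * Rintegral leb (sym_itv pi) (fun t => complex.Re (c * expi (t * n%:~R))).
    by rewrite bint_trig1; case: ifP => // _; rewrite mulr0.
  rewrite -(bintZ mI fI _ (bmeas_trig1 _ _)).
  have bs := bmeasD (bI (n + 1)) (bI (n - 1)).
  rewrite /I -(bintD mI fI (bI (n + 1)) (bI (n - 1))) -(bintZ mI fI _ bs).
  rewrite -(bintZ mI fI (1 + r ^+ 2) (bI n)).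
  rewrite -(bintB mI fI (bmeasZ _ (bI n)) (bmeasZ _ bs)).
  apply: eq_Rintegral => t _.
  have -> : complex.Re (c * expi (t * (n + 1)%:~R)) =
     complex.Re (c * expi (t * n%:~R)) * cos t - complex.Im (c * expi (t * n%:~R)) * sin t.
    by rewrite intrD mulrDr mulr1 expiD mulrA ReM.
  have -> : complex.Re (c * expi (t * (n - 1)%:~R)) =
     complex.Re (c * expi (t * n%:~R)) * cos t + complex.Im (c * expi (t * n%:~R)) * sin t.
    by rewrite intrB mulrBr mulr1 expiD mulrA ReM /= cosN sinN mulrN opprK.
  have := poisson_denom_gt0 t r01; rewrite /poisson => d0.
  by field; rewrite gt_eqF.
have [M IM] : exists M, forall n, `|I n| <= M.
  have bP : bmeas (fun t : measurableTypeR R => normc c * poisson r t).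
    by apply: bmeasZ; exact: bmeas_poisson.
  exists (Rintegral leb (sym_itv pi) (fun t => normc c * poisson r t)) => n.
  apply: le_trans (bint_norm mI fI (bI n)) _.
  apply: (bint_le mI fI (bmeas_norm (bI n)) bP) => t _.
  rewrite normrM (ger0_norm (poisson_ge0 _ r01)) mulrC ler_wpM2r ?poisson_ge0//.
  by rewrite (le_trans (ler_normRe _))// normcM normc_expi mulr1.
have [->|rn0] := eqVneq r 0.
  under eq_Rintegral do rewrite /poisson expr0n subr0 mulr0 mul0r subr0 addr0 divr1 mul1r.
  by rewrite bint_trig1 expr0n absz_eq0; case: eqP; rewrite ?mulr1// ?mulr0 ?mul0r.
have rp : 0 < r by rewrite lt_neqAle eq_sym rn0.
(* A bounded sequence growing like [r^(-n)] vanishes; it is applied to [Z n.+1 - r * Z n]. *)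
have dec (W : nat -> R) (B : R) : (forall n, `|W n| <= B) -> (forall n, r * W n.+1 = W n) ->
    forall n, W n = 0.
  move=> WB Wr n; apply/eqP; rewrite -normr_le0; apply/ler_addgt0Pr => e e0.
  have Wn k : W n = r ^+ k * W (n + k)%N.
    elim: k => [|k ih]; first by rewrite expr0 mul1r addn0.
    by rewrite ih -Wr addnS exprSr mulrA.
  have B0 : 0 <= B by rewrite (le_trans _ (WB 0)).
  have [k hk] : exists k, r ^+ k * B <= e.
    have := @cvg_expr R r; rewrite ger0_norm// => /(_ r1) h.
    have e1 : 0 < e / (B + 1) by rewrite divr_gt0//; lra.
    have /cvgrPdist_le /(_ _ e1) [k _ hk] := h.
    exists k; have := hk k (leqnn k); rewrite /= sub0r normrN ger0_norm ?exprn_ge0//.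
    rewrite ler_pdivlMr; last by lra.
    by have := exprn_ge0 k r0; nra.
  rewrite add0r (Wn k) normrM ger0_norm ?exprn_ge0// (le_trans _ hk)//.
  by rewrite ler_wpM2l ?exprn_ge0.
have geo (Z : nat -> R) : (forall n, `|Z n| <= M) ->
    (forall n, (1 + r ^+ 2) * Z n.+1 - r * (Z n.+2 + Z n) = 0) ->
    forall n, Z n = r ^+ n * Z 0%N.
  move=> ZM Zr.
  have W0 : forall n, Z n.+1 - r * Z n = 0.
    apply: (dec _ (M + r * M)).
      move=> n; rewrite (le_trans (ler_normB _ _))// lerD// normrM ger0_norm//.
      by rewrite ler_wpM2l.
    by move=> n; have := Zr n; lra.
  elim=> [|n ih]; first by rewrite expr0 mul1r.
  by rewrite exprS -mulrA -ih; have := W0 n; lra.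
have pos := geo (fun n => I n%:Z) (fun n => IM _).
have neg := geo (fun n => I (- n%:Z)) (fun n => IM _).
have {}pos n : I n%:Z = r ^+ n * I 0.
  apply: pos => k; have := rec k.+1%:Z; rewrite (_ : k.+1%:Z == 0 = false)//.
  rewrite (_ : k.+1%:Z + 1 = k.+2%:Z); last by lia.
  by rewrite (_ : k.+1%:Z - 1 = k%:Z)//; lia.
have {}neg n : I (- n%:Z) = r ^+ n * I 0.
  rewrite neg ?oppr0// => k; have := rec (- k.+1%:Z).
  rewrite (_ : - k.+1%:Z == 0 = false); last by lia.
  rewrite (_ : - k.+1%:Z - 1 = - k.+2%:Z); last by lia.
  rewrite (_ : - k.+1%:Z + 1 = - k%:Z); last by lia.
  by rewrite [X in r * X]addrC.
have I0 : I 0 = 2 * pi * complex.Re c.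
  have := rec 0; rewrite eqxx add0r sub0r (pos 1%N) (neg 1%N) expr1 => h.
  have h1 : 0 < 1 - r ^+ 2 by nra.
  apply: (mulfI (lt0r_neq0 h1)); rewrite -h; ring.
rewrite -/(I q); case: q => n; first by rewrite absz_nat pos I0; ring.
by rewrite NegzE neg abszN absz_nat I0; ring.
Qed.

End fiber_integrals.

(** * Integrals over orbit windows and the height function *)

Section fiber_averages.
Local Open Scope complex_scope.
Context {R : realType} {d : nat}.
Local Notation C := R[i].
Local Notation leb := (@lebesgue_measure R).
Local Notation mu := (@lebesgue_rvec R d).
Local Notation T := (torus_cube d : set (rvec R d)).
Local Notation J f := (Rintegral mu T f).
Implicit Types (k v w : freq d) (x : rvec R d) (p q : @tpoly R d).

Let mT : measurable T := @cube_measurable R d.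
Let fT : (mu T < +oo)%E := @cube_fin R d.

Lemma measurable_flow2 w : measurable_fun setT
  (fun z : rvec R d * measurableTypeR R => flow w z.2 z.1 : rvec R d).
Proof.
apply/measurable_fun_tnthP => i.
rewrite (_ : _ \o _ = fun z : rvec R d * measurableTypeR R =>
    tnth z.1 i + z.2 * (w i)%:~R); last first.
  by apply/funext => z /=; rewrite tnth_mktuple.
apply: measurable_funD.
  apply: (@measurableT_comp _ _ _ _ _ _ (fun x : rvec R d => tnth x i)) => //.
  exact: measurable_tnth.
apply: (@measurableT_comp _ _ _ _ _ _ (fun t : measurableTypeR R => t * (w i)%:~R)) => //.
exact: mulrr_measurable.
Qed.

Lemma bmeas_fiber w (G : rvec R d -> R) x : bmeas G ->
  bmeas (fun t : measurableTypeR R => G (flow w t x)).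
Proof.
move=> [mG [M GM]]; split; last by exists M => t; exact: GM.
apply: (@measurableT_comp _ _ _ _ _ _ G) => //.
apply: (@measurableT_comp _ _ _ _ _ _
  (fun z : rvec R d * measurableTypeR R => flow w z.2 z.1 : rvec R d)
  _ (fun t => (x, t))); first exact: measurable_flow2.
exact: pair1_measurable.
Qed.

(** Not divided by the length of [D], so that nested and adjacent windows compare and add
    directly. *)
Definition favg_on (D : set (measurableTypeR R)) w (G : rvec R d -> R) x : R :=
  Rintegral leb D (fun t => G (flow w t x)).

Lemma bmeas_favg_on D w G : measurable D -> (leb D < +oo)%E -> bmeas G ->
  (forall x, 0 <= G x) -> bmeas (favg_on D w G).
Proof.
move=> mD fD bG G0; have [mG [M GM]] := bG; split.
  pose g (z : rvec R d * measurableTypeR R) : \bar R :=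
    (((fun z => (G (flow w z.2 z.1))%:E) \_ (setT `*` D)) z)%E.
  have mg : measurable_fun setT g.
    apply/(measurable_restrictT _ _).1; first exact: measurableX.
    apply: measurable_funTS; apply/measurable_EFinP.
    apply: (@measurableT_comp _ _ _ _ _ _ G) => //; exact: measurable_flow2.
  have g0 z : (0 <= g z)%E.
    by rewrite /g patchE; case: ifPn => // _; rewrite lee_fin.
  have := @measurable_fun_fubini_tonelli_F _ _ _ _ _ leb g mg g0.
  have mfine : measurable_fun setT (@fine R) by exact: fine_measurable.
  move/(measurableT_comp mfine).
  congr (measurable_fun _ _); apply/funext => x /=.
  rewrite /favg_on /Rintegral /fubini_F; congr fine; rewrite [RHS]integral_mkcond.
  by apply: eq_integral => t _; rewrite /g !patchE in_setX in_setT.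
exists (M * fine (leb D)) => x.
apply: le_trans (bint_norm mD fD (bmeas_fiber w x bG)) _.
rewrite -(bint_cst leb mD M); apply: (bint_le mD fD).
- exact/bmeas_norm/bmeas_fiber.
- exact: bmeas_cst.
- by move=> t _; exact: GM.
Qed.

(** Tonelli, then invariance of the integral under the flow at each time. *)
Lemma bint_favg_on D w G : measurable D -> (leb D < +oo)%E -> bmeas G ->
  (forall x, 0 <= G x) -> (forall j x, G (shift2pi j x) = G x) ->
  J (favg_on D w G) = fine (leb D) * J G.
Proof.
move=> mD fD bG G0 Gper; have [mG [M GM]] := bG.
pose g (z : rvec R d * measurableTypeR R) : \bar R :=
  (((fun z => (G (flow w z.2 z.1))%:E) \_ (T `*` D)) z)%E.
have mg : measurable_fun setT g.
  apply/(measurable_restrictT _ _).1; first exact: measurableX.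
  apply: measurable_funTS; apply/measurable_EFinP.
  apply: (@measurableT_comp _ _ _ _ _ _ G) => //; exact: measurable_flow2.
have g0 z : (0 <= g z)%E.
  by rewrite /g patchE; case: ifPn => // _; rewrite lee_fin.
have := @fubini_tonelli _ _ _ _ _ mu leb g mg g0.
have -> : (\int[mu]_x fubini_F leb g x = (J (favg_on D w G))%:E)%E.
  rewrite bint_EFin//; last exact: bmeas_favg_on.
  rewrite [RHS]integral_mkcond; apply: eq_integral => x _.
  rewrite /fubini_F [RHS]patchE; case: ifPn => xT.
    rewrite /favg_on bint_EFin//; last exact: bmeas_fiber.
    rewrite [RHS]integral_mkcond; apply: eq_integral => t _.
    by rewrite /g !patchE in_setX xT.
  by rewrite integral0_eq// => t _; rewrite /g patchE in_setX (negbTE xT).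
have -> : (\int[leb]_t fubini_G mu g t = (fine (leb D) * J G)%:E)%E.
  transitivity (\int[leb]_(t in D) (J G)%:E)%E; last first.
    move: (J G) => c; rewrite (integral_cst leb mD c%:E) EFinM fineK; first exact: muleC.
    by rewrite ge0_fin_numE.
  rewrite [RHS]integral_mkcond; apply: eq_integral => t _.
  rewrite /fubini_G [RHS]patchE; case: ifPn => tD.
    rewrite -(bint_flow w t bG Gper) bint_EFin//; last exact: bmeas_flow.
    rewrite [RHS]integral_mkcond; apply: eq_integral => x _.
    by rewrite /g !patchE in_setX tD andbT.
  by rewrite integral0_eq// => x _; rewrite /g patchE in_setX (negbTE tD) andbF.
by move=> [].
Qed.

Section maximal.
Variables (w : freq d) (G : rvec R d -> R).
Hypotheses (bG : bmeas G) (G0 : forall x, 0 <= G x)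
  (Gper : forall j x, G (shift2pi j x) = G x).

Definition favg (r : R) x := favg_on (sym_itv r) w G x.

Lemma bmeas_favg r : bmeas (favg r).
Proof.
by apply: bmeas_favg_on => //; [exact: measurable_sym_itv|exact: sym_itv_fin].
Qed.

Lemma favg_shift2pi r j x : favg r (shift2pi j x) = favg r x.
Proof.
by apply: eq_Rintegral => t _; rewrite flow_shift2pi Gper.
Qed.

Lemma favg_subset (D1 D2 : set (measurableTypeR R)) x :
  measurable D1 -> measurable D2 -> (leb D2 < +oo)%E -> D1 `<=` D2 ->
  favg_on D1 w G x <= favg_on D2 w G x.
Proof.
move=> m1 m2 f2 D12.
have f1 : (leb D1 < +oo)%E.
  by rewrite (le_lt_trans _ f2)// le_measure// inE.
rewrite -lee_fin !bint_EFin//; try exact: bmeas_fiber.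
apply: ge0_subset_integral => //.
- apply/measurable_EFinP; apply: measurable_funTS.
  by have [] := bmeas_fiber w x bG.
- by move=> t _; rewrite lee_fin.
Qed.

Lemma favg_le r1 r2 x : r1 <= r2 -> favg r1 x <= favg r2 x.
Proof.
move=> r12; apply: favg_subset; rewrite ?sym_itv_fin//; try exact: measurable_sym_itv.
by move=> t /andP[? ?]; apply/andP; split; lra.
Qed.

Lemma favg_flow_le r h x : favg r x <= favg (r + `|h|) (flow w h x).
Proof.
have mD : measurable ([set t | - (r + `|h|) <= t - h <= r + `|h|] : set (measurableTypeR R)).
  rewrite (_ : [set t | _] = `[h - (r + `|h|), h + (r + `|h|)]%classic); first exact: measurable_itv.
  by apply/seteqP; split => t /=; rewrite in_itv/= => /andP[? ?]; apply/andP; split; lra.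
have -> : favg (r + `|h|) (flow w h x) =
   favg_on [set t | - (r + `|h|) <= t - h <= r + `|h|] w G x.
  rewrite /favg /favg_on /Rintegral; congr fine.
  rewrite [RHS](ge0_integral_translation h)//; last 2 first.
  - apply: measurable_funTS; apply/measurable_EFinP.
    by have [] := bmeas_fiber w x bG.
  - by move=> t; rewrite lee_fin.
  have -> : (fun t => t + h) @^-1` [set t | - (r + `|h|) <= t - h <= r + `|h|] =
      sym_itv (r + `|h|).
    by apply/seteqP; split => t /=; rewrite addrK.
  by apply: eq_integral => t _; rewrite flowD.
apply: favg_subset => //; first exact: measurable_sym_itv.
- rewrite (_ : [set t | _] = `[h - (r + `|h|), h + (r + `|h|)]%classic).
    by rewrite lebesgue_measure_itv /=; case: ifPn => // _; rewrite -EFinD ltry.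
  by apply/seteqP; split => t /=; rewrite in_itv/= => /andP[? ?]; apply/andP; split; lra.
- move=> t /= /andP[? ?]; have := ler_norm h; have := ler_norm (- h).
  by rewrite normrN => ? ?; apply/andP; split; lra.
Qed.

(** The direction is integral, so orbits close up after time [2 pi] and the full window sees one
    whole turn. *)
Lemma favg_pi_flow h x : favg pi (flow w h x) = favg pi x.
Proof.
rewrite /favg /favg_on -(bint_sym_period h (bmeas_fiber w x bG)).
  by apply: eq_Rintegral => t _; rewrite flowD.
move=> t; rewrite addrC -flowD; move: (flow w t x) => y.
(* Periodicity is given for one period in one coordinate: first extend it to integer multiples, then
   to several coordinates. *)
have per1 j (n : int) z : G (xadd (fun i => if i == j then n%:~R * (2 * pi) else 0) z) = G z.
  have nat_case (m : nat) z' : G (xadd (fun i => if i == j then m%:R * (2 * pi) else 0) z') = G z'.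
    elim: m => [|m ih] in z' *.
      congr G; apply: eq_from_tnth => i; rewrite tnth_mktuple.
      by case: ifP; rewrite ?mul0r addr0.
    transitivity (G (shift2pi j (xadd (fun i => if i == j then m%:R * (2 * pi) else 0) z'))).
      congr G; apply: eq_from_tnth => i; rewrite !tnth_mktuple.
      by case: ifP => _ //; rewrite -natr1; ring.
    by rewrite Gper ih.
  case: n => n; first exact: nat_case.
  rewrite NegzE -[LHS](nat_case n.+1); congr G; apply: eq_from_tnth => i.
  rewrite !tnth_mktuple; case: ifP => _; last by rewrite !addr0.
  by rewrite mulrNz pmulrn; ring.
have part (s : seq 'I_d) z : uniq s ->
   G (xadd (fun i => if i \in s then 2 * pi * (w i)%:~R else 0) z) = G z.
  elim: s => [_|j s ih /= /andP[js us]].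
    by congr G; apply: eq_from_tnth => i; rewrite tnth_mktuple in_nil addr0.
  rewrite -[RHS]ih// -[RHS](per1 j (w j)); congr G; apply: eq_from_tnth => i.
  rewrite !tnth_mktuple inE; have [->|ij] /= := eqVneq i j.
    by rewrite (negbTE js) addr0 mulrC.
  by rewrite addr0.
rewrite -[RHS](part (enum 'I_d) y (enum_uniq _)); congr G; apply: eq_from_tnth => i.
by rewrite !tnth_mktuple mem_enum.
Qed.

Variable lam : R.
Hypothesis lam0 : 0 < lam.

Definition dyad (j m : nat) : R := pi * m%:R / 2 ^+ j.

(* The minimum keeps the half-lengths below [pi], so that [sigma] is a supremum
   over all dyadic half-lengths in [[0, pi]]. *)
Definition sval (j m : nat) x : R :=
  favg (dyad j (minn m (2 ^ j))) x / lam - dyad j (minn m (2 ^ j)).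

Definition sigma_set x : set R := [set y | exists j m, y = sval j m x].

(** By construction [favg r x <= lam (r + sigma x)] for dyadic [r] up to [pi], a growth that a
    Poisson kernel at height comparable with [sigma] absorbs. It vanishes where no window carries
    more than [lam r]. Countably many half-lengths keep it measurable. *)
Definition sigma x : R := sup (sigma_set x).

Lemma dyad_le_pi j m : (m <= 2 ^ j)%N -> 0 <= dyad j m <= pi.
Proof.
move=> mj; rewrite /dyad divr_ge0 ?mulr_ge0 ?pi_ge0 ?exprn_ge0//=.
by rewrite ler_pdivrMr ?exprn_gt0// ler_wpM2l ?pi_ge0// -natrX ler_nat.
Qed.

Lemma sval_le j m x : sval j m x <= favg pi x / lam.
Proof.
have /andP[h0 h1] := dyad_le_pi (geq_minr m (2 ^ j)).
rewrite /sval lerBlDr (le_trans (_ : _ <= favg pi x / lam))// ?lerDl//.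
by rewrite ler_pM2r ?invr_gt0// favg_le.
Qed.

Lemma sigma_has_sup x : has_sup (sigma_set x).
Proof.
split; first by exists (sval 0 0 x), 0%N, 0%N.
by exists (favg pi x / lam) => _ [j [m ->]]; exact: sval_le.
Qed.

Lemma sval_le_sigma j m x : sval j m x <= sigma x.
Proof. by apply: ub_le_sup; [case: (sigma_has_sup x)|exists j, m]. Qed.

Lemma sigma_le x c : (forall j m, sval j m x <= c) -> sigma x <= c.
Proof.
move=> h; apply: ge_sup; first by case: (sigma_has_sup x).
by move=> _ [j [m ->]].
Qed.

Lemma sval0 x : sval 0 0 x = 0.
Proof.
rewrite /sval /dyad min0n mulr0 mul0r subr0.
rewrite (_ : favg 0 x = 0) ?mul0r// /favg /favg_on /Rintegral.
rewrite (_ : sym_itv 0 = [set 0]); first by rewrite integral_set1.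
rewrite /sym_itv oppr0; apply/seteqP; split => t /=; last by move=> ->; rewrite lexx.
by move=> /andP[h1 h2]; apply/eqP; rewrite eq_le h1 h2.
Qed.

Lemma sigma_ge0 x : 0 <= sigma x.
Proof. by rewrite -(sval0 x) sval_le_sigma. Qed.

Lemma sigma_le_favg x : sigma x <= favg pi x / lam.
Proof. by apply: sigma_le => j m; exact: sval_le. Qed.

Lemma favg_dyad_le i x : favg (dyad i 1) x <= lam * (dyad i 1 + sigma x).
Proof.
have := sval_le_sigma i 1 x; rewrite /sval (minn_idPl _) ?expn_gt0//.
by rewrite lerBlDl ler_pdivrMr// mulrC.
Qed.

Lemma favg_le_sigma0 x : sigma x = 0 -> favg pi x <= lam * pi.
Proof.
move=> s0; have := favg_dyad_le 0 x.
by rewrite s0 addr0 /dyad expr0 mulr1 divr1.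
Qed.

(* A window of half-length [r] around [x] lies in the one of half-length
   [r + |h|] around the translate, unless that exceeds the period. *)
Lemma sigma_flow_ge i h x : `|h| = pi / 2 ^+ i -> sigma x - `|h| <= sigma (flow w h x).
Proof.
move=> hE; rewrite lerBlDr; apply: sigma_le => j m.
rewrite /sval; set m1 := minn m (2 ^ j).
have m1j : (m1 <= 2 ^ j)%N by exact: geq_minr.
pose k := (i + j)%N; pose m2 := (m1 * 2 ^ i)%N; pose n := (2 ^ j)%N.
have dE : dyad j m1 = dyad k m2.
  by rewrite /dyad natrM natrX exprD; field; rewrite !expf_neq0.
have hE' : `|h| = dyad k n by rewrite hE /dyad natrX exprD; field; rewrite !expf_neq0.
have dD a b : dyad k (a + b) = dyad k a + dyad k b.
  by rewrite /dyad natrD; field; rewrite expf_neq0.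
have [le|lt] := leqP (m2 + n) (2 ^ k).
  have := sval_le_sigma k (m2 + n) (flow w h x).
  rewrite /sval (minn_idPl le) dD -hE' -dE.
  have := favg_flow_le (dyad j m1) h x.
  rewrite -(@ler_pM2r _ lam^-1) ?invr_gt0//; lra.
have := sval_le_sigma k (2 ^ k) (flow w h x).
rewrite /sval minnn.
have pE : dyad k (2 ^ k) = pi by rewrite /dyad natrX mulfK// expf_neq0.
rewrite pE favg_pi_flow.
have : pi <= dyad j m1 + `|h|.
  rewrite dE hE' -dD -[leLHS]pE /dyad ler_pM2r ?invr_gt0 ?exprn_gt0//.
  by rewrite ler_pM2l ?pi_gt0// ler_nat ltnW.
have : favg (dyad j m1) x / lam <= favg pi x / lam.
  rewrite ler_pM2r ?invr_gt0// favg_le//.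
  by case/andP: (dyad_le_pi m1j).
lra.
Qed.

(** Dyadic steps match the dyadic half-lengths; [curve_riesz] asks only for arbitrarily small
    steps. *)
Lemma sigma_lipschitz i x : `|sigma (flow w (pi / 2 ^+ i) x) - sigma x| <= pi / 2 ^+ i.
Proof.
have h0 : 0 <= pi / 2 ^+ i :> R by rewrite divr_ge0 ?pi_ge0// exprn_ge0.
have h1 := @sigma_flow_ge i (pi / 2 ^+ i) x (ger0_norm h0).
have h2 := @sigma_flow_ge i (- (pi / 2 ^+ i)) (flow w (pi / 2 ^+ i) x).
rewrite normrN flowD addNr flow0 (ger0_norm h0) in h2.
rewrite (ger0_norm h0) in h1.
by have := h2 erefl; rewrite ler_norml => h3; apply/andP; split; lra.
Qed.

Lemma bmeas_sval j m : bmeas (sval j m).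
Proof.
apply: bmeasB; last exact: bmeas_cst.
under [X in bmeas X]funext do rewrite mulrC.
by apply: bmeasZ; exact: bmeas_favg.
Qed.

Lemma bmeas_sigma : bmeas sigma.
Proof.
have bb : bmeas (fun x => lam^-1 * favg pi x) by apply: bmeasZ; exact: bmeas_favg.
apply: (bmeas_le _ bb); last first.
  by move=> x; rewrite ger0_norm ?sigma_ge0// mulrC sigma_le_favg.
apply: (measurability _ (RGenOInfty.measurableE R)) => //.
move=> _ [_ [a ->] <-]; rewrite setTI.
rewrite [X in measurable X](_ : _ = \bigcup_j \bigcup_m (sval j m @^-1` `]a, +oo[)).
  apply: bigcup_measurable => j _; apply: bigcup_measurable => m _.
  rewrite -[X in measurable X]setTI.
  by have [ms _] := bmeas_sval j m; exact: ms.
apply/seteqP; split => x /=.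
  rewrite in_itv/= andbT => ax.
  have [_ [j [m ->]] h] := sup_gt (sigma_has_sup x).1 ax.
  by exists j => //; exists m => //=; rewrite in_itv/= andbT.
move=> [j _ [m _]] /=; rewrite !in_itv/= !andbT => h.
by rewrite (lt_le_trans h)// sval_le_sigma.
Qed.

Lemma sigma_shift2pi j x : sigma (shift2pi j x) = sigma x.
Proof.
congr sup; apply/seteqP; split => y [i [m ->]]; exists i, m;
  by rewrite /sval favg_shift2pi.
Qed.

End maximal.
End fiber_averages.

(** * Hopf's maximal ergodic inequality *)

Section hopf.
Local Open Scope complex_scope.
Context {R : realType} {d : nat}.
Local Notation leb := (@lebesgue_measure R).
Local Notation mu := (@lebesgue_rvec R d).
Local Notation T := (torus_cube d : set (rvec R d)).
Local Notation J f := (Rintegral mu T f).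
Implicit Types (w : freq d) (x : rvec R d).

Let mT : measurable T := @cube_measurable R d.
Let fT : (mu T < +oo)%E := @cube_fin R d.

Lemma bmeas_max0 (f : rvec R d -> R) : bmeas f -> bmeas (fun x => Num.max 0 (f x)).
Proof.
move=> bf; rewrite (_ : (fun x => _) = fun x => 2^-1 * (f x + `|f x|)).
  by apply: bmeasZ; apply: bmeasD => //; exact: bmeas_norm.
apply/funext => x; case: leP => h.
  by rewrite ger0_norm//; field.
by rewrite ltr0_norm// subrr mulr0.
Qed.

Section maximal_sums.
Variables (w : freq d) (h : R) (f : rvec R d -> R).
Hypotheses (bf : bmeas f) (fper : forall j x, f (shift2pi j x) = f x).

(* The maximum of 0 and the first [n] ergodic sums of [f] under the rotation
   [flow w h]. *)
Fixpoint hopf_max (n : nat) (x : rvec R d) : R :=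
  if n is n'.+1 then Num.max 0 (f x + hopf_max n' (flow w h x)) else 0.

Lemma bmeas_hopf_max n : bmeas (hopf_max n).
Proof.
elim: n => [|n ih]; first exact: bmeas_cst.
by apply: bmeas_max0; apply: bmeasD => //; exact: bmeas_flow.
Qed.

Lemma hopf_max_shift2pi n j x : hopf_max n (shift2pi j x) = hopf_max n x.
Proof. by elim: n x => [//|n ih] x /=; rewrite fper flow_shift2pi ih. Qed.

Lemma hopf_max_ge0 n x : 0 <= hopf_max n x.
Proof. by case: n => [//|n] /=; rewrite le_max lexx. Qed.

Lemma hopf_max_leS n x : hopf_max n x <= hopf_max n.+1 x.
Proof.
elim: n x => [|n ih] x; first by rewrite hopf_max_ge0.
rewrite [leLHS]/= [leRHS]/= ge_max !le_max lexx /=; apply/orP; right.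
by rewrite lerD2l; exact: ih.
Qed.

(** Where the maximum [M] is positive, [M x <= f x + M (flow w h x)]; elsewhere [M x = 0]. So the
    increment [M x - M (flow w h x)], of integral zero, is at most [f] on the set [M > 0] and at
    most 0 off it. *)
Lemma hopf_inequality n :
  0 <= J (fun x => f x * \1_[set x | 0 < hopf_max n.+1 x] x).
Proof.
pose M := hopf_max n.+1.
have bM : bmeas M by exact: bmeas_hopf_max.
have bMf : bmeas (fun x => M (flow w h x)) by exact: bmeas_flow.
have mP : measurable [set x | 0 < M x].
  rewrite [X in measurable X](_ : _ = M @^-1` `]0, +oo[); last first.
    by apply/seteqP; split => x /=; rewrite in_itv/= andbT.
  by rewrite -[X in measurable X]setTI; case: bM => m _; exact: m.
have b1 : bmeas (fun x => f x * \1_[set x | 0 < M x] x).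
  by apply: bmeasM => //; exact: bmeas_indic.
have e0 : 0 = J (fun x => M x - M (flow w h x)).
  rewrite (bintB mT fT bM bMf) (bint_flow w h bM) ?subrr// => j x.
  exact: hopf_max_shift2pi.
rewrite [leLHS]e0.
apply: (bint_le mT fT (bmeasB bM bMf) b1) => x _.
have h1 := hopf_max_leS n (flow w h x); have h2 := hopf_max_ge0 n.+1 (flow w h x).
rewrite indicE; case: (boolP (x \in _)); rewrite ?inE /= => hx.
  rewrite mulr1 lerBlDr (le_trans (_ : _ <= f x + hopf_max n (flow w h x)))//.
    have ME : M x = Num.max 0 (f x + hopf_max n (flow w h x)) by [].
    move: hx; rewrite ME lt_max ltxx /= => h3.
    by rewrite ge_max (ltW h3) lexx.
  by rewrite lerD2l.
have -> : M x = 0.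
  apply/eqP; rewrite eq_le hopf_max_ge0 andbT leNgt; apply/negP => h3.
  by move/negP: hx; apply; rewrite inE.
by rewrite sub0r mulr0 oppr_le0.
Qed.

(** Meant for excesses of segment integrals, for which subadditivity suffices. *)
Lemma hopf_max_ge (S : nat -> rvec R d -> R) n m x :
  (forall x, S 0%N x <= 0) ->
  (forall i x, S i.+1 x <= f x + S i (flow w h x)) -> (m <= n)%N ->
  S m x <= hopf_max n x.
Proof.
move=> S0 SS; elim: n m x => [|n ih] m x.
  by rewrite leqn0 => /eqP ->; exact: S0.
case: m => [_|m mn]; first by rewrite (le_trans (S0 x))// hopf_max_ge0.
by rewrite /= le_max; apply/orP; right; rewrite (le_trans (SS m x))// lerD2l ih.
Qed.

End maximal_sums.
End hopf.

(** * Weak-type bound for the set where the height is positive *)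

Section weak_type.
Local Open Scope complex_scope.
Context {R : realType} {d : nat}.
Local Notation leb := (@lebesgue_measure R).
Local Notation mu := (@lebesgue_rvec R d).
Local Notation T := (torus_cube d : set (rvec R d)).
Local Notation J f := (Rintegral mu T f).
Implicit Types (w : freq d) (x : rvec R d).

Let mT : measurable T := @cube_measurable R d.
Let fT : (mu T < +oo)%E := @cube_fin R d.

Variable (G : rvec R d -> R).
Hypotheses (bG : bmeas G) (G0 : forall x, 0 <= G x)
  (Gper : forall j x, G (shift2pi j x) = G x).

Definition seg (a b : R) : set (measurableTypeR R) := [set t | a <= t <= b].

Lemma segE (a b : R) : seg a b = `[a, b]%classic.
Proof. by apply/seteqP; split => t /=; rewrite in_itv. Qed.

Lemma measurable_seg (a b : R) : measurable (seg a b).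
Proof. by rewrite segE; exact: measurable_itv. Qed.

Lemma seg_fin (a b : R) : (leb (seg a b) < +oo)%E.
Proof.
rewrite segE lebesgue_measure_itv /=; case: ifPn => // _.
by rewrite -EFinD ltry.
Qed.

Lemma favg_on_seg_le w (a b c : R) x : a <= b -> b <= c ->
  favg_on (seg a c) w G x <= favg_on (seg a b) w G x + favg_on (seg b c) w G x.
Proof.
move=> ab bc; have [mg _] := bmeas_fiber w x bG.
have bg := bmeas_fiber w x bG.
have mg' D : measurable_fun D (fun t : measurableTypeR R => (G (flow w t x))%:E).
  by apply/measurable_EFinP; exact: measurable_funTS.
rewrite -lee_fin EFinD !bint_EFin//; try exact: measurable_seg; try exact: seg_fin.
have -> : seg a c = seg a b `|` (seg b c `\` seg a b).
  rewrite setDE setUIr setUv setIT; apply/seteqP; split => t /=.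
    by move=> /andP[h1 h2]; case: (leP t b) => h3; [left|right]; apply/andP; split => //; lra.
  by move=> [] /andP[h1 h2]; apply/andP; split; lra.
rewrite ge0_integral_setU//; last 4 first.
- exact: measurable_seg.
- by apply: measurableD; exact: measurable_seg.
- by move=> t _; rewrite lee_fin.
- by rewrite disj_set2E setDIK.
rewrite leeD2l//; apply: ge0_subset_integral => //.
- by apply: measurableD; exact: measurable_seg.
- exact: measurable_seg.
- by move=> t _; rewrite lee_fin.
Qed.

Lemma favg_on_seg_flow w (a b h : R) x :
  favg_on (seg (a + h) (b + h)) w G x = favg_on (seg a b) w G (flow w h x).
Proof.
rewrite /favg_on /Rintegral; congr fine.
rewrite (ge0_integral_translation h)//; last 3 first.
- exact: measurable_seg.
- apply: measurable_funTS; apply/measurable_EFinP.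
  by have [] := bmeas_fiber w x bG.
- by move=> t; rewrite lee_fin.
have -> : (fun t => t + h) @^-1` seg (a + h) (b + h) = seg a b.
  by apply/seteqP; split => t /=; rewrite /seg /= !lerD2r.
by apply: eq_integral => t _; rewrite flowD.
Qed.

Lemma flowN w t x : flow (- w) t x = flow w (- t) x.
Proof.
by apply: eq_from_tnth => j; rewrite !tnth_mktuple ffunE mulrNz mulrN mulNr.
Qed.

Lemma favg_on_segN w (r : R) x :
  favg_on (seg (- r) 0) w G x = favg_on (seg 0 r) (- w) G x.
Proof.
rewrite /favg_on /Rintegral; congr fine.
have mN : measurable_fun setT (-%R : measurableTypeR R -> measurableTypeR R).
  exact: oppr_measurable.
have -> : (\int[leb]_(t in seg (- r) 0) (G (flow w t x))%:E =
   \int[pushforward leb (-%R : measurableTypeR R -> measurableTypeR R)]_(t in seg (- r) 0)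
     (G (flow w t x))%:E)%E.
  by apply: eq_measure_integral => //= A mA _; exact/esym/lebesgue_measureN.
rewrite ge0_integral_pushforward//; last 3 first.
- exact: measurable_seg.
- apply: measurable_funTS; apply/measurable_EFinP.
  by have [] := bmeas_fiber w x bG.
- by move=> t _; rewrite lee_fin.
have -> : -%R @^-1` seg (- r) 0 = seg 0 r.
  by apply/seteqP; split => t /=; rewrite /seg /= => /andP[? ?]; apply/andP; split; lra.
by apply: eq_integral => t _ /=; rewrite flowN.
Qed.

(** With [f] the excess of the integral over one step of length [h] above [l h], the excess over [m]
    steps is dominated by [hopf_max]. Hopf's inequality on the set where that maximum is positive
    reads [l h mu(D) <= h J G]. *)
Lemma weak_one_sided w (l h : R) n : 0 < l -> 0 < h ->
  exists D : set (rvec R d), [/\ measurable D,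
    (mu (D `&` T) <= (J G / l)%:E)%E &
    forall x m, (m <= n)%N -> l * (m%:R * h) < favg_on (seg 0 (m%:R * h)) w G x -> D x].
Proof.
move=> l0 h0; pose f x := favg_on (seg 0 h) w G x - l * h.
have bA : bmeas (favg_on (seg 0 h) w G).
  by apply: bmeas_favg_on => //; [exact: measurable_seg|exact: seg_fin].
have bf : bmeas f by apply: bmeasB => //; exact: bmeas_cst.
have fper j x : f (shift2pi j x) = f x.
  rewrite /f; congr (_ - _); apply: eq_Rintegral => t _.
  by rewrite flow_shift2pi Gper.
pose M := hopf_max w h f n.+1.
have bM : bmeas M by exact: bmeas_hopf_max.
have mP : measurable [set x | 0 < M x].
  rewrite [X in measurable X](_ : _ = M @^-1` `]0, +oo[); last first.
    by apply/seteqP; split => x /=; rewrite in_itv/= andbT.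
  by rewrite -[X in measurable X]setTI; case: bM => m _; exact: m.
have fP : (mu ([set x | (0 < M x)%R] `&` T) < +oo)%E.
  by rewrite (le_lt_trans _ fT)// le_measure// ?inE//; exact: measurableI.
exists [set x | 0 < M x]; split => //.
  have := hopf_inequality w h bf fper n; rewrite -/M => hh.
  have b1 : bmeas (\1_[set x | 0 < M x] : rvec R d -> R) by exact: bmeas_indic.
  have h1 : J (fun x => f x * \1_[set x | 0 < M x] x) <= h * J G - l * h * fine (mu ([set x | 0 < M x] `&` T)).
    have -> : h * J G = J (favg_on (seg 0 h) w G).
      rewrite bint_favg_on//; [|exact: measurable_seg|exact: seg_fin].
      congr (_ * _); rewrite segE lebesgue_measure_itv/= lte_fin h0.
      by rewrite -EFinD subr0.
    rewrite -(bint_indic mu mT mP) -(bintZ mT fT _ b1) -(bintB mT fT bA (bmeasZ _ b1)).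
    apply: (bint_le mT fT (bmeasM bf b1) (bmeasB bA (bmeasZ _ b1))) => x _.
    have a0 : 0 <= favg_on (seg 0 h) w G x by apply: Rintegral_ge0 => t _.
    rewrite /f indicE; case: (_ \in _); rewrite ?mulr1 ?mulr0 ?subr0//.
  rewrite -[X in (X <= _)%E]fineK ?ge0_fin_numE// lee_fin ler_pdivlMr//.
  rewrite -(@ler_pM2r _ h)//; lra.
move=> x m mn hm /=; rewrite /M.
pose S m x := favg_on (seg 0 (m%:R * h)) w G x - l * (m%:R * h).
apply: lt_le_trans (@hopf_max_ge _ _ w h f S n.+1 m x _ _ (leqW mn)).
- by rewrite /S subr_gt0.
- move=> y; rewrite /S !mul0r mulr0 subr0 /favg_on /Rintegral.
  rewrite (_ : seg 0 0 = [set 0]); first by rewrite integral_set1.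
  rewrite /seg; apply/seteqP; split => t /=; last by move=> ->; rewrite lexx.
  by move=> /andP[h1 h2]; apply/eqP; rewrite eq_le h1 h2.
- move=> i y; rewrite /S /f -natr1 mulrDl mul1r.
  have ih0 : 0 <= i%:R * h by rewrite mulr_ge0// ltW.
  have := @favg_on_seg_le w 0 h (i%:R * h + h) y (ltW h0) _.
  rewrite lerDr => /(_ ih0).
  have := @favg_on_seg_flow w 0 (i%:R * h) h y; rewrite add0r => ->.
  lra.
Qed.

(** If a window of half-length [r] carries more than [lam r], one of its halves carries more than
    [(lam / 2) r]; each side costs [2 J G / lam], hence the 4. The sets [D j] increase, since a
    finer grid contains the old windows, and the bound passes to their union. *)
Lemma weak_type_sigma w (lam : R) : 0 < lam ->
  (mu ([set x | (0 < sigma w G lam x)%R] `&` T) <= (4 * J G / lam)%:E)%E.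
Proof.
move=> lam0.
pose D j := [set x | exists m, 0 < sval w G lam j m x] `&` T.
have mD j : measurable (D j).
  apply: measurableI => //.
  rewrite [X in measurable X](_ : _ = \bigcup_m (sval w G lam j m @^-1` `]0, +oo[)).
    apply: bigcup_measurable => m _; rewrite -[X in measurable X]setTI.
    by have [ms _] := bmeas_sval w bG G0 lam j m; exact: ms.
  apply/seteqP; split => x /=.
    by move=> [m h]; exists m => //=; rewrite in_itv/= andbT.
  by move=> [m _] /=; rewrite in_itv/= andbT => h; exists m.
have DE : [set x | 0 < sigma w G lam x] `&` T = \bigcup_j D j.
  apply/seteqP; split => [x [/= s0 xT]|x [j _ [[m h] xT]]].
    have [_ [j [m ->]] h] := sup_gt (sigma_has_sup w bG G0 lam0 x).1 s0.
    by exists j => //; split => //; exists m.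
  split => //=; apply: (lt_le_trans h).
  exact: sval_le_sigma.
have Dnd : nondecreasing_seq D.
  apply/nondecreasing_seqP => j; apply/subsetPset => x [[m h] xT]; split => //.
  exists (minn m (2 ^ j) * 2)%N.
  have -> : sval w G lam j.+1 (minn m (2 ^ j) * 2) x = sval w G lam j m x; last exact: h.
  rewrite /sval (minn_idPl (_ : _ <= 2 ^ j.+1)%N); last first.
    by rewrite expnSr leq_mul2r geq_minr orbT.
  have -> : dyad j.+1 (minn m (2 ^ j) * 2) = dyad j (minn m (2 ^ j)) :> R.
    by rewrite /dyad natrM exprSr; field; rewrite expf_neq0.
  by [].
have bound j : (mu (D j) <= (4 * J G / lam)%:E)%E.
  have l2 : 0 < lam / 2 by rewrite divr_gt0.
  have h0 : 0 < pi / 2 ^+ j :> R by rewrite divr_gt0 ?pi_gt0// exprn_gt0.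
  have [D1 [m1 u1 D1P]] := weak_one_sided w (2 ^ j)%N l2 h0.
  have [D2 [m2 u2 D2P]] := weak_one_sided (- w) (2 ^ j)%N l2 h0.
  have m12 : measurable ((D1 `&` T) `|` (D2 `&` T)).
    by apply: measurableU; exact: measurableI.
  apply: (@le_trans _ _ (mu ((D1 `&` T) `|` (D2 `&` T)))).
    apply: le_measure; rewrite ?inE//.
    move=> x [[m hm] xT]; move: hm; rewrite /sval; set k := minn m _ => hm.
    have kj : (k <= 2 ^ j)%N by exact: geq_minr.
    have dE : dyad j k = k%:R * (pi / 2 ^+ j) :> R by rewrite /dyad; ring.
    have {}hm : lam * dyad j k < favg w G (dyad j k) x.
      by move: hm; rewrite subr_gt0 ltr_pdivlMr// mulrC.
    have le2 : favg w G (dyad j k) x <=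
        favg_on (seg 0 (dyad j k)) (- w) G x + favg_on (seg 0 (dyad j k)) w G x.
      rewrite -favg_on_segN; apply: favg_on_seg_le.
        by rewrite oppr_le0; case/andP: (@dyad_le_pi R j k kj).
      by case/andP: (@dyad_le_pi R j k kj).
    rewrite dE in hm le2.
    have [h1|h1] := ltP (lam / 2 * (k%:R * (pi / 2 ^+ j))) (favg_on (seg 0 (k%:R * (pi / 2 ^+ j))) w G x).
      by left; split => //; exact: (D1P x k).
    by right; split => //; apply: (D2P x k) => //; lra.
  apply: (le_trans (measureU2 _ _ _)); try exact: measurableI.
  apply: (le_trans (leeD u1 u2)); rewrite -EFinD lee_fin.
  by rewrite le_eqVlt; apply/orP; left; apply/eqP; field; rewrite gt_eqF.
rewrite DE.
have := @nondecreasing_cvg_mu _ _ _ mu D mD (bigcup_measurable (fun j _ => mD j)) Dnd.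
move=> cv; rewrite -(cvg_lim _ cv)//; apply: lime_le.
  by apply/cvg_ex; eexists; exact: cv.
by near=> j; exact: bound.
Unshelve. all: by end_near. Qed.

End weak_type.

(** * The Poisson extension at the height given by the window integrals *)

Section poisson_bound.
Local Open Scope complex_scope.
Context {R : realType} {d : nat}.
Local Notation C := R[i].
Local Notation leb := (@lebesgue_measure R).
Implicit Types (k v w : freq d) (x : rvec R d) (p q : @tpoly R d).

(** On [[0, 1]] the constant is 1/8. Beyond, the cosine decreases, so
    [1 - cos t >= 1/8 >= t^2 / 128] because [t <= pi < 4]. *)
Lemma one_minus_cos_ge (t : R) : `|t| <= pi -> t ^+ 2 / 128 <= 1 - cos t.
Proof.
rewrite -(cos_norm t) -[t ^+ 2](real_normK (num_real t)).
have : 0 <= `|t| := normr_ge0 t.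
move: (`|t| : R) => {}t t0 tpi.
have small (u : R) : 0 <= u <= 1 -> u ^+ 2 / 8 <= 1 - cos u.
  move=> /andP[u0 u1].
  have -> : cos u = 1 - 2 * sin (u / 2) ^+ 2.
    have {1}-> : u = (u / 2) *+ 2 by rewrite mulr2n -splitr.
    by rewrite cos_mulr2n sin2cos2; ring.
  have u2 : `|u / 2| <= 1 by rewrite ger0_norm; lra.
  have := sin_sub_le u2; rewrite ler_norml => /andP[h1 _].
  have h2 : u / 4 <= sin (u / 2) by nra.
  nra.
have [t1|t1] := leP t 1.
  by have := small t; rewrite t0 t1 => /(_ isT); have := sqr_ge0 t; lra.
have c1 : cos t < cos 1.
  by rewrite ltr_cos// ?in_itv/= ?t0 ?tpi// ler01 (le_trans _ (pi_ge2 R))//; lra.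
have := small 1; rewrite ler01 lexx expr1n => /(_ isT) h1.
have p4 : pi < 4 :> R by have := pihalf_lt2 R; lra.
nra.
Qed.

(** The numerator is at most [2 s], and the denominator [(1 - r)^2 + 2 r (1 - cos t)] is at least
    [(s^2 + t^2) / 128], since [r >= 1/2]. *)
Lemma poisson_le (s t : R) : 0 < s <= 1/2 -> `|t| <= pi ->
  poisson (expR (- s)) t <= 256 * (s / (s ^+ 2 + t ^+ 2)).
Proof.
move=> /andP[s0 s1] tpi; set r := expR (- s).
have h1 : 1 - s <= r by exact: expR_ge1Dx.
have h2 : r * (1 + s) <= 1.
  have : r * expR s = 1 by rewrite /r -expRD addNr expR0.
  by have := expR_ge1Dx s; have := expR_gt0 (- s); rewrite -/r; nra.
have r0 : 0 < r by exact: expR_gt0.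
have r1 : r < 1 by nra.
have hc := one_minus_cos_ge tpi.
have d0 : 0 < s ^+ 2 + t ^+ 2 by rewrite ltr_wpDr ?sqr_ge0// exprn_gt0.
rewrite /poisson mulrA ler_pdivlMr// mulrAC ler_pdivrMr; last first.
  by apply: poisson_denom_gt0; rewrite ltW.
have h3 : 1 - r ^+ 2 <= 2 * s by nra.
have h4 : (s ^+ 2 + t ^+ 2) / 128 <= 1 - 2 * r * cos t + r ^+ 2.
  have : s / 2 <= 1 - r by nra.
  have : t ^+ 2 / 128 <= 2 * r * (1 - cos t) by have := sqr_ge0 t; nra.
  nra.
have : (1 - r ^+ 2) * (s ^+ 2 + t ^+ 2) <= 2 * s * (s ^+ 2 + t ^+ 2).
  by rewrite ler_pM2r.
have : 2 * s * ((s ^+ 2 + t ^+ 2) / 128) <= 2 * s * (1 - 2 * r * cos t + r ^+ 2).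
  by rewrite ler_pM2l// mulr_gt0.
lra.
Qed.

Lemma tpois_integral w (r : R) p x : 0 <= r < 1 ->
  Rintegral leb (sym_itv pi) (fun t => poisson r t * complex.Re (teval p (flow w t x))) =
  2 * pi * complex.Re (\sum_(t <- p) t.2 * tchar t.1 x * (r ^+ `|fdot t.1 w|%N)%:C).
Proof.
move=> r01; have mI := measurable_sym_itv (@pi R); have fI := sym_itv_fin (@pi R).
transitivity (Rintegral leb (sym_itv pi) (fun t : measurableTypeR R => \sum_(b <- p)
    poisson r t * complex.Re (b.2 * tchar b.1 x * expi (t * (fdot b.1 w)%:~R)))).
  apply: eq_Rintegral => t _; rewrite /teval Re_sum mulr_sumr; apply: eq_bigr => b _.
  by rewrite tchar_flow; congr (_ * complex.Re _); ring.
rewrite (bint_sum mI fI); last first.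
  by move=> b; apply: bmeasM; [exact: bmeas_poisson|exact: bmeas_trig1].
rewrite Re_sum mulr_sumr; apply: eq_bigr => b _.
rewrite poisson_trig// [b.2 * _ * _%:C]mulrC ReZ; ring.
Qed.

Section bound.
Variables (w : freq d) (G : rvec R d -> R).
Hypotheses (bG : bmeas G) (G0 : forall x, 0 <= G x).
Variable lam : R.
Hypothesis lam0 : 0 < lam.

(** On the shell between [dyad i 1 / 2] and [dyad i 1] the kernel is at most
    [s / t^2 <= 4 s / dyad i 1 ^+ 2]. This majorizes it by a positive combination of windows, whose
    integrals [sigma] controls. *)
Lemma poisson_dyadic (s t : R) n : 0 < s -> dyad n 1 < `|t| <= pi ->
  s / (s ^+ 2 + t ^+ 2) <=
  \sum_(i < n) 4 * s / dyad i 1 ^+ 2 * \1_(sym_itv (dyad i 1)) t.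
Proof.
move=> s0; elim: n => [|n ih] /andP[h1 h2].
  by move: h1; rewrite /dyad expr0 divr1 mulr1 ltNge h2.
rewrite big_ord_recr /=.
have d0 i : 0 < dyad i 1 :> R by rewrite /dyad mulr1 divr_gt0 ?pi_gt0// exprn_gt0.
have [h3|h3] := ltP (dyad n 1) `|t|.
  rewrite ler_wpDr ?ih ?h3//; rewrite mulr_ge0//.
  by apply: divr_ge0; [apply: mulr_ge0; [exact: ler0n|exact: ltW]|exact: sqr_ge0].
have pos : 0 <= \sum_(i < n) 4 * s / dyad i 1 ^+ 2 * \1_(sym_itv (dyad i 1)) t.
  apply: sumr_ge0 => i _; rewrite mulr_ge0//.
  by apply: divr_ge0; [apply: mulr_ge0; [exact: ler0n|exact: ltW]|exact: sqr_ge0].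
rewrite (le_trans _ (_ : 4 * s / dyad n 1 ^+ 2 * \1_(sym_itv (dyad n 1)) t <= _))//; last first.
  by rewrite lerDr.
rewrite indicE mem_set ?mulr1; last by rewrite /sym_itv /=; rewrite -ler_norml.
have dS : dyad n.+1 1 = dyad n 1 / 2 :> R.
  by rewrite /dyad exprS; field; rewrite expf_neq0.
rewrite dS in h1.
have t0 : 0 < `|t| by rewrite (le_lt_trans _ h1)// divr_ge0// ltW.
have tt : t ^+ 2 = `|t| ^+ 2 by rewrite real_normK// num_real.
rewrite ler_pdivrMr; last by rewrite tt ltr_wpDl ?sqr_ge0// exprn_gt0.
rewrite mulrAC ler_pdivlMr ?exprn_gt0// -mulrA mulrCA ler_pM2l//.
rewrite tt; have : (dyad n 1 / 2) ^+ 2 <= `|t| ^+ 2.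
  by have := d0 n => dn0; apply: lerXn2r; rewrite ?nnegrE; lra.
have := sqr_ge0 s; rewrite expr_div_n; lra.
Qed.

Lemma poisson_dyadic_le (s t : R) n : 0 < s -> `|t| <= pi ->
  s / (s ^+ 2 + t ^+ 2) <=
  s^-1 * \1_(sym_itv (dyad n 1)) t +
  \sum_(i < n) 4 * s / dyad i 1 ^+ 2 * \1_(sym_itv (dyad i 1)) t.
Proof.
move=> s0 tpi; have [h|h] := ltP (dyad n 1) `|t|.
  rewrite ler_wpDl ?poisson_dyadic ?h//.
  by rewrite mulr_ge0 ?invr_ge0 ?(ltW s0).
rewrite ler_wpDr//.
  apply: sumr_ge0 => i _; rewrite mulr_ge0//.
  by apply: divr_ge0; [apply: mulr_ge0; [exact: ler0n|exact: ltW]|exact: sqr_ge0].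
rewrite indicE mem_set ?mulr1; last by rewrite /sym_itv /=; rewrite -ler_norml.
rewrite ler_pdivrMr ?ltr_wpDr ?sqr_ge0 ?exprn_gt0// mulrDr.
rewrite expr2 mulrA mulVf ?gt_eqF// mul1r lerDl.
by rewrite mulr_ge0 ?sqr_ge0// invr_ge0 ltW.
Qed.

Lemma dyad_anti i n : (i <= n)%N -> dyad n 1 <= dyad i 1 :> R.
Proof.
move=> h; rewrite /dyad ler_pM2l ?mulr1 ?pi_gt0//.
by rewrite lef_pV2 ?posrE ?exprn_gt0// ler_eXn2l// ltr1n.
Qed.

Lemma exists_dyad (s : R) : 0 < s <= pi -> exists n, s <= dyad n 1 <= 2 * s.
Proof.
move=> /andP[s0 spi].
have [N hN] : exists N, dyad N 1 < s.
  have : @GRing.exp R 2^-1 @ \oo --> 0 by apply: cvg_expr; rewrite ger0_norm//; lra.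
  have e0 : 0 < s / (2 * pi) by rewrite divr_gt0// mulr_gt0// pi_gt0.
  move=> /cvgrPdist_le /(_ _ e0) [N _ h]; exists N; have := h N (leqnn N).
  rewrite sub0r normrN ger0_norm ?exprn_ge0// exprVn ler_pdivlMr ?mulr_gt0 ?pi_gt0//.
  by rewrite /dyad mulr1 => h'; rewrite mulrC in h'; lra.
elim: N hN => [|N ih] hN.
  by move: hN; rewrite /dyad expr0 divr1 mulr1 ltNge spi.
have [/ih//|h] := ltP (dyad N 1) s.
exists N; rewrite h /=.
have dS : dyad N.+1 1 = dyad N 1 / 2 :> R.
  by rewrite /dyad exprS; field; rewrite expf_neq0.
by move: hN; rewrite dS; lra.
Qed.

Lemma sum_inv_dyad n : \sum_(i < n) (dyad i 1)^-1 <= (dyad n 1)^-1 :> R.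
Proof.
elim: n => [|n ih]; first by rewrite big_ord0 invr_ge0 /dyad divr_ge0// mulr_ge0// pi_ge0.
rewrite big_ord_recr /=; have -> : (dyad n.+1 1)^-1 = 2 * (dyad n 1)^-1 :> R.
  have -> : dyad n.+1 1 = dyad n 1 / 2 :> R.
    by rewrite /dyad exprS; field; rewrite expf_neq0.
  by rewrite invf_div.
lra.
Qed.

(** The innermost window has half-length between [s] and [2 s] and contributes
    [(2 s + 8 s) lam / s = 10 lam]. On the others [dyad i 1 + 8 s <= 9 dyad i 1], so they contribute
    [36 lam s / dyad i 1], which sums geometrically to [36 lam]. *)
Lemma poisson_favg_le (s : R) x : 0 < s <= 1/2 -> sigma w G lam x <= 8 * s ->
  Rintegral leb (sym_itv pi) (fun t => poisson (expR (- s)) t * G (flow w t x)) <=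
  256 * (46 * lam).
Proof.
have pl := poisson_le; have : 0 < 256 :> R by rewrite ltr0n.
move: (256 : R) pl => c pl c0.
move=> s01 ss; have /andP[s0 s1] := s01.
have spi : 0 < s <= pi by rewrite s0 /= (le_trans s1)//; have := pi_ge2 R; lra.
have [n /andP[n1 n2]] := exists_dyad spi.
have n10 : dyad n 1 + 8 * s <= 10 * s by lra.
have mI := measurable_sym_itv (@pi R); have fI := sym_itv_fin (@pi R).
have r01 : 0 <= expR (- s) < 1 by rewrite expR_ge0 -expR0 ltr_expR oppr_lt0.
have bg := bmeas_fiber w x bG.
have bP : bmeas (fun t : measurableTypeR R => poisson (expR (- s)) t * G (flow w t x)).
  by apply: bmeasM => //; exact: bmeas_poisson.
have bI r : bmeas (fun t : measurableTypeR R => \1_(sym_itv r) t * G (flow w t x)).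
  by apply: bmeasM => //; apply: bmeas_indic; exact: measurable_sym_itv.
pose K (t : measurableTypeR R) := s^-1 * (\1_(sym_itv (dyad n 1)) t * G (flow w t x)) +
  \sum_(i < n) 4 * s / dyad i 1 ^+ 2 * (\1_(sym_itv (dyad i 1)) t * G (flow w t x)).
have bK : bmeas K.
  apply: bmeasD; first exact: bmeasZ.
  by apply: bmeas_sum => i; exact: bmeasZ.
have step1 : Rintegral leb (sym_itv pi) (fun t => poisson (expR (- s)) t * G (flow w t x)) <=
   c * Rintegral leb (sym_itv pi) K.
  rewrite -(bintZ mI fI _ bK); apply: (bint_le mI fI bP (bmeasZ _ bK)) => t.
  rewrite /sym_itv /= -ler_norml => tpi.
  have := pl _ _ s01 tpi; have := poisson_dyadic_le n s0 tpi; set X := s / _ => h1 h2.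
  have -> : c * K t = c * (s^-1 * \1_(sym_itv (dyad n 1)) t +
     \sum_(i < n) 4 * s / dyad i 1 ^+ 2 * \1_(sym_itv (dyad i 1)) t) * G (flow w t x).
    rewrite /K -[RHS]mulrA; congr (_ * _); rewrite [RHS]mulrDl mulr_suml mulrA; congr (_ + _).
    by apply: eq_bigr => i _; rewrite mulrA.
  by rewrite ler_wpM2r// (le_trans h2)// (ler_wpM2l (ltW c0)).
have favgE i : Rintegral leb (sym_itv pi)
    (fun t => \1_(sym_itv (dyad i 1)) t * G (flow w t x)) = favg w G (dyad i 1) x.
  have mi := measurable_sym_itv (dyad i 1 : R).
  have i1 : (1 <= 2 ^ i)%N by rewrite expn_gt0.
  have /andP[_ ipi] := @dyad_le_pi R i 1 i1.
  rewrite /favg /favg_on /Rintegral; congr fine.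
  have -> : sym_itv (dyad i 1) = sym_itv pi `&` sym_itv (dyad i 1) :> set R.
    apply/esym/setIidPr => t /andP[? ?]; apply/andP; split; lra.
  rewrite [RHS]integral_mkcondr; apply: eq_integral => t tI.
  rewrite patchE indicE in_setI tI /=.
  by case: ifPn => _; rewrite ?mul1r ?mul0r.
have step2 : Rintegral leb (sym_itv pi) K <=
   s^-1 * (lam * (dyad n 1 + 8 * s)) +
   \sum_(i < n) 4 * s / dyad i 1 ^+ 2 * (lam * (dyad i 1 + 8 * s)).
  rewrite /K (bintD mI fI (bmeasZ _ (bI _))); last first.
    by apply: bmeas_sum => i; exact: bmeasZ.
  rewrite (bint_sum mI fI); last by move=> i; exact: bmeasZ.
  have fl i : favg w G (dyad i 1) x <= lam * (dyad i 1 + 8 * s).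
    rewrite (le_trans (favg_dyad_le w bG G0 lam0 i x))// ler_pM2l// lerD2l//.
  rewrite lerD//.
    by rewrite (bintZ mI fI _ (bI _)) favgE ler_wpM2l ?invr_ge0 ?fl// ltW.
  apply: ler_sum => i _; rewrite (bintZ mI fI _ (bI _)) favgE ler_wpM2l ?fl//.
  by apply: divr_ge0; [apply: mulr_ge0; [exact: ler0n|exact: ltW]|exact: sqr_ge0].
have d0 i : 0 < dyad i 1 :> R by rewrite /dyad mulr1 divr_gt0 ?pi_gt0// exprn_gt0.
have step3 : \sum_(i < n) 4 * s / dyad i 1 ^+ 2 * (lam * (dyad i 1 + 8 * s)) <=
   36 * lam.
  apply: (@le_trans _ _ (\sum_(i < n) 36 * lam * s * (dyad i 1)^-1)).
    apply: ler_sum => i _.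
    have si : s <= dyad i 1.
      by apply: (le_trans n1); apply: dyad_anti; exact: ltnW.
    rewrite -subr_ge0.
    have -> : 36 * lam * s / dyad i 1 - 4 * s / dyad i 1 ^+ 2 * (lam * (dyad i 1 + 8 * s)) =
       32 * lam * s / dyad i 1 ^+ 2 * (dyad i 1 - s).
      by field; rewrite gt_eqF.
    by rewrite mulr_ge0 ?subr_ge0// divr_ge0 ?sqr_ge0// !mulr_ge0// ltW.
  rewrite -mulr_sumr; have h := sum_inv_dyad n.
  have h' : s * (dyad n 1)^-1 <= 1 by rewrite ler_pdivrMr// mul1r.
  rewrite -mulrA ler_piMr ?mulr_ge0 ?(ltW lam0)//.
  by rewrite (le_trans _ h')// ler_pM2l.
have step4 : s^-1 * (lam * (dyad n 1 + 8 * s)) <= 10 * lam.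
  rewrite mulrC ler_pdivrMr//.
  have -> : 10 * lam * s = lam * (10 * s) by ring.
  by rewrite ler_pM2l.
rewrite (le_trans step1)//.
have -> : 46 * lam = 10 * lam + 36 * lam by ring.
by rewrite ler_pM2l// (le_trans step2)// lerD.
Qed.

Lemma Re_tpois_gt0 (s : R) p x : (forall y, normc (teval p y) <= G y) ->
  0 < s <= 1/2 -> sigma w G lam x <= 8 * s ->
  `|complex.Re (tpois w (fun=> s) p x)| <= 256 * (12 * lam).
Proof.
(* [46 <= 12 * 2 * pi] because [pi >= 2]. *)
have lampi : 46 * lam <= 12 * lam * (2 * pi).
  have p2 : 2 <= pi :> R := pi_ge2 R.
  have : 12 * lam * (2 * 2) <= 12 * lam * (2 * pi) by rewrite !ler_wpM2l ?mulr_ge0// ltW.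
  by move: lam0; lra.
move=> pG s01 ss; have /andP[s0 s1] := s01.
have mI := measurable_sym_itv (@pi R); have fI := sym_itv_fin (@pi R).
have r01 : 0 <= expR (- s) < 1 by rewrite expR_ge0 -expR0 ltr_expR oppr_lt0.
have e : complex.Re (tpois w (fun=> s) p x) = (2 * pi)^-1 *
   Rintegral leb (sym_itv pi) (fun t => poisson (expR (- s)) t * complex.Re (teval p (flow w t x))).
  rewrite tpois_integral// mulKf ?mulf_neq0 ?gt_eqF ?pi_gt0//.
  congr complex.Re; apply: eq_bigr => t _; congr (_ * _%:C).
  by rewrite -expRM_natl mulrN -natr_absz.
have bR : bmeas (fun t : measurableTypeR R => complex.Re (teval p (flow w t x))).
  by apply: (bmeas_fiber w x (G := fun x => complex.Re (teval p x))); case: (bcmeas_teval p).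
have bPR : bmeas (fun t : measurableTypeR R => poisson (expR (- s)) t * complex.Re (teval p (flow w t x))).
  by apply: bmeasM => //; exact: bmeas_poisson.
have bP : bmeas (fun t : measurableTypeR R => poisson (expR (- s)) t * G (flow w t x)).
  by apply: bmeasM; [exact: bmeas_poisson|exact: bmeas_fiber].
have p0 : 0 < 2 * pi :> R by rewrite mulr_gt0// pi_gt0.
rewrite e normrM ger0_norm ?invr_ge0 ?(ltW p0)// mulrC ler_pdivrMr//.
apply: (le_trans (bint_norm mI fI bPR)).
have h : Rintegral leb (sym_itv pi) (fun t => `|poisson (expR (- s)) t * complex.Re (teval p (flow w t x))|)
   <= 256 * (46 * lam).
  apply: le_trans (poisson_favg_le s01 ss).
  apply: (bint_le mI fI (bmeas_norm bPR) bP) => t _.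
  rewrite normrM (ger0_norm (poisson_ge0 _ r01)) ler_wpM2l ?poisson_ge0//.
  exact: (le_trans (ler_normRe _)).
by rewrite (le_trans h)// -mulrA ler_wpM2l.
Qed.

(** At height 0 the kernel degenerates. The extension of a fixed polynomial is Lipschitz in the
    height, so the bound is taken slightly higher and the height is let down. *)
Lemma Re_tpois_le (s : R) p x : (forall y, normc (teval p y) <= G y) ->
  0 <= s < 1/2 -> sigma w G lam x <= 8 * s ->
  `|complex.Re (tpois w (fun=> s) p x)| <= 256 * (12 * lam).
Proof.
move=> pG /andP[s0 s1] ss.
pose K := \sum_(t <- p) normc t.2 * `|fdot t.1 w|%:~R : R.
have K0 : 0 <= K by apply: sumr_ge0 => t _; rewrite mulr_ge0 ?normc_ge0// ler0z.
have lip e : 0 <= e ->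
    `|complex.Re (tpois w (fun=> s) p x) - complex.Re (tpois w (fun=> s + e) p x)| <= K * e.
  move=> e0; rewrite -ReB (le_trans (ler_normRe _))// /tpois -sumrB.
  rewrite (le_trans (normc_sum _ _))// mulr_suml; apply: ler_sum => t _.
  rewrite -mulrBr -rmorphB !normcM normc_tchar mulr1 normcZ -mulrA ler_wpM2l ?normc_ge0//.
  set q : R := _%:~R; have q0 : 0 <= q by rewrite ler0z.
  rewrite mulrDr opprD expRD -{1}[expR (- (q * s))]mulr1 -mulrBr normrM.
  have e1 : expR (- (q * e)) <= 1 by rewrite -expR0 ler_expR oppr_le0 mulr_ge0.
  have e2 := expR_ge1Dx (- (q * e)).
  have e3 : expR (- (q * s)) <= 1 by rewrite -expR0 ler_expR oppr_le0 mulr_ge0.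
  rewrite (ger0_norm (expR_ge0 _)) [`|1 - _|]ger0_norm ?subr_ge0//.
  have := expR_ge0 (- (q * s)); nra.
apply/ler_addgt0Pr => e e0.
pose e' := Num.min (e / (K + 1)) (1/2 - s).
have e'0 : 0 < e' by rewrite lt_min divr_gt0 ?subr_gt0//; lra.
have Ke : K * e' <= e.
  have : e' <= e / (K + 1) by rewrite ge_min lexx.
  have : K * (e / (K + 1)) <= e.
    by rewrite mulrCA ger_pMr// ler_pdivrMr; lra.
  by move=> h1 h2; apply: le_trans h1; rewrite ler_wpM2l.
have hs : `|complex.Re (tpois w (fun=> s + e') p x)| <= 256 * (12 * lam).
  apply: Re_tpois_gt0 => //; last by lra.
  have : e' <= 1/2 - s by rewrite ge_min lexx orbT.
  by move=> ?; apply/andP; split; lra.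
have := lip _ (ltW e'0).
have := ler_normD (complex.Re (tpois w (fun=> s + e') p x))
  (complex.Re (tpois w (fun=> s) p x) - complex.Re (tpois w (fun=> s + e') p x)).
rewrite addrC subrK; lra.
Qed.

(** At [r = 0] the Poisson integral is the orbit mean, so real and imaginary parts are each at most
    [favg pi x / (2 pi) <= lam / 2]. *)
Lemma normc_tzero_le p x : (forall y, normc (teval p y) <= G y) ->
  favg w G pi x <= lam * pi -> normc (teval (tzero w p) x) <= lam.
Proof.
move=> pG hx.
have mI := measurable_sym_itv (@pi R); have fI := sym_itv_fin (@pi R).
have key q : (forall y, normc (teval q y) <= G y) ->
    `|complex.Re (teval (tzero w q) x)| <= lam / 2.
  move=> qG; have r01 : 0 <= (0 : R) < 1 by rewrite lexx ltr01.
  have := tpois_integral w q x r01.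
  have -> : \sum_(t <- q) t.2 * tchar t.1 x * (0 ^+ `|fdot t.1 w|%N)%:C =
      teval (tzero w q) x.
    rewrite teval_tmult; apply: eq_bigr => t _; rewrite expr0n absz_eq0.
    by case: eqP => _ /=; rewrite ?mulr1 ?mul1r ?mulr0 ?mul0r.
  have bR : bmeas (fun t : measurableTypeR R => complex.Re (teval q (flow w t x))).
    by apply: (bmeas_fiber w x (G := fun x => complex.Re (teval q x))); case: (bcmeas_teval q).
  under eq_Rintegral do rewrite /poisson expr0n subr0 mulr0 mul0r subr0 addr0 divr1 mul1r.
  move=> e; have p0 : 0 < 2 * pi :> R by rewrite mulr_gt0// pi_gt0.
  rewrite -(ler_pM2l p0) -{1}(gtr0_norm p0) -normrM -e.
  apply: (le_trans (bint_norm mI fI bR)).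
  have -> : 2 * pi * (lam / 2) = lam * pi by field.
  apply: le_trans hx; apply: (bint_le mI fI (bmeas_norm bR) (bmeas_fiber w x bG)) => t _.
  exact: (le_trans (ler_normRe _)).
have h1 := key p pG.
have h2 : `|complex.Im (teval (tzero w p) x)| <= lam / 2.
  have iG y : normc (teval (tmult (fun=> - 'i%C) p) y) <= G y.
    by rewrite teval_scale normcM normcN_i mul1r.
  have := key _ iG.
  have -> : teval (tzero w (tmult (fun=> - 'i%C) p)) x = - 'i%C * teval (tzero w p) x.
    by rewrite /tzero tmult_comp !teval_tmult mulr_sumr; apply: eq_bigr => t _; ring.
  by rewrite ReM /= oppr0 mul0r sub0r mulN1r opprK.
apply: (le_trans (normc_le_ReIm _)); lra.
Qed.

End bound.
End poisson_bound.

(** * Approximation of indicators by trigonometric polynomials *)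

Section density.
Local Open Scope complex_scope.
Context {R : realType} {d : nat}.
Local Notation C := R[i].
Local Notation mu := (@lebesgue_rvec R d).
Local Notation T := (torus_cube d : set (rvec R d)).
Local Notation J f := (Rintegral mu T f).
Implicit Types (k v w : freq d) (x : rvec R d) (p q : @tpoly R d).

Let mT : measurable T := @cube_measurable R d.
Let fT : (mu T < +oo)%E := @cube_fin R d.

(** Values in [[0, 1]] are preserved by [1 - u] and by products, which mirror complements and
    intersections without spoiling [L^1] errors. *)
Definition unit_valued p (u : rvec R d -> R) :=
  (forall x, teval p x = (u x)%:C) /\ (forall x, 0 <= u x <= 1).

Lemma unit_valued_bmeas p u : unit_valued p u -> bmeas u.
Proof.
move=> [pu _]; rewrite (_ : u = fun x => complex.Re (teval p x)).
  by case: (bcmeas_teval p).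
by apply/funext => x; rewrite pu.
Qed.

Lemma unit_valuedC p u : unit_valued p u ->
  unit_valued (tone ++ tmult (fun=> -1) p) (fun x => 1 - u x).
Proof.
move=> [pu u01]; split=> x.
  by rewrite teval_cat teval_one teval_scale pu rmorphB /=; ring.
by have /andP[? ?] := u01 x; apply/andP; split; lra.
Qed.

Lemma unit_valuedM p u q u2 : unit_valued p u -> unit_valued q u2 ->
  unit_valued (tmul p q) (fun x => u x * u2 x).
Proof.
move=> [pu u01] [qw w01]; split=> x; first by rewrite teval_mul pu qw rmorphM.
have /andP[? ?] := u01 x; have /andP[? ?] := w01 x.
by apply/andP; split; [exact: mulr_ge0|exact: mulr_ile1].
Qed.

(** These sets form a sigma-algebra, so density reduces to sets bounded by one coordinate
    hyperplane. *)
Definition approximable (A : set (rvec R d)) := measurable A /\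
  forall e : R, 0 < e -> exists p u, unit_valued p u /\
    J (fun x => `|\1_A x - u x|) <= e.

Let bdiff A u : measurable A -> bmeas u -> bmeas (fun x => `|\1_A x - u x : R|).
Proof. by move=> mA bu; apply: bmeas_norm; apply: bmeasB => //; exact: bmeas_indic. Qed.

Lemma approximable0 : approximable set0.
Proof.
split=> // e e0; exists [::], (fun=> 0); split.
  by split=> x; rewrite ?teval_nil// lexx ler01.
under eq_Rintegral do rewrite indic0 subrr normr0.
by rewrite (bint_cst mu mT) mul0r ltW.
Qed.

Lemma approximableC A : approximable A -> approximable (~` A).
Proof.
move=> [mA hA]; split; first exact: measurableC.
move=> e e0; have [p [u [pu he]]] := hA e e0.
exists (tone ++ tmult (fun=> -1) p), (fun x => 1 - u x); split; first exact: unit_valuedC.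
rewrite (le_trans _ he)// le_eqVlt; apply/orP; left; apply/eqP.
apply: eq_Rintegral => x _; rewrite !indicE in_setC.
by case: (x \in A) => /=; rewrite -normrN; congr (`|_|); ring.
Qed.

Lemma approximableI A B : approximable A -> approximable B -> approximable (A `&` B).
Proof.
move=> [mA hA] [mB hB]; split; first exact: measurableI.
move=> e e0; have e2 : 0 < e / 2 by rewrite divr_gt0.
have [p [u [pu hu]]] := hA _ e2; have [q [w [qw hw]]] := hB _ e2.
exists (tmul p q), (fun x => u x * w x); split; first exact: unit_valuedM.
have bu := unit_valued_bmeas pu; have bw := unit_valued_bmeas qw.
have b1 := bdiff mA bu; have b2 := bdiff mB bw.
have -> : e = e / 2 + e / 2 by rewrite -splitr.
apply: le_trans (lerD hu hw); rewrite -(bintD mT fT b1 b2).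
apply: (bint_le mT fT (bdiff (measurableI _ _ mA mB) (bmeasM bu bw)) (bmeasD b1 b2)).
move=> x _; rewrite indicI /=.
set a : R := \1_A x; set b : R := \1_B x.
have a01 : 0 <= a <= 1 by rewrite /a indicE; case: (_ \in _); rewrite ?lexx ?ler01.
have -> : a * b - u x * w x = (a - u x) * w x + a * (b - w x) by ring.
have /andP[a0 a1] := a01; have /andP[w0 w1] := qw.2 x.
rewrite (le_trans (ler_normD _ _))// lerD//.
  by rewrite normrM (ger0_norm w0) ler_piMr.
by rewrite normrM (ger0_norm a0) ler_piMl.
Qed.

Lemma approximable_bigcup (F : (set (rvec R d))^nat) :
  (forall n, approximable (F n)) -> approximable (\bigcup_n F n).
Proof.
move=> hF; pose H n := \bigcup_(i < n) F i.
have hH n : approximable (H n).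
  elim: n => [|n ih].
    by rewrite /H bigcup_mkord big_ord0; exact: approximable0.
  rewrite /H bigcup_mkord big_ord_recr /= -bigcup_mkord.
  by rewrite -[X in approximable X]setCK setCU; apply: approximableC;
    apply: approximableI; exact: approximableC.
have mF n : measurable (F n) by case: (hF n).
have mU : measurable (\bigcup_n F n) by exact: bigcup_measurable.
split=> // e e0; have e2 : 0 < e / 2 by rewrite divr_gt0.
have mH n : measurable (H n) by case: (hH n).
have Hnd : nondecreasing_seq (fun n => H n `&` T).
  by apply/nondecreasing_seqP => n; apply/subsetPset => x [[i /= ilt Fi] xT]; split => //; exists i => //=; rewrite ltnS ltnW.
have UE : \bigcup_n (H n `&` T) = (\bigcup_n F n) `&` T.
  rewrite -setI_bigcupl; congr (_ `&` _); apply/seteqP; split=> x.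
    by move=> [n _ [i _ Fi]]; exists i.
  by move=> [n _ Fn]; exists n.+1 => //; exists n => /=.
have cv := @nondecreasing_cvg_mu _ _ _ mu (fun n => H n `&` T)
  (fun n => measurableI _ _ (mH n) mT) (bigcup_measurable (fun n _ => measurableI _ _ (mH n) mT)) Hnd.
rewrite UE in cv.
have fU : (mu ((\bigcup_n F n) `&` T) < +oo)%E.
  by rewrite (le_lt_trans _ fT)// le_measure// ?inE//; exact: measurableI.
have fH n : (mu (H n `&` T) < +oo)%E.
  by rewrite (le_lt_trans _ fT)// le_measure// ?inE//; exact: measurableI.
have [n hn] : exists n, fine (mu ((\bigcup_n F n) `&` T)) - fine (mu (H n `&` T)) <= e / 2.
  have /fine_cvgP[_ /cvgrPdist_le /(_ _ e2) [n _ hn]] : mu (H n `&` T) @[n --> \oo] --> (fine (mu ((\bigcup_n F n) `&` T)))%:E.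
    by rewrite fineK ?ge0_fin_numE.
  by exists n; have := hn n (leqnn n); rewrite /=; apply: le_trans; exact: ler_norm.
have [p [u [pu hu]]] := (hH n).2 _ e2.
have bu := unit_valued_bmeas pu.
exists p, u; split => //.
have b1 : bmeas (fun x => \1_(\bigcup_n F n) x - \1_(H n) x : R).
  by apply: bmeasB; exact: bmeas_indic.
have b2 := bdiff (mH n) bu.
have -> : e = e / 2 + e / 2 by rewrite -splitr.
apply: le_trans (lerD hn hu).
rewrite -!(bint_indic mu mT) // -(bintB mT fT (bmeas_indic mU) (bmeas_indic (mH n))).
rewrite -(bintD mT fT b1 b2).
apply: (bint_le mT fT (bdiff mU bu) (bmeasD b1 b2)) => x _.
have h : \1_(H n) x <= \1_(\bigcup_n F n) x :> R.
  rewrite !indicE; case: (boolP (x \in H n)) => [|_]; last by rewrite ler0n.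
  by rewrite inE => -[i _ Fi]; rewrite mem_set//; exists i.
have := ler_normD (\1_(\bigcup_n F n) x - \1_(H n) x) (\1_(H n) x - u x).
by rewrite addrA subrK (ger0_norm (_ : 0 <= \1_(\bigcup_n F n) x - \1_(H n) x :> R)) ?subr_ge0.
Qed.

Lemma approximable_null A B : measurable B -> approximable A ->
  mu ((A `\` B `|` B `\` A) `&` T) = 0%E -> approximable B.
Proof.
move=> mB [mA hA] h0; split=> // e e0.
have [p [u [pu hu]]] := hA e e0; exists p, u; split=> //.
have bu := unit_valued_bmeas pu.
have mS : measurable (A `\` B `|` B `\` A) by apply: measurableU; exact: measurableD.
have b0 : bmeas (\1_(A `\` B `|` B `\` A) : rvec R d -> R) by exact: bmeas_indic.
have -> : e = e + fine (mu ((A `\` B `|` B `\` A) `&` T)) by rewrite h0 addr0.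
rewrite -(bint_indic mu mT mS); apply: le_trans (lerD hu (lexx _)).
rewrite -(bintD mT fT (bdiff mA bu) b0).
apply: (bint_le mT fT (bdiff mB bu) (bmeasD (bdiff mA bu) b0)) => x _.
have : `|\1_B x - \1_A x| <= \1_(A `\` B `|` B `\` A) x :> R.
  rewrite !indicE !(in_setU, in_setD); case: (x \in A); case: (x \in B) => /=;
   by rewrite ?subrr ?subr0 ?sub0r ?normrN ?normr0 ?normr1.
have := ler_normD (\1_B x - \1_A x) (\1_A x - u x).
by rewrite addrA subrK; lra.
Qed.

Lemma bernoulli_ge (y : R) n : 0 <= y <= 1 -> 1 - n%:R * y <= (1 - y) ^+ n.
Proof.
move=> /andP[y0 y1]; elim: n => [|n ih]; first by rewrite mul0r subr0 expr0.
rewrite exprS -natr1; have := ler_wpM2l (_ : 0 <= 1 - y) ih.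
rewrite subr_ge0 => /(_ y1); have : 0 <= n%:R :> R by []; nra.
Qed.

(* Kuhn's polynomials, which approximate a step at 1/2. *)
Lemma kuhn_cvg1 (z : R) : 0 <= z < 1/2 -> (1 - z ^+ n) ^+ (2 ^ n) @[n --> \oo] --> (1 : R).
Proof.
move=> /andP[z0 z1].
have c1 : 1 - (2 * z) ^+ n @[n --> \oo] --> (1 : R).
  rewrite -[X in _ --> X]subr0; apply: cvgB; first exact: cvg_cst.
  apply: cvg_expr; rewrite ger0_norm; lra.
apply: (squeeze_cvgr _ c1 (cvg_cst (1 : R))); near=> n.
have zn : 0 <= z ^+ n <= 1.
  by rewrite exprn_ge0//= exprn_ile1//; lra.
apply/andP; split.
  have := bernoulli_ge (2 ^ n) zn; rewrite natrX exprMn; exact.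
have /andP[zn0 zn1] := zn.
by rewrite exprn_ile1// ?subr_ge0//; lra.
Unshelve. all: by end_near. Qed.

(** The product with [(1 + z^n)^(2^n)], which is at least [(2 z)^n], is at most 1. *)
Lemma kuhn_cvg0 (z : R) : 1/2 < z <= 1 -> (1 - z ^+ n) ^+ (2 ^ n) @[n --> \oo] --> (0 : R).
Proof.
move=> /andP[z0 z1].
have c1 : ((2 * z)^-1) ^+ n @[n --> \oo] --> (0 : R).
  apply: cvg_expr; rewrite ger0_norm ?invr_ge0; last by lra.
  by rewrite invf_lt1; lra.
apply: (squeeze_cvgr _ (cvg_cst 0) c1); near=> n.
have zn0 : 0 < z ^+ n by rewrite exprn_gt0//; lra.
have zn1 : z ^+ n <= 1 by rewrite exprn_ile1//; lra.
rewrite exprn_ge0 ?subr_ge0//= exprVn -[leRHS]mul1r ler_pdivlMr; last first.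
  by rewrite exprn_gt0//; lra.
have h1 : (1 - z ^+ n) ^+ (2 ^ n) * (1 + z ^+ n) ^+ (2 ^ n) <= 1.
  rewrite -exprMn exprn_ile1//.
    by apply: mulr_ge0; lra.
  by nra.
have h2 : (2 * z) ^+ n <= (1 + z ^+ n) ^+ (2 ^ n).
  rewrite exprMn -natrX; have : forall m : nat, m%:R * z ^+ n <= (1 + z ^+ n) ^+ m.
    elim=> [|m ih]; first by rewrite mul0r expr0.
    have : 1 <= (1 + z ^+ n) ^+ m by rewrite exprn_ege1//; lra.
    by rewrite exprS -natr1; nra.
  exact.
apply: le_trans h1; rewrite ler_wpM2l// exprn_ge0// subr_ge0//.
Unshelve. all: by end_near. Qed.

Lemma teval_single_cos (j : 'I_d) (b : R) : exists p,
  forall x, teval p x = (cos (tnth x j - b))%:C.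
Proof.
pose k : freq d := [ffun i => (i == j)%:Z].
have pk x : phase k x = tnth x j.
  rewrite /phase (bigD1 j)//= ffunE eqxx mul1r big1 ?addr0// => i /negbTE ij.
  by rewrite ffunE ij mul0r.
exists (tmult (fun=> (2^-1 : R)%:C) ([:: (k, expi (- b))] ++ tconj [:: (k, expi (- b))])) => x.
rewrite teval_scale teval_cat teval_conj {1 2}/teval !big_seq1 [fst _]/= [snd _]/= /tchar pk -expiD addrC.
rewrite conj_expi; have -> : tnth x j - b = - b + tnth x j by rewrite addrC.
apply/eqP; rewrite eq_complex /= cosN sinN; apply/andP; split; apply/eqP; by field.
Qed.

(** For [0 <= a < 2 pi] and [x] in the cube, the condition [a < x_j] cuts out an arc, described by
    [cos (x_j - a / 2) < cos (a / 2)]. Rescaled to [z] in [[0, 1]] with threshold 1/2, Kuhn's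
    polynomials in [z] converge to the indicator off the null planes [x_j = 0] and [x_j = a]. *)
Lemma approximable_halfline (j : 'I_d) (a : R) :
  approximable [set x | a < tnth x j].
Proof.
have mA : measurable [set x : rvec R d | a < tnth x j].
  rewrite [X in measurable X](_ : _ = (fun x : rvec R d => tnth x j) @^-1` `]a, +oo[); last first.
    by apply/seteqP; split => x /=; rewrite in_itv/= andbT.
  by rewrite -[X in measurable X]setTI; apply: measurable_tnth => //; exact: measurable_itv.
have [a0|a0] := ltP a 0.
  apply: (@approximable_null setT) => //.
    by rewrite -setC0; apply: approximableC; exact: approximable0.
  rewrite [X in mu X](_ : _ = set0) ?measure0//; apply/seteqP; split=> x //=.
  move=> [[[_ h]|[_]]//] xT; apply: h => /=; have /andP[h _] := xT j.
  exact: lt_le_trans h.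
have [a1|a1] := leP (2 * pi) a.
  apply: (@approximable_null set0) => //; first exact: approximable0.
  rewrite [X in mu X](_ : _ = set0) ?measure0//; apply/seteqP; split=> x //=.
  move=> [[[]//|[h _]]] xT; have /andP[_ h'] := xT j.
  by move: h; rewrite /= ltNge (le_trans (ltW h') a1).
pose z x := 1/2 + (cos (tnth x j - a / 2) - cos (a / 2)) / 4.
have z01 x : 0 <= z x <= 1.
  rewrite /z; have := cos_le1 (tnth x j - a / 2); have := cos_geN1 (tnth x j - a / 2).
  have := cos_le1 (a / 2); have := cos_geN1 (a / 2).
  by move=> *; apply/andP; split; lra.
have [pc pcE] := teval_single_cos j (a / 2).
pose pz : @tpoly R d := [:: (0, (1/2 - cos (a / 2) / 4)%:C)] ++ tmult (fun=> (1/4 : R)%:C) pc.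
have uz : unit_valued pz z.
  split=> // x; rewrite teval_cat teval_scale pcE /teval big_seq1 /= tchar0 mulr1.
  by rewrite -rmorphM -rmorphD /= /z; congr (_%:C); field.
have uX p u n : unit_valued p u -> exists q, unit_valued q (fun x => u x ^+ n).
  move=> pu; elim: n => [|n [q qu]].
    by exists tone; split=> x; rewrite ?teval_one ?expr0// ler01 lexx.
  exists (tmul p q); under [X in unit_valued _ X]funext do rewrite exprS.
  exact: unit_valuedM.
pose u n x := (1 - z x ^+ n) ^+ (2 ^ n).
have uu n : exists q, unit_valued q (u n).
  have [q1 q1u] := uX _ _ n uz.
  exact: (uX _ _ (2 ^ n)%N (unit_valuedC q1u)).
have bu n : bmeas (u n) by have [q qu] := uu n; exact: unit_valued_bmeas qu.
have u01 n x : 0 <= u n x <= 1 by have [q [_ h]] := uu n.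
pose N := [set x : rvec R d | tnth x j = 0 \/ tnth x j = a].
have Ncvg x : T x -> ~ N x -> u n x @[n --> \oo] --> (\1_[set x | a < tnth x j] x : R).
  move=> xT /not_orP[x0 xa]; have /andP[t0 t1] := xT j.
  have {}t0 : 0 < tnth x j by rewrite lt_neqAle t0 andbT eq_sym; exact/eqP.
  have zE : z x = 1/2 - sin (tnth x j / 2) * sin ((tnth x j - a) / 2) / 2.
    rewrite /z; have -> : tnth x j - a / 2 = tnth x j / 2 + (tnth x j - a) / 2 by field.
    have -> : a / 2 = tnth x j / 2 - (tnth x j - a) / 2 by field.
    by rewrite cosD cosB; field.
  have s1 : 0 < sin (tnth x j / 2) by apply: sin_gt0_pi; apply/andP; split; lra.
  rewrite indicE; have [ax|xa'] := ltP a (tnth x j).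
    rewrite mem_set//; apply: kuhn_cvg1; case/andP: (z01 x) => -> _ /=.
    have s2 : 0 < sin ((tnth x j - a) / 2) by apply: sin_gt0_pi; apply/andP; split; lra.
    by rewrite zE; have := mulr_gt0 s1 s2; lra.
  rewrite memNset; last by rewrite /= ltNge xa'.
  apply: kuhn_cvg0; case/andP: (z01 x) => _ -> /=; rewrite andbT.
  have {}xa : tnth x j < a by rewrite lt_neqAle xa' andbT; exact/eqP.
  have s2 : 0 < sin ((a - tnth x j) / 2) by apply: sin_gt0_pi; apply/andP; split; lra.
  have -> : z x = 1/2 + sin (tnth x j / 2) * sin ((a - tnth x j) / 2) / 2.
    rewrite zE; have -> : (tnth x j - a) / 2 = - ((a - tnth x j) / 2) by field.
    by rewrite sinN; ring.
  by have := mulr_gt0 s1 s2; lra.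
have mpl (b : R) : measurable [set x : rvec R d | tnth x j = b].
  rewrite [X in measurable X](_ : _ = (fun x : rvec R d => tnth x j) @^-1` [set b]) //.
  by rewrite -[X in measurable X]setTI; apply: measurable_tnth => //; exact: measurable_set1.
have plane0 (b : R) : mu ([set x : rvec R d | tnth x j = b] `&` T) = 0%E.
  pose A i : set (measurableTypeR R) := if i == j then [set b] else [set t | 0 <= t < 2 * pi].
  have mA' i : measurable (A i).
    by rewrite /A; case: ifP => _; [exact: measurable_set1|exact: measurable_period].
  have := tuple_measure_box lebesgue_measure mA'; rewrite -/(lebesgue_rvec d) => h.
  apply/eqP; rewrite eq_le measure_ge0 andbT.
  apply: (@le_trans _ _ (mu [set x | forall i, A i (tnth x i)])).
    apply: le_measure; rewrite ?inE; first exact: measurableI.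
      rewrite [X in measurable X](_ : _ = \bigcap_(i in [set: 'I_d])
        ((fun x : rvec R d => tnth x i) @^-1` A i)).
        apply: fin_bigcap_measurable; first exact: finite_finset.
        by move=> i _; rewrite -[X in measurable X]setTI; exact: measurable_tnth.
      by apply/seteqP; split => [x Ax i _|x Ax i]; exact: Ax.
    move=> x [/= xb xT] i; rewrite /A; case: eqP => [->//|_]; exact: xT.
  rewrite [leLHS]h (bigD1 j)//= /A eqxx.
  by rewrite [X in (X * _)%E](lebesgue_measure_set1 b) mul0e.
have mp b : measurable ([set x : rvec R d | tnth x j = b] `&` T) := measurableI _ _ (mpl b) mT.
have NE : N `&` T = ([set x | tnth x j = 0] `&` T) `|` ([set x | tnth x j = a] `&` T).
  by rewrite -setIUl.
have mNT : measurable (N `&` T) by rewrite NE; exact: measurableU.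
have muN : mu (N `&` T) = 0%E by rewrite NE; apply: null_set_setU => //; exact: plane0.
split=> // e e0.
have bb n : bmeas (fun x => `|\1_[set x | a < tnth x j] x - u n x : R|) by exact: bdiff.
have cv0 : (\int[mu]_(x in T) (`|\1_[set x | (a < tnth x j)%R] x - u n x|%R)%:E)%E @[n --> \oo] --> 0%E.
  have [] := @dominated_convergence _ _ _ mu T mT
     (fun n x => (`|\1_[set x | a < tnth x j] x - u n x|)%:E) (fun=> 0%E) (fun=> 1%E).
  - move=> n; apply/measurable_EFinP; apply: measurable_funTS; by have [] := bb n.
  - exact: measurable_cst.
  - exists (N `&` T); split.
    + exact: mNT.
    + exact: muN.
    + move=> x /= h; have xT : T x by apply: contrapT => nT; apply: h => xT; case: (nT xT).
      split => //; apply: contrapT => nN; apply: h => _.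
      apply: cvg_EFin; first by near=> n.
      apply/cvgrPdist_le => del del0; have /cvgrPdist_le /(_ _ del0) := Ncvg x xT nN.
      by apply: filterS => n /=; rewrite sub0r normrN normr_id.
  - exact: (bmeas_integrable mT fT (bmeas_cst (1 : R))).
  - apply/aeW => x n _; rewrite lee_fin normr_id ler_norml.
    have /andP[? ?] := u01 n x; rewrite indicE.
  by case: (_ \in _); rewrite /= ?mulr1n ?mulr0n; apply/andP; split; lra.
  by move=> _ _; rewrite integral0.
have /fine_cvgP[_ /cvgrPdist_le /(_ _ e0) [n _ hn]] := cv0.
have [q qu] := uu n; exists q, (u n); split=> //.
have := hn n (leqnn n); rewrite /= sub0r normrN; apply: le_trans.
exact: ler_norm.
Unshelve. all: by end_near. Qed.

Lemma approximable_measurable A : measurable A -> approximable A.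
Proof.
move: A; apply: smallest_sub; first split.
- exact: approximable0.
- by move=> A hA; rewrite setTD; exact: approximableC.
- by move=> F hF; exact: approximable_bigcup.
move=> A; rewrite -bigcup_seq /= => -[j /= _ [B mB <-]]; rewrite setTI.
have mB' : (@RGenOInfty.G R).-sigma.-measurable B by rewrite -RGenOInfty.measurableE.
move: B mB' {mB}; apply: smallest_sub; first split.
- by rewrite /= preimage_set0; exact: approximable0.
- by move=> B hB; rewrite /= setTD preimage_setC; exact: approximableC.
- by move=> F hF; rewrite /= preimage_bigcup; exact: approximable_bigcup.
move=> _ [a ->] /=.
rewrite (_ : _ @^-1` _ = [set x | a < tnth x j]); first exact: approximable_halfline.
by apply/seteqP; split => x /=; rewrite in_itv/= andbT.
Qed.

End density.

(** * From moments to exponential integrability for one moving half-space *)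

Section exponential_estimate.
Local Open Scope complex_scope.
Context {R : realType} {d : nat}.
Local Notation C := R[i].
Local Notation mu := (@lebesgue_rvec R d).
Local Notation T := (torus_cube d : set (rvec R d)).
Local Notation J f := (Rintegral mu T f).
Local Notation V := (fine (mu T)).
Implicit Types (k v w : freq d) (x : rvec R d) (p q : @tpoly R d).

Let mT : measurable T := @cube_measurable R d.
Let fT : (mu T < +oo)%E := @cube_fin R d.

Definition poisson_cst : R := 256 * 12.

Lemma poisson_cstE lam : poisson_cst * lam = 256 * (12 * lam).
Proof. by rewrite mulrA. Qed.

Lemma poisson_cst_ge1 : 1 <= poisson_cst.
Proof. by rewrite /poisson_cst -natrM ler1n. Qed.

Lemma expR_half_le2 : expR (1/2) <= 2 :> R.
Proof.
have h1 : 1 + (- (1/2)) <= expR (- (1/2)) :> R := expR_ge1Dx _.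
have h2 : expR (1/2) * expR (- (1/2)) = 1 :> R by rewrite -expRD subrr expR0.
have h0 := expR_gt0 (1/2 : R).
nra.
Qed.

Lemma expR1_le4 : expR 1 <= 4 :> R.
Proof.
have h3 : expR 1 = expR (1/2) * expR (1/2) :> R by rewrite -expRD -splitr.
by rewrite h3; have := expR_half_le2; have := expR_gt0 (1/2 : R); nra.
Qed.

(* The term with [m] the integral part of [z] already dominates. *)
Lemma expR_le_moments (z : R) M : 0 <= z -> z <= M%:R ->
  expR z <= 4 + \sum_(1 <= m < M.+1) (4 * z / m%:R) ^+ (2 * m).
Proof.
move=> z0 zM.
have S0 (a b : nat) : 0 <= \sum_(a <= m < b) (4 * z / m%:R) ^+ (2 * m).
  by apply: sumr_ge0 => m _; rewrite exprn_ge0// divr_ge0// mulr_ge0.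
have [z1|z1] := leP z 1.
  apply: (@le_trans _ _ 4); last by rewrite lerDl.
  by rewrite (le_trans _ expR1_le4)// ler_expR.
pose m := Num.truncn z.
have /andP[m1 m2] : m%:R <= z < m.+1%:R by exact: truncn_itv.
have mM : (m <= M)%N by rewrite -(ler_nat R) (le_trans m1).
have m0 : (0 < m)%N.
  by rewrite lt0n; apply/eqP => e; move: m2; rewrite e; lra.
have mR : 1 <= m%:R :> R by rewrite ler1n.
rewrite (@big_cat_nat _ _ _ m)//=; last by rewrite ltnW.
rewrite [X in _ + (_ + X)]big_ltn//.
have h1 := S0 1%N m; have h2 := S0 m.+1 M.+1.
suff : expR z <= (4 * z / m%:R) ^+ (2 * m) by lra.
have e1 : expR z <= 4 ^+ m.+1.
  apply: (@le_trans _ _ (expR m.+1%:R)); first by rewrite ler_expR ltW.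
  by rewrite -[X in expR X]mul1r mulrC expRM_natl lerXn2r// ?nnegrE ?expR_ge0// expR1_le4.
apply: (le_trans e1).
have e2 : 4 <= 4 * z / m%:R by rewrite ler_pdivlMr; lra.
apply: (@le_trans _ _ (4 ^+ (2 * m))).
  by rewrite ler_weXn2l ?ler1n// mul2n -addnn -addn1 leq_add2l.
by rewrite lerXn2r// ?nnegrE//; lra.
Qed.

(** The factors [(4 / m)^(2m)] and [(m / 8)^(2m)] multiply to [2^(-2m)], so the moments sum to at
    most [K]. *)
Lemma exp_moments (A : set (rvec R d)) (y : rvec R d -> R) (K : R) :
  measurable A -> bmeas y -> (forall x, 0 <= y x) -> 0 <= K ->
  (forall m, (0 < m)%N ->
    J (fun x => \1_A x * y x ^+ (2 * m)) <= K * (m%:R / 8) ^+ (2 * m)) ->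
  J (fun x => \1_A x * expR (y x)) <= 4 * V + K.
Proof.
move=> mA by_ y0 K0 hm.
have bA := @bmeas_indic _ _ R A mA.
have [M yM] : exists M : nat, forall x, y x <= M%:R.
  have [_ [N yN]] := by_; exists (Num.truncn N).+1 => x.
  rewrite (le_trans (ler_norm _))// (le_trans (yN x))//.
  by rewrite ltW// truncnS_gt.
pose F m x := (4 / m%:R) ^+ (2 * m) * (\1_A x * y x ^+ (2 * m)) : R.
have bF m : bmeas (F m) by apply: bmeasZ; apply: bmeasM => //; exact: bmeasX.
have bS : bmeas (fun x => \sum_(1 <= m < M.+1) F m x) by exact: bmeas_sum.
apply: (@le_trans _ _ (J (fun x => 4 + \sum_(1 <= m < M.+1) F m x))).
  apply: (bint_le mT fT (bmeasM bA (bmeas_exp by_)) (bmeasD (bmeas_cst 4) bS)) => x _.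
  rewrite indicE; have [xA|xA] := boolP (x \in A) => /=; rewrite ?mulr1n ?mulr0n.
    rewrite mul1r (le_trans (expR_le_moments (y0 x) (yM x)))// lerD2l.
    apply: ler_sum => m _; rewrite /F le_eqVlt; apply/orP; left; apply/eqP.
    by rewrite indicE xA mul1r -exprMn mulrAC.
  rewrite mul0r addr_ge0//; apply: sumr_ge0 => m _; rewrite /F !mulr_ge0// ?exprn_ge0//.
rewrite (bintD mT fT (bmeas_cst 4) bS) (bint_cst mu mT) lerD2l (bint_sum mT fT)//.
have -> : K = K * 1 by rewrite mulr1.
suff h n : \sum_(1 <= m < n.+1) J (F m) <= K * (1 - 2^-1 ^+ n).
  by rewrite (le_trans (h M))// ler_wpM2l// gerBl exprn_ge0.
elim: n => [|n ih]; first by rewrite big_geq// expr0 subrr mulr0.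
rewrite big_nat_recr//=.
have : J (F n.+1) <= K * 2^-1 ^+ n.+1.
  rewrite /F (bintZ mT fT); last by apply: bmeasM => //; exact: bmeasX.
  apply: (@le_trans _ _ ((4 / n.+1%:R) ^+ (2 * n.+1) * (K * (n.+1%:R / 8) ^+ (2 * n.+1)))).
    by rewrite ler_wpM2l ?hm// exprn_ge0// divr_ge0.
  rewrite mulrCA ler_wpM2l// -exprMn.
  have -> : 4 / n.+1%:R * (n.+1%:R / 8) = 2^-1 :> R by field.
  by rewrite ler_wiXn2l ?invr_ge0//; [lra|lia].
move: ih; rewrite exprS; set t := 2^-1 ^+ n; nra.
Qed.

Section half_space.
Variables (w : freq d) (G : rvec R d -> R).
Hypotheses (bG : bmeas G) (G0 : forall x, 0 <= G x)
  (Gper : forall j x, G (shift2pi j x) = G x).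
Variable lam : R.
Hypothesis lam0 : 0 < lam.

Local Notation A := (poisson_cst * lam).

Let A0 : 0 < A.
Proof. by rewrite mulr_gt0// (lt_le_trans ltr01) ?poisson_cst_ge1. Qed.

(** Here the curve of height [sigma / 8] touches the torus, so a bound on the curve is a bound on
    the polynomial itself. *)
Definition calm : set (rvec R d) := [set x | sigma w G lam x = 0].

Lemma measurable_calm : measurable calm.
Proof.
have [ms _] := bmeas_sigma w bG G0 lam0.
have -> : calm = sigma w G lam @^-1` [set 0] by [].
by rewrite -[X in measurable X]setTI; apply: ms => //; exact: measurable_set1.
Qed.

Lemma normc_calm_le p x : (forall y, normc (teval p y) <= G y) -> calm x ->
  normc (teval p x) <= 2 * A.
Proof.
move=> pG xE.
have key q : (forall y, normc (teval q y) <= G y) -> `|complex.Re (teval q x)| <= A.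
  move=> qG; have := @Re_tpois_le R d w G bG G0 lam lam0 0 q x qG.
  rewrite lexx tpois_cst0 xE mulr0 lexx poisson_cstE; apply => //.
  by rewrite divr_gt0.
have h1 := key p pG.
have iG y : normc (teval (tmult (fun=> - 'i%C) p) y) <= G y.
  by rewrite teval_scale normcM normcN_i mul1r.
have := key _ iG; rewrite teval_scale ReM /= oppr0 mul0r sub0r mulN1r opprK => h2.
by have := normc_le_ReIm (teval p x); lra.
Qed.

(* On the curve of height [sigma / 8] the Poisson integral of [p] is [O(lam)]. *)
Lemma tana_moment p m : (forall y, normc (teval p y) <= G y) -> (0 < m)%N ->
  J (fun x => \1_calm x * complex.Im (teval (tana w p) x) ^+ (2 * m)) <=
  6 * V * (17 * m%:R * A) ^+ (2 * m).
Proof.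
move=> pG m0; pose F := tmult (fun=> - 'i%C) (tana w p).
have aF : analytic w F by rewrite /analytic all_map; exact: analytic_tana.
(* The factor 1/8 keeps the slope below 1/4 and, as [sigma <= pi < 4] on [D], the height below 1/2,
   where the Poisson bound holds. *)
pose s x := 8^-1 * sigma w G lam x.
(* A flow-invariant set containing [calm]; on it the orbit mean of [p] and the height are both under
   control. *)
pose D := [set x | favg w G pi x <= lam * pi].
have bs : bmeas s by apply: bmeasZ; exact: (bmeas_sigma w bG G0 lam0).
have s0 x : 0 <= s x by rewrite mulr_ge0 ?invr_ge0// (sigma_ge0 w bG G0 lam0).
have sper j x : s (shift2pi j x) = s x by rewrite /s sigma_shift2pi.
have mD : measurable D.
  have [mf _] := bmeas_favg w bG G0 pi.
  rewrite [X in measurable X](_ : _ = favg w G pi @^-1` `]-oo, lam * pi]); last first.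
    by apply/seteqP; split => x /=; rewrite in_itv.
  by rewrite -[X in measurable X]setTI; apply: mf => //; exact: measurable_itv.
pose chi : rvec R d -> R := \1_D.
have bchi : bmeas chi by exact: bmeas_indic.
have chi0 x : 0 <= chi x by rewrite /chi indicE ler0n.
have chi1 x : chi x <= 1 by rewrite /chi indicE lern1; case: (_ \in _).
have Dinv y x : favg w G pi y = favg w G pi x -> chi y = chi x.
  by move=> e; rewrite /chi !indicE; congr (nat_of_bool _)%:R; apply/idP/idP; rewrite !inE /D /= e.
have chiper j x : chi (shift2pi j x) = chi x by apply: Dinv; rewrite favg_shift2pi.
have chifl h x : chi (flow w h x) = chi x by apply: Dinv; rewrite favg_pi_flow.
have hs : forall e : R, 0 < e -> exists2 h, 0 < h <= e & forall x, `|s (flow w h x) - s x| <= h / 4.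
  move=> e e0; have [i hi] : exists i, pi / 2 ^+ i <= e.
    have : @GRing.exp R 2^-1 @ \oo --> 0 by apply: cvg_expr; rewrite ger0_norm//; lra.
    have e1 : 0 < e / pi by rewrite divr_gt0// pi_gt0.
    move=> /cvgrPdist_le /(_ _ e1) [N _ h]; exists N; have := h N (leqnn N).
    rewrite sub0r normrN ger0_norm ?exprn_ge0// exprVn ler_pdivlMr ?pi_gt0//.
    by rewrite mulrC.
  exists (pi / 2 ^+ i); first by rewrite divr_gt0 ?pi_gt0 ?exprn_gt0.
  move=> x; rewrite /s -mulrBr normrM ger0_norm ?invr_ge0//.
  have := sigma_lipschitz w bG G0 Gper lam0 i x; set L := _ / _ => hL.
  have L0 : 0 <= L by rewrite divr_ge0 ?pi_ge0 ?exprn_ge0.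
  by rewrite mulrC ler_pdivrMr//; lra.
have := @curve_riesz R d w s chi bs s0 sper bchi chi0 chiper chifl F m aF m0 hs.
have tF x : teval (tzero w F) x = - 'i%C * teval (tzero w p) x.
  rewrite -[in RHS]teval_tzero_tana /F.
  by rewrite /tzero tmult_comp !teval_tmult mulr_sumr; apply: eq_bigr => t _; ring.
have sF x : tevals w s F x = - 'i%C * tevals w s (tana w p) x.
  by rewrite /tevals /F /tmult big_map mulr_sumr; apply: eq_bigr => t _ /=; ring.
have Dchi x : D x -> chi x = 1 by move=> Dx; rewrite /chi indicE mem_set.
have nDchi x : ~ D x -> chi x = 0 by move=> Dx; rewrite /chi indicE memNset.
have [bre bim] := bcmeas_tevals w bs F.
have bI : bmeas (fun x => chi x * complex.Im (tevals w s F x) ^+ (2 * m)).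
  by apply: bmeasM => //; exact: bmeasX.
have bRe : bmeas (fun x => chi x * complex.Re (tevals w s F x) ^+ (2 * m)).
  by apply: bmeasM => //; exact: bmeasX.
have bZ : bmeas (fun x => chi x * normc (teval (tzero w F) x) ^+ (2 * m)).
  by apply: bmeasM => //; apply: bmeasX; apply: bcmeas_normc; exact: bcmeas_teval.
have An : 0 <= A ^+ (2 * m) by rewrite exprn_ge0// ltW.
have h1 : J (fun x => chi x * complex.Im (tevals w s F x) ^+ (2 * m)) <= A ^+ (2 * m) * V.
  rewrite -(bint_cst mu mT); apply: (bint_le mT fT bI (bmeas_cst _)) => x _.
  have [Dx|Dx] := pselect (D x); last by rewrite nDchi// mul0r.
  rewrite Dchi// mul1r sF ImM /= oppr0 mul0r add0r mulN1r Re_tana.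
  rewrite exprM sqrrN -exprM exprM -real_normK ?num_real// -exprM.
  rewrite lerXn2r// ?nnegrE ?(ltW A0)//.
  have -> : tpois w s p x = tpois w (fun=> s x) p x by [].
  have := @Re_tpois_le R d w G bG G0 lam lam0 (s x) p x pG.
  rewrite poisson_cstE; apply; last by rewrite /s mulVKf.
  rewrite s0 /=.
  have : sigma w G lam x <= pi.
    by rewrite (le_trans (sigma_le_favg w bG G0 lam0 x))// ler_pdivrMr// mulrC.
  have := pihalf_lt2 R; rewrite /s; set S := sigma _ _ _ _ => h1 h2.
  rewrite mulrC ltr_pdivrMr//; lra.
have h2 : J (fun x => chi x * normc (teval (tzero w F) x) ^+ (2 * m)) <= A ^+ (2 * m) * V.
  rewrite -(bint_cst mu mT); apply: (bint_le mT fT bZ (bmeas_cst _)) => x _.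
  have [Dx|Dx] := pselect (D x); last by rewrite nDchi// mul0r.
  rewrite Dchi// mul1r tF normcM normcN_i mul1r lerXn2r// ?nnegrE ?normc_ge0 ?(ltW A0)//.
  rewrite (le_trans (normc_tzero_le bG pG Dx))//.
  by rewrite ler_peMl ?(ltW lam0)// poisson_cst_ge1.
have h3 : J (fun x => \1_calm x * complex.Im (teval (tana w p) x) ^+ (2 * m)) <=
    J (fun x => chi x * complex.Re (tevals w s F x) ^+ (2 * m)).
  have bT : bmeas (fun x => \1_calm x * complex.Im (teval (tana w p) x) ^+ (2 * m)).
    apply: bmeasM; first by apply: bmeas_indic; exact: measurable_calm.
    by apply: bmeasX; case: (bcmeas_teval (tana w p)).
  apply: (bint_le mT fT bT bRe) => x _.
  have [Ex|Ex] := pselect (calm x); last first.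
    by rewrite indicE memNset// mul0r mulr_ge0// exprM exprn_ge0// sqr_ge0.
  rewrite indicE mem_set// mul1r Dchi; last exact: (favg_le_sigma0 (w:=w) bG G0 lam0 Ex).
  rewrite mul1r sF.
  have -> : tevals w s (tana w p) x = teval (tana w p) x.
    rewrite -(tevals_cst0 w) /tevals; apply: eq_bigr => t _.
    by rewrite /s (Ex : sigma w G lam x = 0) mulr0.
  by rewrite ReM /= oppr0 mul0r sub0r mulN1r opprK.
move=> h; apply: (le_trans h3); apply: (le_trans h).
have k1 : 1 <= (17 * m%:R) ^+ (2 * m) :> R.
  have : 1 <= m%:R :> R by rewrite ler1n.
  by move=> ?; rewrite exprn_ege1//; lra.
have V0 : 0 <= V by rewrite fine_ge0.
rewrite [leRHS](_ : _ = 6 * ((17 * m%:R) ^+ (2 * m) * (A ^+ (2 * m) * V))); last first.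
  by rewrite [(17 * m%:R * A) ^+ _]exprMn; ring.
move: k1 h1 h2 (mulr_ge0 An V0); set X := (17 * _) ^+ _; set Y := A ^+ _ * V.
set I1 := J _; set I2 := J _ => k1 h1 h2 Y0.
have : X * I1 <= X * Y by rewrite ler_wpM2l// (le_trans ler01).
have : Y <= X * Y by rewrite ler_peMl.
by rewrite -mulrA; lra.
Qed.

End half_space.

(** The set depends on [G] and [v] but not on [c], since modulation keeps [|p| <= G]. The three
    parts of [normc_tge_le] have moments [V], [6 V] and [6 V] times [(17 m A)^(2m)]. The choice 208
    makes [(3/2) 17 / 208 = 51/416] at most 1/8, as [exp_moments] requires, and [17 = 4 + 13]. *)
Theorem half_space_exp v a c (G : rvec R d -> R) (lam : R) p :
  fdot a v = 1 -> bmeas G -> (forall x, 0 <= G x) ->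
  (forall j x, G (shift2pi j x) = G x) -> 0 < lam ->
  (forall y, normc (teval p y) <= G y) ->
  J (fun x => \1_(calm (- v) G lam) x *
     expR (normc (teval (thalf v c p) x) / (208 * (poisson_cst * lam)))) <= 17 * V.
Proof.
move=> av bG G0 Gper lam0 pG.
have pc1 := poisson_cst_ge1.
have A0 : 0 < poisson_cst * lam by rewrite mulr_gt0// (lt_le_trans ltr01).
move: (poisson_cst * lam) A0 (@tana_moment (- v) G bG G0 Gper lam lam0)
  (fun q x h => @normc_calm_le (- v) G bG G0 lam lam0 q x h) => A A0 hA hC.
set E := calm (- v) G lam.
have mE : measurable E by exact: measurable_calm.
have V0 : 0 <= V by rewrite fine_ge0.
pose f := tshift (- (a *~ c)) p.
have nf x : normc (teval f x) = normc (teval p x).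
  by rewrite teval_shift normcM normc_tchar mul1r.
have fG x : normc (teval f x) <= G x by rewrite nf.
have ifG x : normc (teval (tmult (fun=> 'i%C) f) x) <= G x.
  by rewrite teval_scale normcM normc_i mul1r.
have bA := @bmeas_indic _ _ R E mE.
have bh : bmeas (fun x => normc (teval (thalf v c p) x)) by exact/bcmeas_normc/bcmeas_teval.
pose y x := (208 * A)^-1 * normc (teval (thalf v c p) x).
have b0 : 0 < 208 * A by rewrite mulr_gt0.
have -> : (fun x => \1_E x * expR (normc (teval (thalf v c p) x) / (208 * A))) =
    (fun x => \1_E x * expR (y x)).
  by apply/funext => x; rewrite /y mulrC [X in expR X]mulrC mulrC.
have -> : 17 * V = 4 * V + 13 * V by ring.
apply: (exp_moments mE (bmeasZ _ bh)) => [x||m m0].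
- by rewrite mulr_ge0 ?normc_ge0// invr_ge0 ltW.
- by rewrite mulr_ge0.
have evn (r : R) : `|r| ^+ (2 * m) = r ^+ (2 * m).
  by rewrite exprM real_normK ?num_real// -exprM.
pose I1 x := \1_E x * normc (teval f x) ^+ (2 * m) : R.
pose I2 x := \1_E x * complex.Im (teval (tana (- v) f) x) ^+ (2 * m) : R.
pose I3 x := \1_E x * complex.Im (teval (tana (- v) (tmult (fun=> 'i%C) f)) x) ^+ (2 * m) : R.
have b1 : bmeas I1 by apply: bmeasM => //; apply: bmeasX; exact/bcmeas_normc/bcmeas_teval.
have bIm q : bmeas (fun x => \1_E x * complex.Im (teval (tana (- v) q) x) ^+ (2 * m)).
  by apply: bmeasM => //; apply: bmeasX; case: (bcmeas_teval (tana (- v) q)).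
have b2 : bmeas I2 := bIm f.
have b3 : bmeas I3 := bIm _.
have bt : bmeas (fun x => \1_E x * y x ^+ (2 * m)).
  by apply: bmeasM => //; apply: bmeasX; exact: bmeasZ.
have mR : 1 <= m%:R :> R by rewrite ler1n.
have j1 : J I1 <= V * (17 * m%:R * A) ^+ (2 * m).
  rewrite mulrC -(bint_cst mu mT); apply: (bint_le mT fT b1 (bmeas_cst _)) => x _.
  have B0 : 0 <= 17 * m%:R * A by rewrite !mulr_ge0// ltW.
  have [Ex|Ex] := pselect (E x); last first.
    by rewrite /I1 indicE memNset// mul0r exprn_ge0.
  rewrite /I1 indicE mem_set// mul1r lerXn2r// ?nnegrE ?normc_ge0//.
  rewrite (le_trans (hC _ _ fG Ex))// ler_wpM2r ?(ltW A0)//; lra.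
have j2 := hA f m fG m0.
have j3 := hA _ m ifG m0.
have key : J (fun x => \1_E x * y x ^+ (2 * m)) <=
   (3/2 / (208 * A)) ^+ (2 * m) * (J I1 + J I2 + J I3).
  rewrite -(bintD mT fT b1 b2) -(bintD mT fT (bmeasD b1 b2) b3).
  rewrite -(bintZ mT fT _ (bmeasD (bmeasD b1 b2) b3)).
  apply: (bint_le mT fT bt (bmeasZ _ (bmeasD (bmeasD b1 b2) b3))) => x _.
  rewrite /I1 /I2 /I3 -!mulrDr mulrCA ler_wpM2l ?indicE ?ler0n//.
  rewrite /y exprMn [3/2/_]mulrC exprMn -[leRHS]mulrA ler_wpM2l//.
    by rewrite exprn_ge0// invr_ge0 ltW.
  rewrite (normc_thalf _ _ _ av) -[complex.Im _ ^+ _]evn -[X in _ * (_ + _ + X)]evn.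
  apply: le_trans (expr_sum3_le _ (normc_ge0 _) (normr_ge0 _) (normr_ge0 _)).
  rewrite lerXn2r// ?nnegrE ?normc_ge0//; last exact: normc_tge_le.
  by rewrite divr_ge0// !addr_ge0// normc_ge0.
apply: (le_trans key).
have S0 : 0 <= 3/2 / (208 * A) by rewrite divr_ge0// ltW.
apply: (@le_trans _ _ ((3/2 / (208 * A)) ^+ (2 * m) * (13 * V * (17 * m%:R * A) ^+ (2 * m)))).
  rewrite ler_wpM2l ?exprn_ge0//; move: j1 j2 j3; rewrite -/I2 -/I3 -/E.
  by rewrite -/I2 -/I3; lra.
rewrite mulrCA ler_wpM2l ?mulr_ge0// -exprMn.
have -> : 3/2 / (208 * A) * (17 * m%:R * A) = m%:R * (51 / 416).
  by field; rewrite gt_eqF.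
have [q0 q1] : 0 <= (51 / 416 : R) /\ 51 / 416 <= 8^-1 :> R by split; lra.
move: (51 / 416 : R) q0 q1 => q q0 q1.
have m00 : 0 <= m%:R :> R by rewrite ler0n.
apply: lerXn2r; rewrite ?nnegrE; last exact: (ler_wpM2l m00 q1).
  exact: (mulr_ge0 m00 q0).
exact: (mulr_ge0 m00 (le_trans q0 q1)).
Qed.

End exponential_estimate.

(** * Approximation of bounded functions, and duality *)

Section density_functions.
Local Open Scope complex_scope.
Context {R : realType} {d : nat}.
Local Notation C := R[i].
Local Notation mu := (@lebesgue_rvec R d).
Local Notation T := (torus_cube d : set (rvec R d)).
Local Notation J f := (Rintegral mu T f).
Local Notation V := (fine (mu T)).
Implicit Types (k v w : freq d) (x : rvec R d) (p q g : @tpoly R d).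

Let mT : measurable T := @cube_measurable R d.
Let fT : (mu T < +oo)%E := @cube_fin R d.

(** The sum is the integral part of [t]. *)
Lemma layer_sum_bounds (t : R) K : 0 <= t <= K%:R ->
  t - 1 <= \sum_(i < K) ((i.+1%:R <= t)%R)%:R <= t.
Proof.
elim: K t => [|K ih] t /andP[t0 tK].
  by rewrite big_ord0 t0 andbT; lra.
rewrite big_ord_recl /=; have [t1|t1] := leP 1 t.
  have : 0 <= t - 1 <= K%:R by rewrite -natr1 in tK; apply/andP; split; lra.
  move=> /ih; rewrite (eq_bigr (fun i : 'I_K => ((i.+2%:R <= t)%R)%:R)); last first.
    by move=> i _; rewrite lerBrDr natr1.
  by move=> /andP[? ?]; apply/andP; split; rewrite /= ?mulr1n; lra.
rewrite big1; first by rewrite /= addr0 t0 andbT; lra.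
move=> i _; rewrite /bump /= add1n leNgt (lt_le_trans t1)//.
by rewrite ler1n.
Qed.

(** Layers: [u] is within [1 / K] of the mean of the indicators of [K u >= i + 1], and each
    indicator is replaced by a polynomial. *)
Lemma unit_function_approx (u : rvec R d -> R) (e : R) :
  measurable_fun setT u -> (forall x, 0 <= u x <= 1) -> 0 < e ->
  exists p u', unit_valued p u' /\ J (fun x => `|u x - u' x|) <= e.
Proof.
move=> mu_ u01 e0.
have V0 : 0 <= V by rewrite fine_ge0.
have [K [K0 KV]] : exists K, (0 < K)%N /\ V / K%:R <= e / 2.
  exists (Num.truncn (V / (e / 2))).+1; split => //.
  rewrite ler_pdivrMr ?ltr0n// mulrC -ler_pdivrMr ?divr_gt0//.
  by rewrite ltW// truncnS_gt.
have KR : 0 < K%:R :> R by rewrite ltr0n.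
pose S (i : 'I_K) := [set x | i.+1%:R <= K%:R * u x].
have mS i : measurable (S i).
  have mKu : measurable_fun setT (fun x => K%:R * u x) by exact: measurable_funM.
  rewrite [X in measurable X](_ : _ = (fun x => K%:R * u x) @^-1` `[i.+1%:R, +oo[); last first.
    by apply/seteqP; split => x /=; rewrite in_itv /= andbT.
  by rewrite -[X in measurable X]setTI; apply: mKu => //; exact: measurable_itv.
have e2 : 0 < e / 2 by rewrite divr_gt0.
have /choice[p hp] : forall i, exists p, exists u', unit_valued p u' /\
    J (fun x => `|\1_(S i) x - u' x|) <= e / 2.
  by move=> i; have [_ /(_ _ e2)] := approximable_measurable (mS i).
have /choice[u' hu] := hp.
pose s x := K%:R^-1 * \sum_(i < K) u' i x.
pose q := tmult (fun=> (K%:R^-1 : R)%:C) (flatten [seq p i | i <- enum 'I_K]).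
have bu i : bmeas (u' i) by have [h _] := hu i; exact: unit_valued_bmeas h.
have bs : bmeas s by apply: bmeasZ; exact: bmeas_sum.
exists q, s; split; first split => x.
- rewrite teval_scale rmorphM; congr (_ * _).
  have -> (l : seq 'I_K) : teval (flatten [seq p i | i <- l]) x = \sum_(i <- l) (u' i x)%:C.
    elim: l => [|i l ih] /=; first by rewrite teval_nil big_nil.
    by rewrite teval_cat ih big_cons; have [[-> _] _] := hu i.
  by rewrite big_enum rmorph_sum.
- have h i : 0 <= u' i x <= 1 by have [[_ ->] _] := hu i.
  rewrite mulr_ge0 ?invr_ge0 ?ler0n//=; last by apply: sumr_ge0 => i _; case/andP: (h i).
  rewrite /s mulrC ler_pdivrMr// mul1r [leRHS](_ : _ = \sum_(i < K) 1); last by rewrite sumr_const card_ord.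
  by apply: ler_sum => i _; case/andP: (h i).
pose D x := K%:R^-1 * \sum_(i < K) `|\1_(S i) x - u' i x|.
have bD i : bmeas (fun x => `|\1_(S i) x - u' i x|).
  by apply: bmeas_norm; apply: bmeasB => //; exact: bmeas_indic.
have bDs : bmeas D by apply: bmeasZ; exact: bmeas_sum.
have bu0 : bmeas u.
  by split => //; exists 1 => x; have /andP[h0 h1] := u01 x; rewrite ger0_norm.
apply: (@le_trans _ _ (J (fun x => K%:R^-1 + D x))).
  apply: (bint_le mT fT (bmeas_norm (bmeasB bu0 bs)) (bmeasD (bmeas_cst _) bDs)) => x _.
  have /andP[h0 h1] := u01 x.
  have Ku : 0 <= K%:R * u x <= K%:R by rewrite mulr_ge0 ?ler0n//= ler_piMr ?ler0n.
  have /andP[l1 l2] := layer_sum_bounds Ku.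
  have -> : u x - s x = K%:R^-1 * ((K%:R * u x - \sum_(i < K) (\1_(S i) x : R)) +
      \sum_(i < K) (\1_(S i) x - u' i x)).
    rewrite sumrB /s; field.
    by rewrite gt_eqF.
  rewrite normrM ger0_norm ?invr_ge0 ?ler0n// /D.
  rewrite -[X in _ <= X + _]mulr1 -mulrDr ler_wpM2l ?invr_ge0 ?ler0n//.
  rewrite (le_trans (ler_normD _ _))// lerD ?ler_norm_sum//.
  have -> : \sum_(i < K) (\1_(S i) x : R) = \sum_(i < K) ((i.+1%:R <= K%:R * u x)%R)%:R.
    apply: eq_bigr => i _; rewrite indicE; congr (nat_of_bool _)%:R.
    by apply/idP/idP; rewrite inE.
  by rewrite ler_norml; apply/andP; split; lra.
rewrite (bintD mT fT (bmeas_cst _) bDs) (bint_cst mu mT) (bintZ mT fT); last exact: bmeas_sum.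
rewrite (bint_sum mT fT)//.
have -> : e = e / 2 + e / 2 by rewrite -splitr.
rewrite lerD//; first by rewrite mulrC.
rewrite mulrC ler_pdivrMr//.
apply: (@le_trans _ _ (\sum_(i < K) e / 2)); last by rewrite sumr_const card_ord mulr_natr.
by apply: ler_sum => i _; have [_] := hu i.
Qed.

(** The uniform bound 2 matters as much as the [L^1] error: it makes the polynomials admissible test
    functions for duality. *)
Lemma bounded_function_approx (f : rvec R d -> C) (e : R) :
  bcmeas f -> (forall x, normc (f x) <= 1) -> 0 < e ->
  exists q, (forall x, normc (teval q x) <= 2) /\
    J (fun x => normc (f x - teval q x)) <= e.
Proof.
move=> [b1 b2] f1 e0.
have e4 : 0 < e / 4 by rewrite divr_gt0.
have key (h : rvec R d -> R) : bmeas h -> (forall x, `|h x| <= 1) ->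
    exists p r, (forall x, teval p x = (r x)%:C) /\ (forall x, `|r x| <= 1) /\
      bmeas r /\ J (fun x => `|h x - r x|) <= e / 2.
  move=> bh h1; pose u x := 2^-1 * (1 + h x).
  have bu : bmeas u by apply: bmeasZ; apply: bmeasD => //; exact: bmeas_cst.
  have u01 x : 0 <= u x <= 1.
    by have := h1 x; rewrite ler_norml /u => /andP[? ?]; apply/andP; split; lra.
  have [p [u' [pu hu]]] := unit_function_approx bu.1 u01 e4.
  have bu' := unit_valued_bmeas pu.
  exists (tmult (fun=> (2 : R)%:C) p ++ tmult (fun=> -1) tone), (fun x => 2 * u' x - 1).
  split; first by move=> x; rewrite teval_cat !teval_scale pu.1 teval_one rmorphB rmorphM /= mulN1r.
  split; first by move=> x; have /andP[? ?] := pu.2 x; rewrite ler_norml; apply/andP; split; lra.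
  split; first by apply: bmeasB; [exact: bmeasZ|exact: bmeas_cst].
  have -> : (fun x => `|h x - (2 * u' x - 1)|) = (fun x => 2 * `|u x - u' x|).
    apply/funext => x; rewrite -[2 in RHS]ger0_norm// -normrM; congr (`|_|); rewrite /u.
    by field.
  by rewrite (bintZ mT fT _ (bmeas_norm (bmeasB bu bu'))); lra.
have [p1 [r1 [pr1 [r11 [br1 h1]]]]] := key _ b1 (fun x => le_trans (ler_normRe _) (f1 x)).
have [p2 [r2 [pr2 [r21 [br2 h2]]]]] := key _ b2 (fun x => le_trans (ler_normIm _) (f1 x)).
exists (p1 ++ tmult (fun=> 'i%C) p2).
have qE x : teval (p1 ++ tmult (fun=> 'i%C) p2) x = (r1 x +i* r2 x)%C.
  rewrite teval_cat teval_scale pr1 pr2; apply/eqP; rewrite eq_complex /=.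
  by apply/andP; split; apply/eqP; ring.
split=> [x|].
  by rewrite (le_trans (normc_le_ReIm _))// qE /=; have := r11 x; have := r21 x; lra.
have bf : bcmeas f by split.
have -> : e = e / 2 + e / 2 by rewrite -splitr.
apply: le_trans (lerD h1 h2).
have c1 := bmeas_norm (bmeasB b1 br1); have c2 := bmeas_norm (bmeasB b2 br2).
rewrite -(bintD mT fT c1 c2).
apply: (bint_le mT fT _ (bmeasD c1 c2)) => [|x _].
  by apply: bcmeas_normc; apply: bcmeasB => //; exact: bcmeas_teval.
rewrite (le_trans (normc_le_ReIm _))// qE.
by case: (f x).
Qed.

(** After normalization the error is at most [1 + 2 = 3] pointwise, so its square is controlled by
    its [L^1] norm. *)
Lemma L2_function_approx (f : rvec R d -> C) (e : R) : bcmeas f -> 0 < e ->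
  exists q, J (fun x => normc (f x - teval q x) ^+ 2) <= e.
Proof.
move=> bf e0; have [_ [M0 fM0]] := bcmeas_normc bf.
pose M := Num.max 1 M0.
have M1 : 1 <= M by rewrite le_max lexx.
have fM x : normc (f x) <= M.
  by rewrite le_max (le_trans (ler_norm _) (fM0 x)) orbT.
have Mp : 0 < M by rewrite (lt_le_trans ltr01).
pose h x := (M^-1)%:C * f x.
have bh : bcmeas h by apply: bcmeasM => //; exact: bcmeas_cst.
have h1 x : normc (h x) <= 1.
  by rewrite normcM normcZ ger0_norm ?invr_ge0 ?(ltW Mp)// mulrC ler_pdivrMr// mul1r.
have e1 : 0 < e / (M ^+ 2 * 3) by rewrite divr_gt0// mulr_gt0// exprn_gt0.
have [q [q2 hq]] := bounded_function_approx bh h1 e1.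
exists (tmult (fun=> M%:C) q).
have bd : bmeas (fun x => normc (h x - teval q x)).
  by apply: bcmeas_normc; apply: bcmeasB => //; exact: bcmeas_teval.
have bd2 : bmeas (fun x => normc (f x - teval (tmult (fun=> M%:C) q) x) ^+ 2).
  by apply: bmeasX; apply: bcmeas_normc; apply: bcmeasB => //; exact: bcmeas_teval.
have M3 : 0 < M ^+ 2 * 3 by rewrite mulr_gt0// exprn_gt0.
apply: (@le_trans _ _ (J (fun x => (M ^+ 2 * 3) * normc (h x - teval q x)))).
  apply: (bint_le mT fT bd2 (bmeasZ _ bd)) => x _.
  have -> : f x - teval (tmult (fun=> M%:C) q) x = M%:C * (h x - teval q x).
    rewrite teval_scale /h mulrBr mulrA -rmorphM mulfV ?gt_eqF// mul1r//.
  rewrite normcM normcZ ger0_norm ?(ltW Mp)// exprMn -[leRHS]mulrA ler_wpM2l ?exprn_ge0 ?(ltW Mp)//.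
  rewrite expr2 ler_wpM2r ?normc_ge0//.
  rewrite (le_trans (le_normcD _ _))// normcN.
  by have := h1 x; have := q2 x; lra.
rewrite (bintZ mT fT _ bd) (le_trans (ler_wpM2l (ltW M3) hq))//.
by rewrite mulrC divfK// gt_eqF.
Qed.

(* Duality between L^1 and bounded functions, tested on polynomials only. *)
Lemma normc_dual g (B : R) :
  (forall q, (forall x, normc (teval q x) <= 2) ->
     J (fun x => complex.Re (teval g x * conjc (teval q x))) <= B) ->
  J (fun x => normc (teval g x)) <= B.
Proof.
move=> hB; have bg := bcmeas_teval g; have bn := bcmeas_normc bg.
have [_ [M0 gM0]] := bn; pose M := Num.max 1 M0.
have M1 : 1 <= M by rewrite le_max lexx.
have gM x : normc (teval g x) <= M.
  by rewrite le_max (le_trans (ler_norm _) (gM0 x)) orbT.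
have V0 : 0 <= V by rewrite fine_ge0.
apply/ler_addgt0Pr => e e0.
pose n := e / (2 * (V + 1)).
have n0 : 0 < n by rewrite divr_gt0// mulr_gt0//; lra.
(* [u] is [1 / (|g| + n)], so pairing [g] with [u g] gives [|g|^2 / (|g| + n) >= |g| - n]; the
   positive [n] keeps [u] bounded. *)
pose u x := expR (- ln (normc (teval g x) + n)).
have up x : 0 < normc (teval g x) + n by rewrite ltr_wpDl ?normc_ge0.
have uE x : u x = (normc (teval g x) + n)^-1 by rewrite /u expRN lnK ?posrE.
have bu : bmeas u.
  split.
    apply: measurableT_comp; first exact: measurable_expR.
    apply: measurableT_comp => //; apply: measurableT_comp; first exact: measurable_ln.
    by have [] := bmeasD bn (bmeas_cst n).
  exists n^-1 => x; rewrite ger0_norm ?expR_ge0// uE lef_pV2 ?posrE//.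
  by rewrite lerDr normc_ge0.
pose f x := (u x)%:C * teval g x.
have bf : bcmeas f by apply: bcmeasM => //; exact: bcmeas_real.
have f1 x : normc (f x) <= 1.
  rewrite normcM normcZ ger0_norm ?expR_ge0// uE mulrC ler_pdivrMr// mul1r.
  by rewrite lerDl ltW.
have e1 : 0 < e / (2 * M) by rewrite divr_gt0// mulr_gt0// (lt_le_trans ltr01).
have [q [q2 hq]] := bounded_function_approx bf f1 e1.
have bq := bcmeas_teval q.
have b1 : bmeas (fun x => complex.Re (teval g x * conjc (teval q x))).
  by have [] := bcmeasM bg (bcmeas_conj bq).
have b2 : bmeas (fun x => normc (f x - teval q x)) by apply: bcmeas_normc; exact: bcmeasB.
have b3 := bmeasD (bmeasD b1 (bmeasZ M b2)) (bmeas_cst n).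
have -> : B + e = B + e / 2 + e / 2 by rewrite -addrA -splitr.
apply: (@le_trans _ _ (J (fun x => complex.Re (teval g x * conjc (teval q x)) +
    M * normc (f x - teval q x) + n))).
  apply: (bint_le mT fT bn b3) => x _.
  have h1 : normc (teval g x) - n <= complex.Re (teval g x * conjc (f x)).
    have -> : complex.Re (teval g x * conjc (f x)) = u x * normc (teval g x) ^+ 2.
      by rewrite /f conjcZ mulrCA ReZ sqr_normcE; case: (teval g x) => a b /=; ring.
    rewrite uE mulrC ler_pdivlMr//; have := normc_ge0 (teval g x).
    by have := ltW n0; nra.
  have h2 : complex.Re (teval g x * conjc (f x)) = complex.Re (teval g x * conjc (teval q x)) +
      complex.Re (teval g x * conjc (f x - teval q x)).
    rewrite -ReD -mulrDr; congr (complex.Re (_ * _)).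
    by rewrite -conjcD addrC subrK.
  have h3 : complex.Re (teval g x * conjc (f x - teval q x)) <= M * normc (f x - teval q x).
    rewrite (le_trans (ler_norm _))// (le_trans (ler_normRe _))// normcM normc_conj.
    by rewrite ler_wpM2r ?normc_ge0.
  lra.
rewrite (bintD mT fT (bmeasD b1 (bmeasZ M b2)) (bmeas_cst n)).
rewrite (bintD mT fT b1 (bmeasZ M b2)) (bintZ mT fT _ b2) (bint_cst mu mT).
rewrite lerD ?lerD ?hB//.
  rewrite (le_trans (ler_wpM2l (le_trans ler01 M1) hq))//.
  rewrite le_eqVlt; apply/orP; left; apply/eqP; field.
  by rewrite gt_eqF// (lt_le_trans ltr01).
rewrite /n mulrAC ler_pdivrMr; last by rewrite mulr_gt0//; lra.
have -> : e / 2 * (2 * (V + 1)) = e * V + e by field.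
by rewrite lerDl ltW.
Qed.

End density_functions.

(** * Logarithmic integrability: level sets against test polynomials *)

Section blocks.
Local Open Scope complex_scope.
Context {R : realType} {d : nat}.
Local Notation C := R[i].
Local Notation mu := (@lebesgue_rvec R d).
Local Notation T := (torus_cube d : set (rvec R d)).
Local Notation J f := (Rintegral mu T f).
Local Notation V := (fine (mu T)).
Implicit Types (k v w : freq d) (x : rvec R d) (p q g : @tpoly R d).

Let mT : measurable T := @cube_measurable R d.
Let fT : (mu T < +oo)%E := @cube_fin R d.

(** From [N <= a expR (N / a)] with [a = 2 D], raised to the power [D], and [expR (1/2) <= 2]. *)
Lemma power_le_exp2 (D N : nat) : N%:R ^+ D <= (2 * D%:R) ^+ D * 2 ^+ N :> R.
Proof.
case: D => [|D]; first by rewrite !expr0 mul1r exprn_ege1// ler1n.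
set a : R := 2 * D.+1%:R; have a0 : 0 < a by rewrite mulr_gt0// ltr0n.
have h : N%:R <= a * expR (N%:R / a).
  have := expR_ge1Dx (N%:R / a); rewrite -(ler_pM2l a0) mulrDr mulrCA mulfV ?gt_eqF//.
  by apply: le_trans; rewrite !mulr1 lerDr ltW.
apply: (@le_trans _ _ ((a * expR (N%:R / a)) ^+ D.+1)).
  by rewrite lerXn2r// nnegrE ?mulr_ge0 ?expR_ge0// ltW.
rewrite exprMn ler_wpM2l ?exprn_ge0 ?(ltW a0)//.
rewrite -expRM_natl.
have -> : D.+1%:R * (N%:R / a) = N%:R * (1/2) :> R.
  have D0 : D.+1%:R != 0 :> R by rewrite pnatr_eq0.
  by rewrite /a; move: (D.+1%:R) D0 => z z0; field.
by rewrite expRM_natl; apply: lerXn2r; rewrite ?nnegrE ?expR_ge0// expR_half_le2.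
Qed.

Lemma split_le (b M : R) n : 0 <= b -> 0 < M -> (0 < n)%N ->
  b <= M * (1 + (b / M) ^+ n).
Proof.
move=> b0 M0 n0; rewrite mulrC -ler_pdivrMr//.
have : 0 <= b / M by rewrite divr_ge0// ltW.
move: (b / M) => z z0; have [z1|z1] := leP z 1.
  by rewrite (le_trans z1)// lerDl exprn_ge0.
by rewrite -(prednK n0) exprS (le_trans (_ : _ <= z * z ^+ n.-1))// ?lerDr// ler_peMr// exprn_ege1// ltW.
Qed.

Lemma sqr_add_le (a b : R) : (a + b) ^+ 2 <= 2 * a ^+ 2 + 2 * b ^+ 2.
Proof. by have := sqr_ge0 (a - b); lra. Qed.

Lemma geometric_add_le (a b z : R) : a <= 8^-1 * z -> b <= z ->
  2 * a + 2 * b <= 18 * (8^-1 * z).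
Proof. lra. Qed.

Lemma young_le (t z : R) : 0 < t -> 0 <= z -> z <= t^-1 + t * z ^+ 2.
Proof.
move=> t0 z0; rewrite -(ler_pM2l t0) mulrDr mulfV ?gt_eqF//.
by have := sqr_ge0 (t * z - 1); have := mulr_ge0 (ltW t0) z0; lra.
Qed.

Lemma two_eighths : 2 * 8^-1 = 4^-1 :> R.
Proof. by field. Qed.

Lemma quarter_le_half n : 4^-1 ^+ n <= 2^-1 ^+ n :> R.
Proof. by apply: lerXn2r; rewrite ?nnegrE; lra. Qed.

Definition tdiff (q : nat -> @tpoly R d) (N : nat) : @tpoly R d :=
  if N is M.+1 then q N ++ tmult (fun=> -1) (q M) else q 0%N.

(** Thus the projected [q N] is dominated by a sum of moduli that increases with [N], the majorant
    used in [tame_half_space]. *)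
Lemma thalfs_telescope L (q : nat -> @tpoly R d) N x :
  teval (thalfs L (q N)) x = \sum_(0 <= j < N.+1) teval (thalfs L (tdiff q j)) x.
Proof.
elim: N => [|N ih]; first by rewrite big_nat1.
rewrite big_nat_recr//= -ih /thalfs tmult_cat teval_cat addrC -addrA [X in _ + X](_ : _ = 0) ?addr0//.
rewrite tmult_comp !teval_tmult -big_split big1//= => t _; ring.
Qed.

Section test_polynomial.
Variables (D : nat) (L : seq (freq d * int)) (g : @tpoly R d).
Hypothesis Lprim : forall h, h \in L -> primitive h.1.
Hypothesis LD : (size L <= D)%N.
Hypothesis g2 : forall x, normc (teval g x) <= 2.

Let b x := normc (teval (thalfs L g) x).

Let bb : bmeas b. Proof. exact/bcmeas_normc/bcmeas_teval. Qed.

Let b0 x : 0 <= b x. Proof. exact: normc_ge0. Qed.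

Let V0 : 0 <= V. Proof. exact: fine_ge0. Qed.

Lemma test_moment m : (0 < m)%N ->
  J (fun x => b x ^+ (2 * m)) <= (2 * (104 * m%:R) ^+ D) ^+ (2 * m) * V.
Proof.
move=> m0; have bg : bmeas (fun x => normc (teval g x) ^+ (2 * m)).
  by apply: bmeasX; exact/bcmeas_normc/bcmeas_teval.
apply: (le_trans (riesz_thalfs g Lprim m0)).
have h1 : J (fun x => normc (teval g x) ^+ (2 * m)) <= 2 ^+ (2 * m) * V.
  rewrite -(bint_cst mu mT); apply: (bint_le mT fT bg (bmeas_cst _)) => x _.
  by rewrite lerXn2r// nnegrE ?normc_ge0.
have m1 : 1 <= m%:R :> R by rewrite ler1n.
have mR : 1 <= 104 * m%:R :> R by lra.
have h2 : (104 * m%:R) ^+ (2 * m * size L) <= (104 * m%:R) ^+ (2 * m * D) :> R.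
  by rewrite ler_weXn2l// leq_mul2l LD orbT.
have h0 : 0 <= (104 * m%:R) ^+ (2 * m * size L) :> R by rewrite exprn_ge0// (le_trans ler01).
apply: (le_trans (ler_wpM2l h0 h1)).
have -> : (2 * (104 * m%:R) ^+ D) ^+ (2 * m) * V =
    (104 * m%:R) ^+ (2 * m * D) * (2 ^+ (2 * m) * V).
  by rewrite exprMn -exprM [(D * _)%N]mulnC; ring.
by rewrite ler_wpM2r// mulr_ge0// exprn_ge0.
Qed.

Let W := 4 * 104 ^+ (2 * D) * V.

Lemma test_square : J (fun x => b x ^+ 2) <= W.
Proof.
have -> : W = (2 * 104 ^+ D) ^+ 2 * V.
  by rewrite /W exprMn -exprM [(D * _)%N]mulnC; ring.
by have := @test_moment 1 isT; rewrite muln1 mulr1.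
Qed.

(** Young's inequality, with the weight [t] left free so that it can grow with the block. *)
Lemma test_error (x : rvec R d -> R) (t : R) : bmeas x -> 0 < t ->
  J (fun y => `|x y| * b y) <= t * J (fun y => x y ^+ 2) + t^-1 * W.
Proof.
move=> bx t0; have bxa := bmeas_norm bx.
have bx2 := bmeasX 2 bx; have bb2 := bmeasX 2 bb.
apply: (@le_trans _ _ (J (fun y => t * x y ^+ 2 + t^-1 * b y ^+ 2))).
  apply: (bint_le mT fT (bmeasM bxa bb) (bmeasD (bmeasZ _ bx2) (bmeasZ _ bb2))) => y _.
  rewrite -[x y ^+ 2]real_normK ?num_real//.
  set a : R := `|x y|; have a0 : 0 <= a by exact: normr_ge0.
  rewrite -(ler_pM2l t0) [leRHS]mulrDr [t * (t^-1 * _)]mulrA mulfV ?gt_eqF// mul1r.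
  have := sqr_ge0 (t * a - b y); have := mulr_ge0 (mulr_ge0 (ltW t0) a0) (b0 y); lra.
rewrite (bintD mT fT (bmeasZ _ bx2) (bmeasZ _ bb2)) (bintZ mT fT _ bx2) (bintZ mT fT _ bb2).
by rewrite lerD2l ler_wpM2l ?invr_ge0 ?(ltW t0)// test_square.
Qed.

(* [b <= M (1 + (b/M)^(2N))] with [M] eight times the Riesz constant for the
   exponent [2N]: the second term gains [16^-N] against the size [4^N] of [h]. *)
Lemma test_block (h : rvec R d -> R) N : (0 < N)%N -> bmeas h ->
  (forall x, 0 <= h x <= 4 ^+ N.+1) ->
  J (fun x => h x * b x) <= 8 * 104 ^+ D * (N%:R ^+ D * J h) +
    32 * 104 ^+ D * V * (2 * D%:R) ^+ D * 2^-1 ^+ N.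
Proof.
move=> N0 bh h4; pose M : R := 8 * (104 * N%:R) ^+ D.
have NR : 1 <= N%:R :> R by rewrite ler1n.
have N1 : 0 < 104 * N%:R :> R by lra.
have M0 : 0 < M by rewrite mulr_gt0// exprn_gt0.
pose c x := M^-1 ^+ (2 * N) * b x ^+ (2 * N).
have bc : bmeas c by apply: bmeasZ; exact: bmeasX.
have h01 : J c <= 16^-1 ^+ N * V.
  rewrite /c (bintZ mT fT _ (bmeasX _ bb)).
  apply: (le_trans (ler_wpM2l _ (test_moment N0))); first by rewrite exprn_ge0// invr_ge0 ltW.
  rewrite mulrA -exprMn /M.
  have -> : (8 * (104 * N%:R) ^+ D)^-1 * (2 * (104 * N%:R) ^+ D) = 4^-1 :> R.
    by field; rewrite expf_neq0// gt_eqF.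
  rewrite exprM (_ : 4^-1 ^+ 2 = 16^-1 :> R)//; by field.
apply: (@le_trans _ _ (J (fun x => M * h x + 4 ^+ N.+1 * M * c x))).
  apply: (bint_le mT fT (bmeasM bh bb) (bmeasD (bmeasZ _ bh) (bmeasZ _ bc))) => x _.
  have /andP[h0 h1] := h4 x.
  have N2 : (0 < 2 * N)%N by rewrite muln_gt0.
  apply: (le_trans (ler_wpM2l h0 (split_le (b0 x) M0 N2))).
  have -> : (b x / M) ^+ (2 * N) = c x by rewrite exprMn mulrC.
  have c0 : 0 <= c x by rewrite mulr_ge0// exprn_ge0// invr_ge0 ltW.
  rewrite mulrDr mulr1 mulrDr [M * h x]mulrC lerD2l -mulrA ler_wpM2r//.
  by rewrite mulr_ge0// ltW.
rewrite (bintD mT fT (bmeasZ _ bh) (bmeasZ _ bc)) (bintZ mT fT _ bh) (bintZ mT fT _ bc).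
rewrite lerD//; first by rewrite /M exprMn !mulrA.
have M4 : 0 <= 4 ^+ N.+1 * M by rewrite mulr_ge0 ?exprn_ge0// ltW.
apply: (le_trans (ler_wpM2l M4 h01)).
have hp := power_le_exp2 D N.
have e2 : 2^-1 ^+ N = 2 ^+ N * 4^-1 ^+ N :> R by rewrite -exprMn; congr (_ ^+ _); field.
have e16 : 4 ^+ N * 16^-1 ^+ N = 4^-1 ^+ N :> R by rewrite -exprMn; congr (_ ^+ _); field.
have -> : 4 ^+ N.+1 * M * (16^-1 ^+ N * V) = 32 * 104 ^+ D * V * (4 ^+ N * 16^-1 ^+ N) * N%:R ^+ D.
  by rewrite exprS /M exprMn; ring.
rewrite e16 e2.
have -> : 32 * 104 ^+ D * V * (2 * D%:R) ^+ D * (2 ^+ N * 4^-1 ^+ N) =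
   32 * 104 ^+ D * V * 4^-1 ^+ N * ((2 * D%:R) ^+ D * 2 ^+ N) by ring.
by rewrite ler_wpM2l// !mulr_ge0// exprn_ge0// invr_ge0.
Qed.

End test_polynomial.

Lemma measurable_normc (A : set (rvec R d)) (f : rvec R d -> C) :
  measurable_fun A (fun x => complex.Re (f x)) ->
  measurable_fun A (fun x => complex.Im (f x)) ->
  measurable_fun A (fun x => normc (f x)).
Proof.
move=> m1 m2; rewrite (_ : (fun x => _) = Num.sqrt \o
   (fun x => complex.Re (f x) ^+ 2 + complex.Im (f x) ^+ 2)); last first.
  by apply/funext => x /=; case: (f x).
apply: measurableT_comp.
  by apply: continuous_measurable_fun => ?; exact: sqrt_continuous.
by apply: measurable_funD; exact: measurable_funX.
Qed.

Section truncation.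
Variables (D : nat) (f : rvec R d -> C).
Hypotheses (iRe : mu.-integrable T (fun x => (complex.Re (f x))%:E))
  (iIm : mu.-integrable T (fun x => (complex.Im (f x))%:E)).

(** Measurability of [f] is given on the cube only; extension by zero makes it global. *)
Definition cut x : C :=
  ((fun x => complex.Re (f x)) \_ T) x +i* ((fun x => complex.Im (f x)) \_ T) x.

Lemma cutE x : T x -> cut x = f x.
Proof. by move=> xT; rewrite /cut !patchE mem_set//; case: (f x). Qed.

Lemma measurable_Re_cut : measurable_fun setT (fun x => complex.Re (cut x)).
Proof.
rewrite (_ : (fun x => _) = (fun x => complex.Re (f x)) \_ T)//.
by apply/(measurable_restrictT _ mT); have /measurable_int/measurable_EFinP := iRe.
Qed.

Lemma measurable_Im_cut : measurable_fun setT (fun x => complex.Im (cut x)).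
Proof.
rewrite (_ : (fun x => _) = (fun x => complex.Im (f x)) \_ T)//.
by apply/(measurable_restrictT _ mT); have /measurable_int/measurable_EFinP := iIm.
Qed.

Lemma measurable_normc_cut : measurable_fun setT (fun x => normc (cut x)).
Proof. exact: measurable_normc measurable_Re_cut measurable_Im_cut. Qed.

Local Notation level N := [set x | normc (cut x) < expR N%:R].

Lemma measurable_level N : measurable (level N).
Proof.
rewrite [X in measurable X](_ : _ = (fun x => normc (cut x)) @^-1` `]-oo, expR N%:R[); last first.
  by apply/seteqP; split => x /=; rewrite in_itv.
by rewrite -[X in measurable X]setTI; apply: measurable_normc_cut => //; exact: measurable_itv.
Qed.

Definition trunc N x : C := (\1_(level N.+1) x)%:C * cut x.

(** The modulus of [f] on the shell [e^N <= |f| < e^(N+1)], and 0 elsewhere. *)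
Definition blk N x : R := (\1_(level N.+1) x - \1_(level N) x) * normc (cut x).

Lemma trunc_le N x : normc (trunc N x) <= expR N.+1%:R.
Proof.
rewrite /trunc normcM normcZ indicE; have [xl|xl] := boolP (x \in _).
  by rewrite /= normr1 mul1r ltW//; rewrite inE in xl.
by rewrite /= normr0 mul0r expR_ge0.
Qed.

Lemma bcmeas_trunc N : bcmeas (trunc N).
Proof.
have mI : measurable_fun setT (\1_(level N.+1) : rvec R d -> R).
  by apply: measurable_indic; exact: measurable_level.
split; split.
- under [X in measurable_fun _ X]funext do rewrite ReZ.
  by apply: measurable_funM => //; exact: measurable_Re_cut.
- by exists (expR N.+1%:R) => x; exact: le_trans (ler_normRe _) (trunc_le N x).
- under [X in measurable_fun _ X]funext do rewrite ImZ.
  by apply: measurable_funM => //; exact: measurable_Im_cut.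
- by exists (expR N.+1%:R) => x; exact: le_trans (ler_normIm _) (trunc_le N x).
Qed.

Lemma level_sub N x : level N x -> level N.+1 x.
Proof. by rewrite /= => /lt_le_trans; apply; rewrite ler_expR ler_nat. Qed.

Lemma blk_bounds N x : 0 <= blk N x <= expR N.+1%:R.
Proof.
rewrite /blk !indicE; have [x1|x1] := boolP (x \in level N.+1); last first.
  rewrite [x \in level N]memNset ?subrr ?mul0r ?lexx ?expR_ge0//.
  by move=> /level_sub xl; move: x1; rewrite mem_set.
case: (x \in level N); first by rewrite subrr mul0r lexx expR_ge0.
rewrite mulr1n mulr0n.
have {}x1 : normc (cut x) < expR N.+1%:R by rewrite inE in x1.
move: (normc _) (normc_ge0 (cut x)) x1 => y y0 y1.
by rewrite subr0 mul1r y0 ltW.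
Qed.

Lemma bmeas_blk N : bmeas (blk N).
Proof.
split; last first.
  by exists (expR N.+1%:R) => x; have /andP[? ?] := blk_bounds N x; rewrite ger0_norm.
apply: measurable_funM; last exact: measurable_normc_cut.
by apply: measurable_funB; apply: measurable_indic; exact: measurable_level.
Qed.

Lemma normc_truncS N x : normc (trunc N.+1 x - trunc N x) = blk N.+1 x.
Proof.
rewrite /trunc -mulrBl -rmorphB normcM normcZ /blk ger0_norm// !indicE subr_ge0.
have [xl|xl] := boolP (x \in level N.+1); last by rewrite /= ler0n.
by rewrite [x \in level N.+2]mem_set//; apply: level_sub; rewrite inE in xl.
Qed.

(** At most one shell contributes at a given point, and [ln |f| >= N] there. The indicator on the
    right makes the induction work: while it is 1, later shells vanish. *)
Lemma blk_sum_le n x :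
  \sum_(1 <= N < n.+1) N%:R ^+ D * blk N x <= \1_(level n.+1) x * Logk D (cut x).
Proof.
have L0 : 0 <= Logk D (cut x) by rewrite mulr_ge0 ?normc_ge0// le_max lexx.
elim: n => [|n ih].
  by rewrite big_geq// mulr_ge0// indicE ler0n.
rewrite big_nat_recr//=; move: ih; set S := \sum_(1 <= i < _) _.
rewrite /blk !indicE; have [x1|x1] := boolP (x \in level n.+1).
  rewrite [x \in level n.+2]mem_set; last by apply: level_sub; rewrite inE in x1.
  by rewrite subrr mul0r mulr0 addr0.
rewrite /= mul0r subr0; have [x2|x2] := boolP (x \in level n.+2); last first.
  by rewrite /= mul0r mulr0 addr0 mul0r.
rewrite /= !mul1r => S0.
rewrite -[leRHS]add0r lerD//.
have ge : expR n.+1%:R <= normc (cut x).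
  by rewrite leNgt; apply/negP => h; move: x1; rewrite mem_set.
rewrite mulrC /Logk ler_wpM2l ?normc_ge0// le_max; apply/orP; right.
have : n.+1%:R <= ln (normc (cut x)).
  by rewrite -ler_expR lnK// posrE (lt_le_trans (expR_gt0 _) ge).
by move=> h; apply: lerXn2r; rewrite ?nnegrE ?(le_trans _ h).
Qed.

Lemma measurable_Logk_cut : measurable_fun setT (fun x => Logk D (cut x)).
Proof.
apply: measurable_funM; first exact: measurable_normc_cut.
apply: measurable_maxr => //; apply: measurable_funX.
by apply: measurableT_comp; [exact: measurable_ln|exact: measurable_normc_cut].
Qed.

Lemma blk_integral n : (Logk_int D f <= 1)%E ->
  \sum_(1 <= N < n.+1) N%:R ^+ D * J (blk N) <= 1.
Proof.
move=> fD; have bN N := bmeas_blk N.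
have b1 : bmeas (fun x => \sum_(1 <= N < n.+1) N%:R ^+ D * blk N x).
  by apply: bmeas_sum => N; exact: bmeasZ.
have -> : \sum_(1 <= N < n.+1) N%:R ^+ D * J (blk N) =
    J (fun x => \sum_(1 <= N < n.+1) N%:R ^+ D * blk N x).
  rewrite (bint_sum mT fT); last by move=> N; exact: bmeasZ.
  by apply: eq_bigr => N _; rewrite (bintZ mT fT).
rewrite -lee_fin (bint_EFin mT fT b1); apply: le_trans fD.
apply: ge0_le_integral => //.
- move=> x _; rewrite lee_fin; apply: sumr_ge0 => N _.
  by rewrite mulr_ge0 ?exprn_ge0//; case/andP: (blk_bounds N x).
- by apply/measurable_EFinP; apply: measurable_funTS; case: b1.
- apply/measurable_EFinP; apply: (eq_measurable_fun (fun x => Logk D (cut x))).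
    by move=> x; rewrite inE => xT; rewrite cutE.
  exact: measurable_funTS measurable_Logk_cut.
move=> x xT; rewrite lee_fin (le_trans (blk_sum_le n x))// cutE//.
by rewrite ler_piMl// mulr_ge0 ?normc_ge0// le_max lexx.
Qed.

Let mRe : measurable_fun T (fun x => complex.Re (f x)).
Proof. by have /measurable_int/measurable_EFinP := iRe. Qed.

Let mIm : measurable_fun T (fun x => complex.Im (f x)).
Proof. by have /measurable_int/measurable_EFinP := iIm. Qed.

Lemma measurable_normcB (h : rvec R d -> C) : bcmeas h ->
  measurable_fun T (fun x => normc (f x - h x)).
Proof.
move=> [[m1 _] [m2 _]]; apply: measurable_normc.
  under [X in measurable_fun _ X]funext do rewrite ReB.
  by apply: measurable_funB => //; exact: measurable_funTS.
have -> : (fun x => complex.Im (f x - h x)) = (fun x => complex.Im (f x) - complex.Im (h x)).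
  by apply/funext => x; case: (f x) (h x) => a b [].
by apply: measurable_funB => //; exact: measurable_funTS.
Qed.

Lemma integrable_normc : mu.-integrable T (fun x => (normc (f x))%:E).
Proof.
have mn : measurable_fun T (fun x => normc (f x)) by exact: measurable_normc.
have i1 := integrable_norm iRe; have i2 := integrable_norm iIm.
apply: (le_integrable mT _ _ (integrableD mT i1 i2)).
  exact/measurable_EFinP.
move=> x _ /=; rewrite lee_fin ger0_norm ?normc_ge0//.
by rewrite [leRHS]ger0_norm ?addr_ge0// normc_le_ReIm.
Qed.

Lemma trunc_cvg :
  (\int[mu]_(x in T) (normc (f x - trunc n x))%:E)%E @[n --> \oo] --> 0%E.
Proof.
have [] := @dominated_convergence _ _ _ mu T mT
   (fun n x => (normc (f x - trunc n x))%:E) (fun=> 0%E) (fun x => (normc (f x))%:E).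
- by move=> n; apply/measurable_EFinP; apply: measurable_normcB; exact: bcmeas_trunc.
- exact: measurable_cst.
- apply/aeW => x xT; apply: cvg_near_cst; near=> n; congr EFin.
  have xn : normc (cut x) < expR n.+1%:R.
    rewrite cutE// (lt_le_trans _ (expR_ge1Dx _))// ltr_pwDl//.
    rewrite (@le_trans _ _ n%:R)// ?ler_nat//; near: n; exact: nbhs_infty_ger.
  by rewrite /trunc cutE// indicE mem_set// mul1r subrr normc0.
- exact: integrable_normc.
- apply/aeW => x n xT /=; rewrite lee_fin ger0_norm ?normc_ge0//.
  rewrite /trunc cutE// indicE; case: (_ \in _).
    by rewrite mul1r subrr normc0 normc_ge0.
  by rewrite mul0r subr0.
by move=> _ _; rewrite integral0.
Unshelve. all: by end_near. Qed.

End truncation.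

(** [q N] approximates the truncation of [f] at height [e^(N+1)], so an increment is dominated by
    one shell plus an approximation error. Paired with a bounded [g], the projection moves onto [g];
    the shell is then paid for by [test_block], the error by [test_error]. *)
Theorem block_polynomials (D : nat) : exists K : R, 0 < K /\
  forall f : rvec R d -> C,
    mu.-integrable T (fun x => (complex.Re (f x))%:E) ->
    mu.-integrable T (fun x => (complex.Im (f x))%:E) ->
    (Logk_int D f <= 1)%E ->
  exists q : nat -> @tpoly R d,
    (forall L n, (forall h, h \in L -> primitive h.1) -> (size L <= D)%N ->
      \sum_(0 <= j < n.+1) J (fun x => normc (teval (thalfs L (tdiff q j)) x)) <= K) /\
    (\int[mu]_(x in T) (normc (f x - teval (q n) x))%:E)%E @[n --> \oo] --> 0%E.
Proof.
pose W : R := 4 * 104 ^+ (2 * D) * V.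
pose c1 : R := 8 * 104 ^+ D.
pose c2 : R := 32 * 104 ^+ D * V * (2 * D%:R) ^+ D + (18 + W).
pose c0 : R := 16 * V + W + (1 + W).
have V0 : 0 <= V by exact: fine_ge0.
have W0 : 0 <= W by rewrite !mulr_ge0// exprn_ge0.
have c10 : 0 <= c1 by rewrite mulr_ge0// exprn_ge0.
have c20 : 0 <= c2.
  by rewrite addr_ge0// ?addr_ge0// !mulr_ge0// exprn_ge0// mulr_ge0.
exists (c0 + c1 + c2); split.
  by rewrite ltr_wpDr// ltr_wpDr// /c0 ltr_wpDl ?addr_ge0 ?mulr_ge0// ltr_wpDr.
move=> f iRe iIm fD.
have bt N := bcmeas_trunc iRe iIm N.
(* With weight [2^N] in [test_error], a squared error of order [8^-N] leaves terms of order [4^-N]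
   and [2^-N], both summable. *)
have /choice[q hq] : forall N, exists q,
    J (fun x => normc (trunc f N x - teval q x) ^+ 2) <= 8^-1 ^+ N.
  by move=> N; apply: L2_function_approx => //; rewrite exprn_gt0// invr_gt0.
pose y N x := normc (trunc f N x - teval (q N) x).
have by_ N : bmeas (y N) by apply: bcmeas_normc; apply: bcmeasB => //; exact: bcmeas_teval.
pose main N x := if N is M.+1 then blk f N x else normc (trunc f 0 x).
pose err N x := if N is M.+1 then y N x + y M x else y 0%N x.
have bmain N : bmeas (main N).
  by case: N => [|N]; [exact: bcmeas_normc|exact: bmeas_blk].
have berr N : bmeas (err N) by case: N => [|N]; [exact: by_|exact: (bmeasD (by_ N.+1) (by_ N))].
have err0 N x : 0 <= err N x.
  by case: N => [|N]; rewrite /err /y ?addr_ge0// normc_ge0.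
have main0 N x : 0 <= main N x.
  by case: N => [|N]; [exact: normc_ge0|case/andP: (blk_bounds f N.+1 x)].
have tdiff_le N x : normc (teval (tdiff q N) x) <= main N x + err N x.
  case: N => [|N] /=.
    have -> : teval (q 0%N) x = trunc f 0 x - (trunc f 0 x - teval (q 0%N) x) by ring.
    by rewrite (le_trans (le_normcD _ _))// normcN.
  rewrite -(normc_truncS f N x) teval_cat teval_scale.
  have -> : teval (q N.+1) x + -1 * teval (q N) x =
     (trunc f N.+1 x - trunc f N x) +
     (- (trunc f N.+1 x - teval (q N.+1) x) + (trunc f N x - teval (q N) x)) by ring.
  rewrite (le_trans (le_normcD _ _))// lerD2l (le_trans (le_normcD _ _))//.
  by rewrite normcN.
have errN N : J (fun x => err N.+1 x ^+ 2) <= 18 * 8^-1 ^+ N.+1.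
  have h1 := hq N.+1; have h2 := hq N.
  have b1 := bmeasX 2 (by_ N.+1); have b2 := bmeasX 2 (by_ N).
  apply: (@le_trans _ _ (J (fun x => 2 * y N.+1 x ^+ 2 + 2 * y N x ^+ 2))).
    apply: (bint_le mT fT (bmeasX 2 (berr N.+1)) (bmeasD (bmeasZ _ b1) (bmeasZ _ b2))) => x _.
    exact: sqr_add_le.
  rewrite (bintD mT fT (bmeasZ _ b1) (bmeasZ _ b2)) (bintZ mT fT _ b1) (bintZ mT fT _ b2).
  by rewrite exprS in h1 *; exact: geometric_add_le.
exists q; split.
  move=> L n Lprim LD.
  pose B N := if N is M.+1 then c1 * (N%:R ^+ D * J (blk f N)) + c2 * 2^-1 ^+ N else c0.
  have key N : J (fun x => normc (teval (thalfs L (tdiff q N)) x)) <= B N.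
    apply: normc_dual => g g2.
    rewrite (bint_tmult_adj (halfs L)) -/(thalfs L g).
    pose b x := normc (teval (thalfs L g) x).
    have bb : bmeas b by exact/bcmeas_normc/bcmeas_teval.
    have bm := bmeasM (bmain N) bb; have be := bmeasM (berr N) bb.
    apply: (@le_trans _ _ (J (fun x => main N x * b x + err N x * b x))).
      apply: (bint_le mT fT _ (bmeasD bm be)) => [|x _].
        by have [] := bcmeasM (bcmeas_teval (tdiff q N)) (bcmeas_conj (bcmeas_teval (thalfs L g))).
      rewrite (le_trans (ler_norm _))// (le_trans (ler_normRe _))// normcM normc_conj.
      by rewrite -mulrDl ler_wpM2r ?normc_ge0.
    rewrite (bintD mT fT bm be).
    have eE : (fun x => err N x * b x) = (fun x => `|err N x| * b x).
      by apply/funext => x; rewrite ger0_norm.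
    rewrite eE; case: N bm be eE => [|N] bm be eE.
      rewrite /B /c0 lerD//.
        have -> : (fun x => main 0 x * b x) = (fun x => `|main 0 x| * b x).
          by apply/funext => x; rewrite ger0_norm// normc_ge0.
        apply: (le_trans (test_error Lprim LD g2 (bmain 0%N) ltr01)).
        rewrite invr1 !mul1r lerD2r -(bint_cst mu mT).
        apply: (bint_le mT fT (bmeasX 2 (bmain 0%N)) (bmeas_cst _)) => x _.
        have h : main 0 x <= 4 := le_trans (trunc_le f 0 x) expR1_le4.
        rewrite (_ : 16 = 4 ^+ 2 :> R); last by rewrite -natrX.
        by apply: (lerXn2r _ _ _ h); rewrite nnegrE// main0.
      apply: (le_trans (test_error Lprim LD g2 (berr 0%N) ltr01)).
      rewrite invr1 !mul1r lerD2r; apply: le_trans (hq 0%N) _.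
      by rewrite expr0.
    have N0 : (0 < N.+1)%N by [].
    have h4 x : 0 <= main N.+1 x <= 4 ^+ N.+2.
      have /andP[h0 h1] := blk_bounds f N.+1 x; rewrite h0 /= (le_trans h1)//.
      rewrite -[X in expR X]mulr1 expRM_natl lerXn2r// ?nnegrE ?expR_ge0//.
      exact: expR1_le4.
    rewrite /B /c2 mulrDl addrA lerD//.
      exact: (test_block Lprim LD g2 N0 (bmain N.+1) h4).
    have t0 : 0 < 2 ^+ N.+1 :> R by rewrite exprn_gt0.
    apply: (le_trans (test_error Lprim LD g2 (berr N.+1) t0)).
    rewrite -/W -exprVn mulrDl lerD//; last by rewrite mulrC.
    apply: (le_trans (ler_wpM2l (ltW t0) (errN N))).
    rewrite mulrCA ler_wpM2l// -exprMn two_eighths.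
    exact: quarter_le_half.
  apply: (@le_trans _ _ (\sum_(0 <= j < n.+1) B j)); first exact: ler_sum.
  rewrite big_nat_recl//= -[leRHS]addrA lerD2l.
  have -> : \sum_(0 <= i < n) (c1 * (i.+1%:R ^+ D * J (blk f i.+1)) + c2 * 2^-1 ^+ i.+1) =
     c1 * \sum_(1 <= N < n.+1) N%:R ^+ D * J (blk f N) + c2 * \sum_(0 <= i < n) 2^-1 ^+ i.+1.
    by rewrite big_split/= -!mulr_sumr big_add1.
  rewrite lerD//.
    by rewrite ler_piMr// (blk_integral iRe iIm).
  rewrite ler_piMr//.
  have -> : \sum_(0 <= i < n) 2^-1 ^+ i.+1 = 1 - 2^-1 ^+ n :> R.
    elim: n => [|n ih]; first by rewrite big_geq// expr0 subrr.
    by rewrite big_nat_recr//= ih exprS; field.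
  by rewrite gerBl exprn_ge0.
have gn n : (0 <= \int[mu]_(x in T) (normc (f x - teval (q n) x))%:E <=
   \int[mu]_(x in T) (normc (f x - trunc f n x))%:E + ((V + 1) * 2^-1 ^+ n)%:E)%E.
  rewrite integral_ge0//=; last by move=> x _; rewrite lee_fin normc_ge0.
  have m1 := measurable_normcB iRe iIm (bt n).
  have m2 : measurable_fun T (y n) by apply: measurable_funTS; case: (by_ n).
  apply: (@le_trans _ _ (\int[mu]_(x in T) ((normc (f x - trunc f n x))%:E + (y n x)%:E))%E).
    apply: ge0_le_integral => //.
    - by move=> x _; rewrite lee_fin normc_ge0.
    - by apply/measurable_EFinP; apply: (measurable_normcB iRe iIm); exact: bcmeas_teval.
    - by apply: emeasurable_funD; exact/measurable_EFinP.
    move=> x _; rewrite -EFinD lee_fin.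
    have -> : f x - teval (q n) x = (f x - trunc f n x) + (trunc f n x - teval (q n) x) by ring.
    exact: le_normcD.
  rewrite ge0_integralD//; last 4 first.
  - by move=> x _; rewrite lee_fin normc_ge0.
  - exact/measurable_EFinP.
  - by move=> x _; rewrite lee_fin normc_ge0.
  - exact/measurable_EFinP.
  rewrite leeD2l// -(bint_EFin mT fT (by_ n)) lee_fin.
  have b2 := bmeasX 2 (by_ n).
  apply: (@le_trans _ _ (J (fun x => 2^-1 ^+ n + 2 ^+ n * y n x ^+ 2))).
    apply: (bint_le mT fT (by_ n) (bmeasD (bmeas_cst _) (bmeasZ _ b2))) => x _.
    have t0 : 0 < 2 ^+ n :> R by rewrite exprn_gt0.
    by rewrite exprVn young_le// normc_ge0.
  rewrite (bintD mT fT (bmeas_cst _) (bmeasZ _ b2)) (bintZ mT fT _ b2) (bint_cst mu mT).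
  rewrite mulrDl mul1r mulrC lerD2l.
  have t0 : 0 <= 2 ^+ n :> R by rewrite exprn_ge0.
  apply: (le_trans (ler_wpM2l t0 (hq n))).
  rewrite -exprMn two_eighths.
  exact: quarter_le_half.
apply: (@squeeze_cvge _ _ _ _ (fun=> 0%E) _
  (fun n => (\int[mu]_(x in T) (normc (f x - trunc f n x))%:E + ((V + 1) * 2^-1 ^+ n)%:E)%E)).
- by apply: nearW => n; exact: gn.
- exact: cvg_cst.
rewrite -[X in _ --> X]adde0; apply: cvgeD => //; first exact: trunc_cvg.
apply: cvg_EFin; first by near=> n.
rewrite /comp /= -[X in _ --> X](mulr0 (V + 1)); apply: cvgM; first exact: cvg_cst.
by apply: cvg_expr; rewrite ger0_norm; lra.
Unshelve. all: by end_near. Qed.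

End blocks.

(** * Functionals with uniform exponential bounds off a small set *)

Section tame_functionals.
Local Open Scope complex_scope.
Context {R : realType} {d : nat}.
Local Notation C := R[i].
Local Notation mu := (@lebesgue_rvec R d).
Local Notation T := (torus_cube d : set (rvec R d)).
Local Notation J f := (Rintegral mu T f).
Local Notation V := (fine (mu T)).
Implicit Types (k v w : freq d) (x : rvec R d) (p : @tpoly R d).

Let mT : measurable T := @cube_measurable R d.
Let fT : (mu T < +oo)%E := @cube_fin R d.
Let V0 : 0 <= V. Proof. exact: fine_ge0. Qed.

Lemma sigma_mono w (G G' : rvec R d -> R) lam x : bmeas G -> bmeas G' ->
  (forall y, 0 <= G y <= G' y) -> 0 < lam -> sigma w G lam x <= sigma w G' lam x.
Proof.
move=> bG bG' GG' lam0.
have G0 y : 0 <= G y by case/andP: (GG' y).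
have G0' y : 0 <= G' y by case/andP: (GG' y) => ?; exact: le_trans.
apply: (sigma_le bG G0 lam0) => j m.
apply: le_trans (sval_le_sigma w bG' G0' lam0 j m x).
rewrite /sval lerD2r ler_pM2r ?invr_gt0// /favg /favg_on.
apply: (bint_le (measurable_sym_itv _) (sym_itv_fin _) (bmeas_fiber w x bG) (bmeas_fiber w x bG')).
by move=> t _; case/andP: (GG' (flow w t x)).
Qed.

Section fixed_bound.
Variables (D : nat) (K : R).
Hypothesis K0 : 0 < K.

Definition block_bounded (q : nat -> @tpoly R d) := forall L n,
  (forall h, h \in L -> primitive h.1) -> (size L <= D)%N ->
  \sum_(0 <= j < n.+1) J (fun x => normc (teval (thalfs L (tdiff q j)) x)) <= K.

(* The exceptional set may depend on [q], but not on [n] or on the index [N]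
   of the approximating polynomial [q N]. *)
Definition tame (Phi : nat -> @tpoly R d -> rvec R d -> R) := exists A B : R,
  [/\ 0 < A, 0 < B & forall q, block_bounded q -> forall eps, 0 < eps ->
    exists E : set (rvec R d), [/\ measurable E, E `<=` T, (mu (T `\` E) <= eps%:E)%E &
      forall n N, J (fun x => \1_E x * expR (A * eps * Phi n (q N) x)) <= B]].

(** For [lam = 4 K / eps] the weak-type bound is [4 J (G N) / lam <= eps] for every [N]. The
    exceptional sets increase with [N], as the majorants [G N] do, so their union still has measure
    at most [eps]. *)
Lemma tame_half_space v L (c : nat -> int) : primitive v ->
  (forall h, h \in L -> primitive h.1) -> (size L <= D)%N ->
  tame (fun n p x => normc (teval (thalf v (c n) (thalfs L p)) x)).
Proof.
move=> [a av] Lprim LD.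
have pc0 : 0 < poisson_cst :> R by rewrite (lt_le_trans ltr01) ?poisson_cst_ge1.
exists (208 * (poisson_cst * (4 * K)))^-1, (17 * V + 1); split.
- by rewrite invr_gt0; apply: mulr_gt0 => //; apply: mulr_gt0 => //; exact: mulr_gt0.
- by rewrite ltr_wpDl// mulr_ge0.
move=> q qK eps eps0; pose lam := 4 * K / eps.
have lam0 : 0 < lam by rewrite divr_gt0// mulr_gt0.
pose G N x : R := \sum_(0 <= j < N.+1) normc (teval (thalfs L (tdiff q j)) x).
have bj j : bmeas (fun x => normc (teval (thalfs L (tdiff q j)) x)).
  exact/bcmeas_normc/bcmeas_teval.
have bG N : bmeas (G N) by exact: bmeas_sum.
have G0 N x : 0 <= G N x by apply: sumr_ge0 => j _; exact: normc_ge0.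
have Gper N j x : G N (shift2pi j x) = G N x.
  by apply: eq_bigr => i _; rewrite teval_shift2pi.
have GK N : J (G N) <= K by rewrite (bint_sum mT fT)//; exact: qK.
have Gmono N x : G N x <= G N.+1 x.
  by rewrite /G [leRHS]big_nat_recr//= lerDl normc_ge0.
pose F N := [set x | 0 < sigma (- v) (G N) lam x] `&` T.
have mF N : measurable (F N).
  apply: measurableI => //.
  rewrite [X in measurable X](_ : _ = sigma (- v) (G N) lam @^-1` `]0, +oo[); last first.
    by apply/seteqP; split => x /=; rewrite in_itv/= andbT.
  have [ms _] := bmeas_sigma (- v) (bG N) (G0 N) lam0.
  by rewrite -[X in measurable X]setTI; apply: ms => //; exact: measurable_itv.
have muF N : (mu (F N) <= eps%:E)%E.
  apply: (le_trans (weak_type_sigma (bG N) (G0 N) (Gper N) (- v) lam0)).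
  rewrite lee_fin ler_pdivrMr// /lam mulrCA divff ?gt_eqF// mulr1.
  by rewrite ler_pM2l.
have Fnd : nondecreasing_seq F.
  apply/nondecreasing_seqP => N; apply/subsetPset => x [/= s0 xT]; split => //=.
  apply: (lt_le_trans s0); apply: sigma_mono => // y.
  by rewrite G0 Gmono.
have mU : measurable (\bigcup_N F N) by exact: bigcup_measurable.
have cv := @nondecreasing_cvg_mu _ _ _ mu F mF mU Fnd.
have muU : (mu (\bigcup_N F N) <= eps%:E)%E.
  rewrite -(cvg_lim _ cv)//; apply: lime_le; first by apply/cvg_ex; eexists; exact: cv.
  by apply: nearW => N; exact: muF.
exists (T `\` \bigcup_N F N); split.
- exact: measurableD.
- by move=> x [].
- apply: le_trans muU; apply: le_measure; rewrite ?inE//.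
    by apply: measurableD => //; exact: measurableD.
  by move=> x [xT /= nE]; apply: contrapT => nU; apply: nE.
move=> n N; set E := T `\` _.
have calmE : E `<=` calm (- v) (G N) lam.
  move=> x [xT nU]; apply/eqP; rewrite eq_le (sigma_ge0 (- v) (bG N) (G0 N) lam0) andbT.
  by rewrite leNgt; apply/negP => s0; apply: nU; exists N.
have qG y : normc (teval (thalfs L (q N)) y) <= G N y.
  by rewrite thalfs_telescope normc_sum.
have mC : measurable (calm (- v) (G N) lam) by exact: measurable_calm.
have mE : measurable E by exact: measurableD.
have := half_space_exp (c n) av (bG N) (G0 N) (Gper N) lam0 qG.
have e0 : (208 * (poisson_cst * (4 * K)))^-1 * eps = (208 * (poisson_cst * lam))^-1.
  rewrite /lam; have := gt_eqF eps0; have := gt_eqF pc0; have := gt_eqF K0.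
  move=> /negbT Kn /negbT pn /negbT en; field.
  by rewrite Kn pn en.
set y := fun x => normc (teval (thalf v (c n) (thalfs L (q N))) x).
have by_ : bmeas y by exact/bcmeas_normc/bcmeas_teval.
rewrite e0 => h; apply: (@le_trans _ _ (17 * V)); last by rewrite lerDl.
apply: le_trans h.
have be : bmeas (fun x => expR (y x / (208 * (poisson_cst * lam)))).
  apply: bmeas_exp; under [X in bmeas X]funext do rewrite mulrC.
  exact: bmeasZ.
have -> : (fun x => \1_E x * expR ((208 * (poisson_cst * lam))^-1 * y x)) =
    (fun x => \1_E x * expR (y x / (208 * (poisson_cst * lam)))).
  by apply/funext => x; rewrite [X in expR X]mulrC.
apply: (bint_le mT fT (bmeasM (bmeas_indic mE) be) (bmeasM (bmeas_indic mC) be)) => x _.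
rewrite ler_wpM2r ?expR_ge0// !indicE.
have [xE|xE] := boolP (x \in E); last by rewrite ler0n.
by rewrite [x \in calm _ _ _]mem_set//; apply: calmE; rewrite inE in xE.
Qed.

(** Since [c (y1 + y2) <= 2 c max(y1, y2)], one exponential is at most the sum of two. In [4 * c]
    one factor 2 comes from the maximum, the other from spending [eps / 2] on each exceptional
    set. *)
Lemma tame_add (c : R) Phi1 Phi2 Phi : 0 < c -> tame Phi1 -> tame Phi2 ->
  (forall n p, bmeas (Phi1 n p)) -> (forall n p, bmeas (Phi2 n p)) ->
  (forall n p, bmeas (Phi n p)) ->
  (forall n p x, 0 <= Phi1 n p x) -> (forall n p x, 0 <= Phi2 n p x) ->
  (forall n p x, Phi n p x <= c * (Phi1 n p x + Phi2 n p x)) -> tame Phi.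
Proof.
move=> c0 [A1 [B1 [A10 B10 h1]]] [A2 [B2 [A20 B20 h2]]] b1 b2 b ge1 ge2 le.
pose A := Num.min A1 A2.
have A0 : 0 < A by rewrite lt_min A10.
exists (A / (4 * c)), (B1 + B2); split.
- by rewrite divr_gt0// mulr_gt0.
- exact: addr_gt0.
move=> q qK eps eps0; have e2 : 0 < eps / 2 by rewrite divr_gt0.
have [E1 [mE1 E1T muE1 hE1]] := h1 q qK _ e2.
have [E2 [mE2 E2T muE2 hE2]] := h2 q qK _ e2.
have mE := measurableI _ _ mE1 mE2.
exists (E1 `&` E2); split => //.
- by move=> x [/E1T].
- have -> : eps%:E = ((eps / 2)%:E + (eps / 2)%:E)%E by rewrite -EFinD -splitr.
  apply: le_trans (leeD muE1 muE2).
  rewrite setDIr; apply: measureU2; exact: measurableD.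
move=> n N; move: (hE1 n N) (hE2 n N).
set y1 := Phi1 n (q N); set y2 := Phi2 n (q N); set y := Phi n (q N) => {}hE1 {}hE2.
have bx (t : R) (z : rvec R d -> R) : bmeas z -> bmeas (fun x => expR (t * z x)).
  by move=> bz; apply: bmeas_exp; exact: bmeasZ.
have bb1 : bmeas (fun x => \1_E1 x * expR (A1 * (eps / 2) * y1 x)).
  by apply: bmeasM; [exact: bmeas_indic|exact/bx/b1].
have bb2 : bmeas (fun x => \1_E2 x * expR (A2 * (eps / 2) * y2 x)).
  by apply: bmeasM; [exact: bmeas_indic|exact/bx/b2].
apply: le_trans (lerD hE1 hE2); rewrite -(bintD mT fT bb1 bb2).
have bb : bmeas (fun x => \1_(E1 `&` E2) x * expR (A / (4 * c) * eps * y x)).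
  by apply: bmeasM; [exact: bmeas_indic|exact/bx/b].
apply: (bint_le mT fT bb (bmeasD bb1 bb2)) => x _.
rewrite indicI /= !indicE; have [x1|x1] := boolP (x \in E1); last first.
  by rewrite mul0r mul0r addr_ge0// mulr_ge0 ?expR_ge0.
have [x2|x2] := boolP (x \in E2); last first.
  by rewrite mulr0 mul0r addr_ge0// mulr_ge0 ?expR_ge0.
rewrite /= mulr1n !mul1r.
have key (t z : R) : A <= t -> 0 <= z -> y x <= c * (2 * z) ->
    A / (4 * c) * eps * y x <= t * (eps / 2) * z.
  move=> At z0 yz.
  have : A / (4 * c) * eps * y x <= A / (4 * c) * eps * (c * (2 * z)).
    by rewrite ler_wpM2l// mulr_ge0 ?divr_ge0 ?mulr_ge0// ltW.
  move=> /le_trans; apply.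
  have -> : A / (4 * c) * eps * (c * (2 * z)) = A * (eps / 2 * z).
    by field; rewrite gt_eqF.
  by rewrite -[leRHS]mulrA ler_wpM2r// mulr_ge0// ltW.
have A1A : A <= A1 by rewrite ge_min lexx.
have A2A : A <= A2 by rewrite ge_min lexx orbT.
have yle := le n (q N) x; have y10 := ge1 n (q N) x; have y20 := ge2 n (q N) x.
rewrite -/(y1 x) -/(y2 x) -/(y x) in yle y10 y20.
have [y12|y12] := leP (y1 x) (y2 x).
  rewrite (le_trans _ (_ : expR (A2 * (eps / 2) * y2 x) <= _))// ?lerDr ?expR_ge0//.
  rewrite ler_expR; apply: key => //; apply: (le_trans yle).
  by rewrite ler_pM2l// mulr_natl mulr2n lerD2r.
rewrite (le_trans _ (_ : expR (A1 * (eps / 2) * y1 x) <= _))// ?lerDl ?expR_ge0//.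
rewrite ler_expR; apply: key => //; apply: (le_trans yle).
by rewrite ler_pM2l// mulr_natl mulr2n lerD2l ltW.
Qed.

End fixed_bound.
End tame_functionals.

(** * The cube as a combination of half-spaces with one moving *)

Section cube_multipliers.
Local Open Scope complex_scope.
Context {R : realType} {d : nat}.
Local Notation C := R[i].
Implicit Types (k v : freq d) (x : rvec R d) (p : @tpoly R d) (s : seq 'I_d).

(** With both signs available, each of [- n <= k_i] and [k_i <= n] has the form
    [fdot k (axis b i) <= n]. *)
Definition axis (b : bool) (i : 'I_d) : freq d :=
  [ffun j => if j == i then if b then 1 else -1 else 0].

Lemma fdot_axis k b i : fdot k (axis b i) = if b then k i else - k i.
Proof.
rewrite /fdot (bigD1 i)//= big1; last by move=> j /negbTE ji; rewrite ffunE ji mulr0.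
by rewrite addr0 ffunE eqxx; case: b; rewrite ?mulr1 ?mulrN1.
Qed.

Lemma axis_self b i : axis b i i = if b then 1 else -1.
Proof. by rewrite ffunE eqxx. Qed.

Lemma primitive_axis b i : primitive (axis b i).
Proof. by exists (axis b i); rewrite fdot_axis axis_self; case: b. Qed.

Lemma primitive_axisB b b' i j : i != j -> primitive (axis b i - axis b' j).
Proof.
move=> ij; exists (axis b i); rewrite fdotDr fdotNr !fdot_axis axis_self.
by rewrite ffunE eq_sym (negbTE ij); case: b; case: b'.
Qed.

Definition all_primitive (L : seq (freq d * int)) :=
  forall h, h \in L -> primitive h.1.

Lemma all_primitive_cons v c L : primitive v -> all_primitive L ->
  all_primitive ((v, c) :: L).
Proof. by move=> pv pL h; rewrite inE => /orP[/eqP ->//|]; exact: pL. Qed.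

Lemma halfs_cons v c L k : halfs ((v, c) :: L) k = hspace v c k * halfs L k :> R.
Proof. by rewrite /halfs big_cons. Qed.

(* The span of products of half-space indicators in which at most one
   half-space moves with [n]; the number of fixed ones is bounded by the number
   of coordinates in [s], and by one less if there is a moving one. *)
Inductive multi s : (nat -> freq d -> R) -> Prop :=
| multi_moving i b L of i \in s & all_primitive L & (size L < size s)%N :
    multi s (fun n k => hspace (axis b i) n%:Z k * halfs L k)
| multi_fixed L of all_primitive L & (size L <= size s)%N :
    multi s (fun=> halfs L)
| multi_add m1 m2 of multi s m1 & multi s m2 :
    multi s (fun n k => m1 n k + m2 n k)
| multi_scale c m of multi s m : multi s (fun n k => c * m n k)
| multi_ext m m' of multi s m & (forall n k, m n k = m' n k) : multi s m'.

Lemma multi_cons j s m : multi s m -> multi (j :: s) m.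
Proof.
elim=> {m} [i b L si pL sL|L pL sL|m1 m2 _ h1 _ h2|c m _ h|m m' _ h e].
- by apply: multi_moving => //; [rewrite inE si orbT|exact: ltnW].
- by apply: multi_fixed => //; exact: leqW.
- exact: multi_add.
- exact: multi_scale.
- exact: multi_ext h e.
Qed.

Lemma multi_mul_fixed j s m v c : primitive v -> multi s m ->
  multi (j :: s) (fun n k => m n k * hspace v c k).
Proof.
move=> pv; elim=> {m} [i b L si pL sL|L pL sL|m1 m2 _ h1 _ h2|a m _ h|m m' _ h e].
- apply: (@multi_ext _ (fun n k => hspace (axis b i) n%:Z k * halfs ((v, c) :: L) k)).
    by apply: multi_moving => //; [rewrite inE si orbT|exact: all_primitive_cons].
  by move=> n k; rewrite halfs_cons; ring.
- apply: (@multi_ext _ (fun=> halfs ((v, c) :: L))).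
    by apply: multi_fixed => //; exact: all_primitive_cons.
  by move=> n k; rewrite halfs_cons mulrC.
- by apply: (multi_ext (multi_add h1 h2)) => n k; rewrite mulrDl.
- by apply: (multi_ext (multi_scale a h)) => n k; rewrite mulrA.
- by apply: (multi_ext h) => n k; rewrite e.
Qed.

(** The larger of [a] and [b] decides. The strict inequality [a < b] is written [a - b <= -1], so
    that it too is a half-space. *)
Lemma moving_product (a b n : int) :
  ((a <= n)%R)%:R * ((b <= n)%R)%:R =
  ((a <= n)%R)%:R * ((b - a <= 0)%R)%:R + ((b <= n)%R)%:R * ((a - b <= -1)%R)%:R :> R.
Proof.
have -> : (a - b <= -1) = ~~ (b - a <= 0) by lia.
have [ba|ba] /= := boolP (b - a <= 0); rewrite ?mulr1 ?mulr0 ?addr0 ?add0r.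
  have [an|_] := boolP (a <= n); last by rewrite mul0r.
  rewrite mul1r; by have -> : (b <= n) = true by lia.
have [bn|_] := boolP (b <= n); last by rewrite mulr0.
rewrite mulr1; by have -> : (a <= n) = true by lia.
Qed.

(** A second moving half-space is traded for a fixed one whose normal is a difference of two axes.
    As [j] is new, the axes are distinct and the difference is primitive; for one axis with opposite
    signs it would be twice a unit vector. *)
Lemma multi_mul_moving j b s m : j \notin s -> multi s m ->
  multi (j :: s) (fun n k => m n k * hspace (axis b j) n%:Z k).
Proof.
move=> js; elim=> {m} [i b' L si pL sL|L pL sL|m1 m2 _ h1 _ h2|a m _ h|m m' _ h e].
- have ij : i != j by apply: contraNneq js => <-.
  pose L1 := (axis b j - axis b' i, 0 : int) :: L.
  pose L2 := (axis b' i - axis b j, -1 : int) :: L.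
  apply: (@multi_ext _ (fun n k => hspace (axis b' i) n%:Z k * halfs L1 k +
      hspace (axis b j) n%:Z k * halfs L2 k)).
    apply: multi_add; apply: multi_moving => //.
    + by rewrite inE si orbT.
    + by apply: all_primitive_cons => //; apply: primitive_axisB; rewrite eq_sym.
    + exact: mem_head.
    + by apply: all_primitive_cons => //; exact: primitive_axisB.
  move=> n k; rewrite !halfs_cons /hspace !fdotDr !fdotNr.
  rewrite !mulrA -mulrDl [RHS]mulrC -moving_product; ring.
- apply: (@multi_ext _ (fun n k => hspace (axis b j) n%:Z k * halfs L k)).
    by apply: multi_moving => //; exact: mem_head.
  by move=> n k; rewrite mulrC.
- by apply: (multi_ext (multi_add h1 h2)) => n k; rewrite mulrDl.
- by apply: (multi_ext (multi_scale a h)) => n k; rewrite mulrA.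
- by apply: (multi_ext h) => n k; rewrite e.
Qed.

Definition slab (n : nat) (z : int) : R := ((- n%:Z <= z <= n%:Z)%R)%:R.

(** At least one of the two one-sided conditions always holds, so the product of their indicators is
    their sum minus 1. *)
Lemma slabE n z :
  slab n z = ((z <= n%:Z)%R)%:R + ((- z <= n%:Z)%R)%:R - 1.
Proof.
rewrite /slab; have -> : (- n%:Z <= z <= n%:Z) = (z <= n%:Z) && (- z <= n%:Z) by lia.
have [h1|h1] := boolP (z <= n%:Z); last first.
  have -> : (- z <= n%:Z) = true by lia.
  by rewrite /= add0r subrr.
by case: (- z <= n%:Z) => /=; ring.
Qed.

(** The bracket is [sgn z]; the difference of the moving indicators is [- sgn z] outside the slab
    and 0 inside. *)
Lemma sgz_slabE n z : (sgz z)%:~R * slab n z =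
  ((z <= n%:Z)%R)%:R - ((- z <= n%:Z)%R)%:R +
  (1 - ((z <= 0)%R)%:R - ((z <= -1)%R)%:R).
Proof.
rewrite slabE; case: sgzP => z0.
- have -> : (z <= -1) = false by lia.
  have -> : (z <= n%:Z) = true by lia.
  have -> : (- z <= n%:Z) = true by lia.
  by rewrite mulr0z /=; ring.
- have -> : (z <= -1) = false by lia.
  have -> : (- z <= n%:Z) = true by lia.
  by rewrite /=; ring.
- have -> : (z <= -1) = true by lia.
  have -> : (z <= n%:Z) = true by lia.
  by rewrite mulrN1z /=; ring.
Qed.

Lemma multi_slabs (conj : bool) s : uniq s -> multi s (fun n k =>
  \prod_(j <- s) ((if conj then (sgz (k j))%:~R else 1) * slab n (k j))).
Proof.
elim: s => [_|j s ih /= /andP[js us]].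
  apply: (@multi_ext _ (fun=> halfs [::])); first by apply: multi_fixed.
  by move=> n k; rewrite /halfs !big_nil.
move: {ih us}(ih us); set m := (fun n k => _) => hm.
have h1 b := multi_mul_moving b js hm.
have h2 := multi_cons j hm.
have h3 c := multi_mul_fixed j c (primitive_axis true j) hm.
case: conj @m hm h1 h2 h3 => m hm h1 h2 h3.
  apply: (multi_ext (multi_add (multi_add (h1 true) (multi_scale (-1) (h1 false)))
    (multi_add h2 (multi_add (multi_scale (-1) (h3 0)) (multi_scale (-1) (h3 (-1))))))) => n k.
  by rewrite big_cons sgz_slabE /hspace !fdot_axis -/(m n k); ring.
apply: (multi_ext (multi_add (multi_add (h1 true) (h1 false)) (multi_scale (-1) h2))) => n k.
by rewrite big_cons mul1r slabE /hspace !fdot_axis -/(m n k); ring.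
Qed.

Section tame_multipliers.
Variables (D : nat) (K : R).
Hypothesis K0 : 0 < K.

Let bt (m : freq d -> C) p : bmeas (fun x => normc (teval (tmult m p) x)).
Proof. exact/bcmeas_normc/bcmeas_teval. Qed.

Lemma multi_tame (i0 : 'I_d) s m : multi s m -> (size s <= D.+1)%N ->
  tame D K (fun n p x => normc (teval (tmult (fun k => (m n k)%:C) p) x)).
Proof.
move=> + sD; have half_tame v L (c : nat -> int) : primitive v -> all_primitive L ->
    (size L <= D)%N -> tame D K (fun n p x =>
      normc (teval (tmult (fun k => (hspace v (c n) k * halfs L k)%:C) p) x)).
  move=> pv pL LD; have := tame_half_space K0 c pv pL LD.
  congr (tame D K _); apply/funext => n; apply/funext => p; apply/funext => x.
  by rewrite /thalf /thalfs tmult_comp; congr (normc (teval (tmult _ p) x));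
    apply/funext => k; rewrite rmorphM.
elim=> {m} [i b L si pL sL|L pL sL|m1 m2 _ h1 _ h2|a m _ h|m m' _ h e].
- apply: (@half_tame (axis b i) L (fun n => n%:Z)) => //; first exact: primitive_axis.
  by rewrite -ltnS (leq_trans sL).
- case: L pL sL => [_ _|[v c] L pL sL].
    (* The identity is the sum of the projections onto the complementary half-spaces [k_i0 <= 0] and
       [- k_i0 <= -1]. *)
    have t0 (b : bool) := @half_tame (axis b i0) [::] (fun=> if b then 0 else -1)
      (primitive_axis b i0) (fun h => ltac:(by [])) (leq0n _).
    apply: (tame_add ltr01 (t0 true) (t0 false)) => //.
    + by move=> *; exact: normc_ge0.
    + by move=> *; exact: normc_ge0.
    move=> n p x; rewrite mul1r; apply: le_trans (le_normcD _ _).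
    rewrite !teval_tmult -big_split /= le_eqVlt; apply/orP; left; apply/eqP.
    congr normc; apply: eq_bigr => t _; rewrite /halfs !big_nil !mulr1 /hspace !fdot_axis.
    have -> : (- t.1 i0 <= -1) = ~~ (t.1 i0 <= 0) by lia.
    by case: (t.1 i0 <= 0) => /=; ring.
  (* The first fixed half-space takes the role of the moving one, with constant position; at most
     [D] remain. *)
  have := @half_tame v L (fun=> c) (pL (v, c) (mem_head _ _)).
  have pL' : all_primitive L by move=> h hL; apply: pL; rewrite inE hL orbT.
  move=> /(_ pL'); have sL' : (size L <= D)%N by rewrite -ltnS (leq_trans sL).
  move=> /(_ sL'); congr (tame D K _).
  apply/funext => n; apply/funext => p; apply/funext => x.
  by congr (normc (teval (tmult _ p) x)); apply/funext => k; rewrite halfs_cons.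
- apply: (tame_add ltr01 h1 h2) => //.
  + by move=> *; exact: normc_ge0.
  + by move=> *; exact: normc_ge0.
  move=> n p x; rewrite mul1r; apply: le_trans (le_normcD _ _).
  rewrite !teval_tmult -big_split /= le_eqVlt; apply/orP; left; apply/eqP.
  by congr normc; apply: eq_bigr => t _; rewrite rmorphD /=; ring.
- have a0 : 0 < `|a| + 1 by rewrite ltr_wpDl.
  apply: (tame_add a0 h h) => //.
  + by move=> *; exact: normc_ge0.
  + by move=> *; exact: normc_ge0.
  move=> n p x.
  have -> : teval (tmult (fun k => (a * m n k)%:C) p) x =
      a%:C * teval (tmult (fun k => (m n k)%:C) p) x.
    by rewrite !teval_tmult mulr_sumr; apply: eq_bigr => t _; rewrite rmorphM /=; ring.
  rewrite normcM normcZ; apply: ler_pM; rewrite ?normc_ge0 ?lerDl//.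
  exact: normc_ge0.
- suff -> : m' = m by [].
  by apply/funext => n; apply/funext => k.
Qed.

End tame_multipliers.
End cube_multipliers.

(** * Fourier coefficients and square partial sums as multipliers *)

Section fourier_coefficients.
Local Open Scope complex_scope.
Context {R : realType} {d : nat}.
Local Notation C := R[i].
Local Notation mu := (@lebesgue_rvec R d).
Local Notation T := (torus_cube d : set (rvec R d)).
Local Notation J f := (Rintegral mu T f).
Local Notation V := (fine (mu T)).
Implicit Types (k : d.-tuple int) (x : rvec R d) (p : @tpoly R d) (f g h : rvec R d -> C).

Let mT : measurable T := @cube_measurable R d.
Let fT : (mu T < +oo)%E := @cube_fin R d.
Let VE : V = (2 * pi) ^+ d. Proof. by rewrite lebesgue_cube. Qed.
Let Vgt0 : 0 < V. Proof. by rewrite VE exprn_gt0// mulr_gt0// pi_gt0. Qed.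

Definition ffreq k : freq d := [ffun j => tnth k j].
Definition tfreq (l : freq d) : d.-tuple int := [tuple l j | j < d].

Lemma tfreqK : cancel tfreq ffreq.
Proof. by move=> l; apply/ffunP => j; rewrite ffunE tnth_mktuple. Qed.

Lemma ffreqK : cancel ffreq tfreq.
Proof. by move=> k; apply: eq_from_tnth => j; rewrite tnth_mktuple ffunE. Qed.

Lemma dotk_phase k x : dotk k x = phase (ffreq k) x.
Proof. by apply: eq_bigr => j _; rewrite ffunE. Qed.

Lemma tchar_dotk k x : tchar (ffreq k) x = expi (dotk k x).
Proof. by rewrite /tchar dotk_phase. Qed.

Lemma finite_freq_cube n : finite_set (freq_cube d n).
Proof.
pose F (c : {ffun 'I_d -> 'I_(n + n).+1}) : d.-tuple int := [tuple (c j)%:Z - n%:Z | j < d].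
have -> : freq_cube d n = [set F c | c in [set: {ffun 'I_d -> 'I_(n + n).+1}]].
  apply/seteqP; split => [k kn|_ [c _ <-] j]; last first.
    rewrite tnth_mktuple; have := ltn_ord (c j); lia.
  exists [ffun j => inord (absz (tnth k j + n%:Z))] => //.
  apply: eq_from_tnth => j; rewrite tnth_mktuple ffunE.
  have := kn j; move: (tnth k j) => z /andP[z1 z2].
  by rewrite inordK; lia.
by apply: finite_image; exact: finite_finset.
Qed.

Definition cube_seq n : seq (d.-tuple int) := finmap.enum_fset (fset_set (freq_cube d n)).

Lemma mem_cube_seq n k : (k \in cube_seq n) = `[< freq_cube d n k >].
Proof.
have := in_fset_set (finite_freq_cube n) k; rewrite /cube_seq => ->.
by apply/idP/idP; [move=> /set_mem h; apply/asboolP|move=> /asboolP h; apply/mem_set].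
Qed.

Lemma uniq_cube_seq n : uniq (cube_seq n). Proof. exact: finmap.fset_uniq. Qed.

Definition cube_mult n (l : freq d) : R := \prod_(j < d) slab n (l j).

Lemma cube_multE n l : cube_mult n l = (tfreq l \in cube_seq n)%:R.
Proof.
rewrite mem_cube_seq; have [h|h] := asboolP (freq_cube d n (tfreq l)).
  rewrite /cube_mult big1// => j _; rewrite /slab; have := h j.
  by rewrite tnth_mktuple => ->.
have [j hj] : exists j, ~~ (- n%:Z <= l j <= n%:Z).
  apply: contrapT => nex; apply: h => j; rewrite tnth_mktuple.
  by apply: contrapT => hj; apply: nex; exists j; apply/negP.
by rewrite /cube_mult (bigD1 j)//= /slab (negbTE hj) mul0r.
Qed.

Definition spart f n : @tpoly R d := [seq (ffreq k, fourier_coef f k) | k <- cube_seq n].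

Definition conj_mult (l : freq d) : C := \prod_(j < d) (- 'i%C * (sgz (l j))%:~R).

Lemma square_sumE f n x : square_sum f n x = teval (spart f n) x.
Proof.
rewrite /square_sum (fsbig_finite _ _ (finite_freq_cube n)) /teval big_map.
by apply: eq_bigr => k _; rewrite tchar_dotk.
Qed.

Lemma conj_square_sumE f n x :
  conj_square_sum f n x = teval (tmult conj_mult (spart f n)) x.
Proof.
rewrite /conj_square_sum (fsbig_finite _ _ (finite_freq_cube n)) teval_tmult big_map.
apply: eq_bigr => k _; rewrite tchar_dotk /=; congr (_ * _ * _).
by apply: eq_bigr => j _; rewrite ffunE.
Qed.

Lemma bint_Re_teval p :
  J (fun x => complex.Re (teval p x)) = V * complex.Re (\sum_(t <- p | t.1 == 0) t.2).
Proof.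
have -> : (fun x => complex.Re (teval p x)) =
    (fun x => \sum_(t <- p) complex.Re (t.2 * tchar t.1 x)).
  by apply/funext => x; rewrite /teval Re_sum.
rewrite (bint_sum mT fT); last first.
  by move=> t; have [] := bcmeasM (bcmeas_cst t.2) (bcmeas_tchar t.1).
rewrite [X in _ * complex.Re X]big_mkcond Re_sum mulr_sumr; apply: eq_bigr => t _.
case: eqP => [->|/eqP]; last by move=> /bint_tchar ->; rewrite mulr0.
under eq_Rintegral do rewrite tchar0 mulr1.
by rewrite (bint_cst mu mT) mulrC.
Qed.

Lemma torus_integral_teval p :
  torus_integral (teval p) = V%:C * \sum_(t <- p | t.1 == 0) t.2.
Proof.
rewrite /torus_integral; apply/eqP; rewrite eq_complex; apply/andP; split; apply/eqP.
  by rewrite ReZ /= bint_Re_teval.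
rewrite ImZ /=.
have e (z : C) : complex.Im z = complex.Re (- 'i%C * z).
  by case: z => a b /=; ring.
under eq_Rintegral do rewrite e -teval_scale.
rewrite bint_Re_teval big_map e; congr (_ * complex.Re _).
by rewrite mulr_sumr; apply: eq_big => t.
Qed.

Lemma fourier_coef_teval p k :
  fourier_coef (teval p) k = \sum_(t <- p | t.1 == ffreq k) t.2.
Proof.
rewrite /fourier_coef.
have -> : (fun x => teval p x * expi (- dotk k x)) = teval (tshift (- ffreq k) p).
  apply/funext => x; rewrite teval_shift mulrC; congr (_ * _).
  by rewrite /tchar dotk_phase phaseN.
rewrite torus_integral_teval VE mulrA -rmorphM mulVf ?mul1r; last first.
  by rewrite -VE gt_eqF.
by rewrite big_map; apply: eq_bigl => t; rewrite /= subr_eq0.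
Qed.

Lemma teval_spart (m : freq d -> C) p n x :
  teval (tmult m (spart (teval p) n)) x =
  teval (tmult (fun l => m l * (cube_mult n l)%:C) p) x.
Proof.
rewrite !teval_tmult big_map /=.
under eq_bigr do rewrite fourier_coef_teval big_mkcond mulr_sumr mulr_suml.
rewrite exchange_big; apply: eq_bigr => t _ /=.
rewrite cube_multE.
have [tn|tn] := boolP (tfreq t.1 \in cube_seq n); last first.
  rewrite big1_seq ?mulr0 ?mul0r// => k /= kn.
  have [tk|_] := eqVneq t.1 (ffreq k); last by rewrite mulr0 mul0r.
  by move: tn; rewrite tk ffreqK kn.
rewrite (bigD1_seq (tfreq t.1))//= ?uniq_cube_seq// tfreqK eqxx big1 ?addr0 ?mulr1//.
move=> k kt; have [tk|_] := eqVneq t.1 (ffreq k); last by rewrite mulr0 mul0r.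
by move: kt; rewrite tk ffreqK eqxx.
Qed.

Definition cint g := mu.-integrable T (fun x => (complex.Re (g x))%:E) /\
  mu.-integrable T (fun x => (complex.Im (g x))%:E).

Lemma integrable_mul_bmeas (a b : rvec R d -> R) :
  mu.-integrable T (fun x => (a x)%:E) -> bmeas b ->
  mu.-integrable T (fun x => (a x * b x)%:E).
Proof.
move=> ia [mb [M bM]]; apply: (integrableMl mT ia).
  exact: measurable_funTS.
exists M; split; first exact: num_real.
by move=> N MN x _ /=; rewrite (le_trans (bM x))// ltW.
Qed.

Lemma cintM g h : cint g -> bcmeas h -> cint (fun x => g x * h x).
Proof.
move=> [g1 g2] [h1 h2]; split.
  under [X in mu.-integrable _ X]funext do rewrite ReM EFinB.
  by apply: (integrableB mT); exact: integrable_mul_bmeas.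
under [X in mu.-integrable _ X]funext do rewrite ImM EFinD.
by apply: (integrableD mT); exact: integrable_mul_bmeas.
Qed.

Lemma ImB (z w : C) : complex.Im (z - w) = complex.Im z - complex.Im w.
Proof. by case: z w => a b []. Qed.

Lemma cintB g h : cint g -> cint h -> cint (fun x => g x - h x).
Proof.
move=> [g1 g2] [h1 h2]; split.
  under [X in mu.-integrable _ X]funext do rewrite ReB EFinB.
  exact: (integrableB mT).
under [X in mu.-integrable _ X]funext do rewrite ImB EFinB.
exact: (integrableB mT).
Qed.

Lemma cint_bcmeas g : bcmeas g -> cint g.
Proof. by move=> [b1 b2]; split; exact: (bmeas_integrable mT fT). Qed.

Lemma torus_integralB g h : cint g -> cint h ->
  torus_integral (fun x => g x - h x) = torus_integral g - torus_integral h.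
Proof.
move=> [g1 g2] [h1 h2]; rewrite /torus_integral.
under eq_Rintegral do rewrite ReB.
under [X in (_ +i* X)%C]eq_Rintegral do rewrite ImB.
by rewrite (RintegralB mT g1 h1) (RintegralB mT g2 h2).
Qed.

Lemma torus_integralZ (c : R) g : cint g ->
  torus_integral (fun x => c%:C * g x) = c%:C * torus_integral g.
Proof.
move=> [g1 g2]; rewrite /torus_integral.
under eq_Rintegral do rewrite ReZ.
under [X in (_ +i* X)%C]eq_Rintegral do rewrite ImZ.
rewrite (RintegralZl c mT g1) (RintegralZl c mT g2).
by apply/eqP; rewrite eq_complex /= !mul0r subr0 addr0 !eqxx.
Qed.

Lemma normc_torus_integral g : cint g ->
  normc (torus_integral g) <= 2 * J (fun x => normc (g x)).
Proof.
move=> [g1 g2]; have gn := integrable_normc g1 g2.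
rewrite (le_trans (normc_le_ReIm _))//= mulr_natl mulr2n lerD//.
  apply: (le_trans (le_normr_Rintegral mT g1)).
  by apply: (le_Rintegral mT (integrable_norm g1) gn) => x _; exact: ler_normRe.
apply: (le_trans (le_normr_Rintegral mT g2)).
by apply: (le_Rintegral mT (integrable_norm g2) gn) => x _; exact: ler_normIm.
Qed.

Lemma bcmeas_expi_dotk k : bcmeas (fun x => expi (- dotk k x) : C).
Proof.
rewrite (_ : (fun x => _) = tchar (- ffreq k)); first exact: bcmeas_tchar.
by apply/funext => x; rewrite /tchar dotk_phase phaseN.
Qed.

Lemma fourier_coefB g h k : cint g -> cint h ->
  normc (fourier_coef g k - fourier_coef h k) <= 2 / V * J (fun x => normc (g x - h x)).
Proof.
move=> ig ih; have bk := bcmeas_expi_dotk k.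
have i1 := cintM ig bk; have i2 := cintM ih bk.
rewrite /fourier_coef -mulrBr -(torus_integralB i1 i2) -VE normcM normcZ.
rewrite ger0_norm ?invr_ge0 ?(ltW Vgt0)// mulrAC mulrC ler_wpM2r ?invr_ge0 ?(ltW Vgt0)//.
apply: (le_trans (normc_torus_integral (cintB i1 i2))).
rewrite ler_wpM2l// le_eqVlt; apply/orP; left; apply/eqP; apply: eq_Rintegral => x _.
by rewrite -mulrBl normcM normc_expi mulr1.
Qed.

Lemma fourier_coefZ (c : R) g k : cint g ->
  fourier_coef (fun x => c%:C * g x) k = c%:C * fourier_coef g k.
Proof.
move=> ig; rewrite /fourier_coef mulrCA; congr (_ * _).
rewrite -(torus_integralZ _ (cintM ig (bcmeas_expi_dotk k))).
by congr torus_integral; apply/funext => x; rewrite mulrA.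
Qed.

Lemma ler_sum_size (I : Type) (r : seq I) (F : I -> R) (b : R) :
  (forall i, F i <= b) -> \sum_(i <- r) F i <= (size r)%:R * b.
Proof.
move=> Fb; elim: r => [|i r ih]; first by rewrite big_nil mul0r.
by rewrite big_cons /= -natr1 mulrDl mul1r addrC lerD.
Qed.

(** For fixed [n] partial sums depend continuously on the function in [L^1], uniformly in [x]. The
    constant grows with [n], which is harmless when the approximation is chosen after [n]. *)
Lemma teval_spartB (m : freq d -> C) g h n x : (forall l, normc (m l) <= 1) ->
  cint g -> cint h ->
  normc (teval (tmult m (spart g n)) x - teval (tmult m (spart h n)) x) <=
  (size (cube_seq n))%:R * (2 / V * J (fun y => normc (g y - h y))).
Proof.
move=> m1 ig ih; rewrite !teval_tmult !big_map -sumrB /=.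
apply: (le_trans (normc_sum _ _)).
apply: ler_sum_size => k.
rewrite -mulrBl -mulrBr !normcM normc_tchar mulr1.
by rewrite (le_trans (ler_piMl (normc_ge0 _) (m1 _)))// fourier_coefB.
Qed.

Lemma normc_conj_mult_le l : normc (conj_mult l) <= 1.
Proof.
rewrite /conj_mult; elim/big_rec: _ => [|j z _ z1].
  by rewrite -[1]/(1%:C) normcZ normr1.
rewrite !normcM normcN_i mul1r mulr_ile1 ?normc_ge0//.
have -> : (sgz (l j))%:~R = ((sgz (l j))%:~R : R)%:C :> C by rewrite rmorph_int.
by rewrite normcZ; case: sgzP; rewrite ?normr0 ?normrN ?normr1.
Qed.

Lemma conj_multE n l : conj_mult l * (cube_mult n l)%:C =
  (- 'i%C) ^+ d * (\prod_(j < d) ((sgz (l j))%:~R * slab n (l j)))%:C.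
Proof.
rewrite /conj_mult big_split /= prodr_const card_ord -mulrA; congr (_ * _).
rewrite /cube_mult big_split /= rmorphM; congr (_ * _).
by rewrite rmorph_prod; apply: eq_bigr => j _; rewrite rmorph_int.
Qed.

Lemma integral_indic (E : set (rvec R d)) (g : rvec R d -> R) :
  measurable E -> E `<=` T -> bmeas g ->
  (\int[mu]_(x in E) (g x)%:E)%E = (J (fun x => \1_E x * g x))%:E.
Proof.
move=> mE ET bg; rewrite (bint_EFin mT fT); last first.
  by apply: bmeasM => //; exact: bmeas_indic.
have -> : E = T `&` E by rewrite setIC; apply/esym/setIidPl.
rewrite integral_mkcondr; apply: eq_integral => x xT.
rewrite patchE indicE in_setI xT /=.
by case: ifPn => _ /=; rewrite ?mul1r ?mul0r.
Qed.

End fourier_coefficients.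

(** * Exponential integrability for normalized functions *)

Section exponential_integrability.
Local Open Scope complex_scope.
Context {R : realType} {d : nat}.
Local Notation C := R[i].
Local Notation mu := (@lebesgue_rvec R d).
Local Notation T := (torus_cube d : set (rvec R d)).
Local Notation J f := (Rintegral mu T f).
Local Notation V := (fine (mu T)).

Let mT : measurable T := @cube_measurable R d.
Let fT : (mu T < +oo)%E := @cube_fin R d.

Lemma tame_square_sums D K : 0 < K -> (d <= D.+1)%N -> (0 < d)%N ->
  tame D K (fun n (p : @tpoly R d) x =>
    normc (square_sum (teval p) n x) + normc (conj_square_sum (teval p) n x)).
Proof.
move=> K0 dD d0; pose i0 := Ordinal d0.
have sE : (size (index_enum 'I_d) <= D.+1)%N by rewrite -sum1_size sum_nat_const card_ord muln1.
have t (conj : bool) := multi_tame K0 i0 (@multi_slabs R d conj _ (index_enum_uniq _)) sE.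
have bt (m : freq d -> C) p : bmeas (fun x => normc (teval (tmult m p) x)).
  exact/bcmeas_normc/bcmeas_teval.
have SE p n x : normc (square_sum (teval p) n x) =
    normc (teval (tmult (fun l => (\prod_(j < d) (1 * slab n (l j)))%:C) p) x).
  rewrite square_sumE; congr normc.
  have -> : teval (spart (teval p) n) x = teval (tmult (fun=> 1) (spart (teval p) n)) x.
    by rewrite teval_scale mul1r.
  rewrite teval_spart; congr teval; congr tmult; apply/funext => l.
  rewrite mul1r /cube_mult; congr (_%:C).
  by apply: eq_bigr => j _; rewrite mul1r.
have cSE p n x : normc (conj_square_sum (teval p) n x) =
    normc (teval (tmult (fun l => (\prod_(j < d) ((sgz (l j))%:~R * slab n (l j)))%:C) p) x).
  rewrite conj_square_sumE teval_spart.
  rewrite (_ : (fun l => conj_mult l * (cube_mult n l)%:C) = (fun l => (- 'i%C) ^+ d *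
     (\prod_(j < d) ((sgz (l j))%:~R * slab n (l j)))%:C)); last first.
    by apply/funext => l; exact: conj_multE.
  rewrite -(tmult_comp (fun=> (- 'i%C) ^+ d)) teval_scale normcM normcX normcN_i.
  by rewrite expr1n mul1r.
apply: (tame_add ltr01 (t false) (t true)) => //.
- move=> n p; apply: bmeasD.
    by under [X in bmeas X]funext do rewrite SE; exact: bt.
  by under [X in bmeas X]funext do rewrite cSE; exact: bt.
- by move=> *; exact: normc_ge0.
- by move=> *; exact: normc_ge0.
by move=> n p x; rewrite mul1r SE cSE.
Qed.

Lemma bmeas_square_sums (g : rvec R d -> C) n :
  bmeas (fun x => normc (square_sum g n x) + normc (conj_square_sum g n x)).
Proof.
apply: bmeasD; apply: bcmeas_normc.
  by under [X in bcmeas X]funext do rewrite square_sumE; exact: bcmeas_teval.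
by under [X in bcmeas X]funext do rewrite conj_square_sumE; exact: bcmeas_teval.
Qed.

Lemma square_sumZ (c : R) (g : rvec R d -> C) n x : cint g ->
  square_sum (fun x => c%:C * g x) n x = c%:C * square_sum g n x.
Proof.
move=> ig; rewrite !square_sumE /teval !big_map mulr_sumr.
by apply: eq_bigr => k _; rewrite /= fourier_coefZ// mulrA.
Qed.

Lemma conj_square_sumZ (c : R) (g : rvec R d -> C) n x : cint g ->
  conj_square_sum (fun x => c%:C * g x) n x = c%:C * conj_square_sum g n x.
Proof.
move=> ig; rewrite !conj_square_sumE !teval_tmult !big_map mulr_sumr.
by apply: eq_bigr => k _; rewrite /= fourier_coefZ//; ring.
Qed.

(** [E] comes from the sequence [q] alone. For each [n] an index [N] is then chosen so that passing
    from [f] to [q N] raises the exponent by at most 1 everywhere, which costs the factor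
    [expR 1 <= 4]. *)
Theorem exp_square_sums D : (d <= D.+1)%N -> (0 < d)%N -> exists A B : R,
  [/\ 0 < A, 0 < B & forall f : rvec R d -> C, cint f -> (Logk_int D f <= 1)%E ->
    forall eps, 0 < eps -> exists E : set (rvec R d),
      [/\ measurable E, E `<=` T, (mu (T `\` E) <= eps%:E)%E & forall n,
        (\int[mu]_(x in E) (expR (A * eps *
           (normc (square_sum f n x) + normc (conj_square_sum f n x))))%:E <= B%:E)%E]].
Proof.
move=> dD d0; have [K [K0 hK]] := @block_polynomials R d D.
have [A [B [A0 B0 hAB]]] := tame_square_sums K0 dD d0.
exists A, (4 * B); split => //; first exact: mulr_gt0.
move=> f ifc fD eps eps0.
have [q [qK qcvg]] := hK f ifc.1 ifc.2 fD.
have [E [mE ET muE hE]] := hAB q qK eps eps0.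
exists E; split => // n.
have V0 : 0 < V by rewrite lebesgue_cube exprn_gt0// mulr_gt0// pi_gt0.
have a0 : 0 < A * eps by rewrite mulr_gt0.
pose b : R := 2 * ((size (@cube_seq d n))%:R * (2 / V)).
have b0 : 0 <= b by rewrite !mulr_ge0// invr_ge0 ltW.
have iq N : cint (teval (q N)) by apply: cint_bcmeas; exact: bcmeas_teval.
have [N hN] : exists N, A * eps * (b * J (fun x => normc (f x - teval (q N) x))) <= 1.
  have e1 : 0 < (A * eps * (b + 1))^-1 by rewrite invr_gt0 mulr_gt0// ltr_wpDl.
  have /fine_cvgP[_ /cvgrPdist_le /(_ _ e1) [N _ hN]] := qcvg.
  exists N; have := hN N (leqnn N); rewrite /= sub0r normrN => h.
  have J0 : 0 <= J (fun x => normc (f x - teval (q N) x)).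
    by apply: Rintegral_ge0 => x _; exact: normc_ge0.
  have {}h : J (fun x => normc (f x - teval (q N) x)) <= (A * eps * (b + 1))^-1.
    by apply: le_trans h; exact: ler_norm.
  apply: (@le_trans _ _ (A * eps * (b * (A * eps * (b + 1))^-1))).
    by rewrite ler_wpM2l ?(ltW a0)// ler_wpM2l.
  have b1 : 0 < b + 1 by rewrite ltr_wpDl.
  have -> : A * eps * (b * (A * eps * (b + 1))^-1) = b / (b + 1).
    by field; rewrite !gt_eqF.
  by rewrite ler_pdivrMr// mul1r lerDl.
pose y (g : rvec R d -> C) x := normc (square_sum g n x) + normc (conj_square_sum g n x).
have by_ g : bmeas (y g) by exact: bmeas_square_sums.
have be g : bmeas (fun x => expR (A * eps * y g x)) by apply: bmeas_exp; exact: bmeasZ.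
rewrite (integral_indic mE ET (be f)) lee_fin.
have bEe g : bmeas (fun x => \1_E x * expR (A * eps * y g x)).
  by apply: bmeasM => //; exact: bmeas_indic.
apply: (@le_trans _ _ (J (fun x => 4 * (\1_E x * expR (A * eps * y (teval (q N)) x))))).
  apply: (bint_le mT fT (bEe f) (bmeasZ _ (bEe _))) => x _.
  rewrite mulrCA ler_wpM2l ?indicE ?ler0n//.
  apply: (@le_trans _ _ (expR 1 * expR (A * eps * y (teval (q N)) x))); last first.
    by rewrite ler_wpM2r ?expR_ge0// expR1_le4.
  rewrite -expRD ler_expR -lerBlDr -mulrBr; apply: le_trans hN.
  rewrite ler_pM2l// /b.
  have h1 : normc (square_sum f n x) - normc (square_sum (teval (q N)) n x) <=
      (size (@cube_seq d n))%:R * (2 / V * J (fun x => normc (f x - teval (q N) x))).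
    rewrite !square_sumE -(mul1r (teval _ x)) -[X in _ - normc X](mul1r (teval _ x)) -!teval_scale.
    apply: le_trans (@teval_spartB R d (fun=> 1) f (teval (q N)) n x _ ifc (iq N)); last first.
      by move=> l; rewrite /= expr1n expr0n addr0 sqrtr1.
    rewrite lerBlDr; apply: le_trans (le_normcD _ _).
    by rewrite subrK.
  have h2 : normc (conj_square_sum f n x) - normc (conj_square_sum (teval (q N)) n x) <=
      (size (@cube_seq d n))%:R * (2 / V * J (fun x => normc (f x - teval (q N) x))).
    rewrite !conj_square_sumE.
    apply: le_trans (@teval_spartB R d conj_mult f (teval (q N)) n x _ ifc (iq N)); last exact: normc_conj_mult_le.
    rewrite lerBlDr; apply: le_trans (le_normcD _ _).
    by rewrite subrK.
  have dbl (s t u : R) : 2 * (s * t) * u = s * (t * u) + s * (t * u) by ring.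
  by rewrite dbl /y opprD addrACA lerD.
rewrite (bintZ mT fT _ (bEe _)); apply: ler_wpM2l; first by [].
exact: hE.
Qed.

End exponential_integrability.

(** * Rescaling by the Luxemburg norm *)

Lemma rescale_le (R : realFieldType) (A e l y N : R) : 0 <= A -> 0 <= e -> 0 <= y ->
  0 < N -> l <= 2 * N -> A / 4 * e * (l * y / N) <= A * (e / 2) * y.
Proof.
move=> A0 e0 y0 N0 lN.
have -> : A / 4 * e * (l * y / N) = A * (e / 2) * y * (l / (2 * N)).
  by field; rewrite gt_eqF.
rewrite ler_piMr//; first by rewrite !mulr_ge0// divr_ge0.
by rewrite ler_pdivrMr ?mul1r// mulr_gt0.
Qed.

Theorem corollary1 (R : realType) (d : nat) (d_ge1 : (1 <= d)%N) :
  exists gamma C : R, [/\ 0 < gamma, 0 < C &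
    forall f : rvec R d -> R[i],
      Logk_class d.-1 f ->
      ~ {ae lebesgue_rvec d, forall x, torus_cube d x -> f x = 0} ->
    forall eps : R, 0 < eps ->
    exists E : set (rvec R d),
      [/\ measurable E, E `<=` torus_cube d,
          (((2 * pi) ^+ d - eps)%:E < lebesgue_rvec d E)%E &
          forall n : nat, (1 <= n)%N ->
            (\int[lebesgue_rvec d]_(x in E)
               (expR (gamma * eps *
                  ((normc (square_sum f n x) + normc (conj_square_sum f n x))
                   / Logk_norm d.-1 f)))%:E
             <= C%:E)%E]].
Proof.
have [A [B [A0 B0 h]]] := @exp_square_sums R d d.-1 (leqSpred d) d_ge1.
have VE := @lebesgue_cube R d; set V := (2 * pi) ^+ d in VE *.
have V0 : 0 < V by rewrite exprn_gt0// mulr_gt0// pi_gt0.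
have mT := @cube_measurable R d; have fT := @cube_fin R d.
exists (A / 4), (B + V); split; first by rewrite divr_gt0.
  exact: addr_gt0.
move=> f [[_ iRe iIm] _] _ eps eps0.
have icf : cint f by [].
(* Division by a zero norm yields 0, so the exponential is 1 and the whole cube works with bound
   [V]; this is the summand [V] of the constant. *)
have [n0|n0] := eqVneq (Logk_norm d.-1 f) 0.
  exists (torus_cube d); split => //.
    by rewrite VE lte_fin ltrBlDr ltrDl.
  move=> n _; rewrite n0.
  under eq_integral do rewrite invr0 mulr0 mulr0 expR0.
  apply: (@le_trans _ _ V%:E); last by rewrite lee_fin lerDr ltW.
  by rewrite -VE integral_cst// mul1e.
pose S := [set l : R | 0 < l /\ (Logk_int d.-1 (fun x => f x / l%:C%C)%R <= 1)%E].
have nE : Logk_norm d.-1 f = inf S by [].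
(* The infimum of the empty set is 0 by convention, a value just excluded. *)
have S0 : S !=set0.
  by apply/set0P/eqP => S0; move: n0; rewrite nE S0 inf0 eqxx.
have norm0 : 0 < Logk_norm d.-1 f.
  rewrite lt_neqAle eq_sym n0 nE /=.
  by apply: lb_le_inf => // l [l0 _]; exact: ltW.
(* An admissible scale below twice the infimum, whether or not the infimum is attained; it costs one
   factor 2 of the 4 in [A / 4]. *)
have [l [l0 fl] l2] : exists2 l, S l & l < 2 * Logk_norm d.-1 f.
  by apply: inf_lt => //; rewrite -nE ltr_pMl// ltr1n.
pose f0 x := (l^-1)%:C%C * f x.
have f0E : (fun x => f x / l%:C%C) = f0.
  by apply/funext => x; rewrite /f0 mulrC fmorphV.
rewrite f0E in fl.
have ic0 : cint f0.
  have [] := cintM icf (bcmeas_cst (l^-1)%:C%C).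
  by rewrite /f0; split; under [X in _.-integrable _ X]funext do rewrite mulrC.
have fE : f = fun x => l%:C%C * f0 x.
  by apply/funext => x; rewrite /f0 mulrA -rmorphM mulfV ?gt_eqF// mul1r.
(* Half of [eps] makes the measure inequality strict; this is the other factor 2. *)
have e2 : 0 < eps / 2 by rewrite divr_gt0.
have [E [mE ET muE hE]] := h f0 ic0 fl _ e2.
exists E; split => //.
  have TE : torus_cube d = E `|` (torus_cube d `\` E) by rewrite setDUK.
  have mD : measurable (torus_cube d `\` E) by exact: measurableD.
  have le1 : (V%:E <= lebesgue_rvec d E + (eps / 2)%:E)%E.
    by rewrite -VE {1}TE; apply: le_trans (measureU2 _ mE mD) (leeD2l _ muE).
  have fE' : lebesgue_rvec d E \is a fin_num.
    by rewrite ge0_fin_numE// (le_lt_trans _ fT)// le_measure ?inE.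
  move: le1; rewrite -(fineK fE') -EFinD !lee_fin lte_fin => le1.
  by rewrite ltrBlDr (le_lt_trans le1)// ltrD2l ltr_pdivrMr// ltr_pMr// ltr1n.
move=> n _; apply: (@le_trans _ _ B%:E); last by rewrite lee_fin lerDl ltW.
apply: le_trans (hE n).
have by_ (g : rvec R d -> R[i]) := bmeas_square_sums g n.
have bexp (g : rvec R d -> R[i]) (c : R) : measurable_fun E (fun x => (expR (c *
    (normc (square_sum g n x) + normc (conj_square_sum g n x))))%:E).
  apply/measurable_EFinP; apply: measurable_funTS.
  by have [] := bmeas_exp (bmeasZ c (by_ g)).
apply: ge0_le_integral => //.
  apply: eq_measurable_fun (bexp f (A / 4 * eps / Logk_norm d.-1 f)) => x _.
  by rewrite mulrA mulrAC.
move=> x _; rewrite lee_fin ler_expR.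
move: (Logk_norm d.-1 f) norm0 l2 => N norm0 l2.
rewrite [in leLHS]fE square_sumZ// conj_square_sumZ// !normcM !normcZ gtr0_norm// -mulrDr.
set y := _ + _; have y0 : 0 <= y by rewrite addr_ge0// normc_ge0.
by apply: rescale_le => //; exact: ltW.
Qed.
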